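(* For each $s>1$ there exist $N\in\mathbb{N}$ and a $\frac1s$-Hölder continuous map $g:[0,1]\to\mathbb{R}^N$ such that $\Gamma_s=g([0,1])$ satisfies $\mathcal{H}^s(\Gamma_s)>0$, for $\mathcal{H}^s$-a.e. $x\in\Gamma_s$ the set $\mathrm{Tan}(\Gamma_s,x)$ contains infinitely many pairwise non-homeomorphic tangents, and moreover for $\mathcal{H}^s$-a.e. $x\in\Gamma_s$ there exists $T\in\mathrm{Tan}(\Gamma_s,x)$ with the following property: if $Q\subset\mathbb{R}^n$ (any $n$) is a self-similar set with $\dim_H Q=s$, then the set of points $z\in Q$ for which $T$ is bi-Lipschitz homeomorphic to an element of $\mathrm{Tan}(Q,z)$ is $\mathcal{H}^s$-null.
   Context: A compact set $Q\subset\mathbb{R}^n$ is self-similar if it is the attractor (unique nonempty compact $Q=\bigcup_i\phi_i(Q)$) of a finite family $\{\phi_i\}$ of contracting similarities of $\mathbb{R}^n$ satisfying the open set condition: there is a nonempty open $U$ with $\phi_i(U)\subset U$ and $\phi_i(U)\cap\phi_j(U)=\emptyset$ for $i\neq j$. For nonempty $A,B$, $\mathrm{exc}(A,B)=\sup_{a\in A}\inf_{b\in B}|a-b|$; closed sets $X_m$ converge to a closed set $X$ (Attouch–Wets) if for every $r>0$, $\mathrm{exc}(X_m\cap\overline{B}(\mathbf{0},r),X)\to0$ and $\mathrm{exc}(X\cap\overline{B}(\mathbf{0},r),X_m)\to0$. A closed set $T\ni\mathbf{0}$ is a tangent of $X$ at $x\in X$ if $r_m^{-1}(X-x)\to T$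 for some $r_m\downarrow0$; $\mathrm{Tan}(X,x)$ is the set of tangents. *)

(* Defs.v *)
From HB Require Import structures.
From mathcomp Require Import all_boot all_order all_algebra.
From mathcomp Require Import all_classical all_reals all_analysis.
Set Implicit Arguments. Unset Strict Implicit. Unset Printing Implicit Defensive.
Import Order.TTheory GRing.Theory Num.Theory.
Import numFieldNormedType.Exports.
Local Open Scope classical_set_scope.
Local Open Scope ring_scope.

Section Defs.
Variable R : realType.

Definition enorm (n : nat) (v : 'rV[R]_n) : R :=
  Num.sqrt (\sum_(i < n) (v ord0 i) ^+ 2).
Definition edist (n : nat) (x y : 'rV[R]_n) : R := enorm (x - y).

(* diameter (in \bar R; -oo for the empty set, not used) *)
Definition diam (n : nat) (A : set 'rV[R]_n) : \bar R :=
  ereal_sup [set (edist x y)%:E | x in A & y in A].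

Definition epow (d : \bar R) (t : R) : \bar R :=
  match d with
  | r%:E => (r `^ t)%:E
  | +oo%E => +oo%E
  | -oo%E => 0%E
  end.

Definition hcontent (n : nat) (t : R) (U : set 'rV[R]_n) : \bar R :=
  if pselect (U !=set0) then epow (diam U) t else 0%E.

Definition hausdorff_delta (n : nat) (t d : R) (A : set 'rV[R]_n) : \bar R :=
  ereal_inf [set S | exists U : nat -> set 'rV[R]_n,
     [/\ A `<=` \bigcup_i U i, (forall i, (diam (U i) <= d%:E)%E) &
         S = (\sum_(i <oo) hcontent t (U i))%E]].

Definition hausdorff (n : nat) (t : R) (A : set 'rV[R]_n) : \bar R :=
  ereal_sup [set hausdorff_delta t d A | d in [set d : R | 0 < d]].

Definition hdim (n : nat) (A : set 'rV[R]_n) : \bar R :=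
  ereal_inf [set t%:E | t in [set t : R | 0 <= t /\ hausdorff t A = 0%E]].

Definition hae (n : nat) (t : R) (A : set 'rV[R]_n) (P : 'rV[R]_n -> Prop) :=
  hausdorff t [set x | A x /\ ~ P x] = 0%E.

(* excess exc(A,B) = sup_{a in A} inf_{b in B} |a-b|, with exc(set0,B) = 0 *)
Definition exc (n : nat) (A B : set 'rV[R]_n) : \bar R :=
  maxe 0%E (ereal_sup [set ereal_inf [set (edist a b)%:E | b in B] | a in A]).

Definition cball0 (n : nat) (r : R) : set 'rV[R]_n := [set x | enorm x <= r].

Definition aw_cvg (n : nat) (X : nat -> set 'rV[R]_n) (Y : set 'rV[R]_n) :=
  forall r : R, 0 < r ->
    ((fun m => exc (X m `&` cball0 (n:=n) r) Y) @ \oo --> 0%E) /\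
    ((fun m => exc (Y `&` cball0 (n:=n) r) (X m)) @ \oo --> 0%E).

Definition blowup (n : nat) (X : set 'rV[R]_n) (x : 'rV[R]_n) (r : R) :=
  [set r^-1 *: (y - x) | y in X].

Definition Tan (n : nat) (X : set 'rV[R]_n) (x : 'rV[R]_n) (T : set 'rV[R]_n) :=
  [/\ X x, closed T, T 0 &
   exists r : nat -> R, [/\ (forall m, 0 < r m), (forall m, r m.+1 <= r m),
     (r @ \oo --> (0 : R)) & aw_cvg (fun m => blowup X x (r m)) T]].

Definition homeomorphic (n m : nat) (A : set 'rV[R]_n) (B : set 'rV[R]_m) :=
  exists (f : 'rV[R]_n -> 'rV[R]_m) (g : 'rV[R]_m -> 'rV[R]_n),
  [/\ f @` A = B, g @` B = A, {within A, continuous f} /\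
      {within B, continuous g},
      (forall a, A a -> g (f a) = a) & (forall b, B b -> f (g b) = b)].

Definition bilip_equiv (n m : nat) (A : set 'rV[R]_n) (B : set 'rV[R]_m) :=
  exists (f : 'rV[R]_n -> 'rV[R]_m) (L : R), 0 < L /\ f @` A = B /\
   forall a b, A a -> A b ->
     L^-1 * edist a b <= edist (f a) (f b) <= L * edist a b.

Definition contr_similarity (n : nat) (phi : 'rV[R]_n -> 'rV[R]_n) :=
  exists r : R, 0 < r < 1 /\ forall x y, edist (phi x) (phi y) = r * edist x y.

Definition self_similar (n : nat) (Q : set 'rV[R]_n) :=
  exists (k : nat) (phi : 'I_k -> 'rV[R]_n -> 'rV[R]_n),
  [/\ (0 < k)%N, (forall i, contr_similarity (phi i)),
      (exists U : set 'rV[R]_n, [/\ open U, U !=set0,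
          (forall i, phi i @` U `<=` U) &
          (forall i j, i != j -> phi i @` U `&` phi j @` U = set0)]) &
      [/\ compact Q, Q !=set0 & Q = \bigcup_i (phi i @` Q)]].

Definition holder01 (n : nat) (g : R -> 'rV[R]_n) (a : R) :=
  exists C : R, forall t u, 0 <= t <= 1 -> 0 <= u <= 1 ->
    edist (g t) (g u) <= C * `|t - u| `^ a.

End Defs.

(* Main.v *)
(* The curve is a vector of lacunary sums [sum_p lam^(-dp) w(2^(dp + r) t)] with [lam = 2^(1/s)], which turn
   the distance on the time line into its power 1/s. The levels [p] are cut into blocks. In block [i] the time
   is replaced by its position on a line to which clusters of k_i loops are attached at scale 2^(-n_i); long
   gaps keep different blocks from interfering, and every k occurs as k_i infinitely often. Since times are
   brought together only boundedly often, the image has positive H^s measure. Almost every time falls, for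
   each k, infinitely often very close to a cluster of k loops, so that the snowflaked line T_k with k loops is
   a tangent at almost every point.

   T_k has exactly k points whose removal leaves at least three pieces, so the T_k are pairwise not
   homeomorphic. The loop of T_1 gives three points joined by arbitrarily fine chains, each chain staying away
   from the third point by a fixed distance. If T_1 were bi-Lipschitz to a tangent of a self-similar set Q,
   such configurations would pass to Q, then to small similar copies of Q near each of its points, hence to
   each ball of the tangent and to each ball of T_1; but T_1 is an arc away from its loop. *)

Require Import Defs.
From HB Require Import structures.
From mathcomp Require Import all_boot all_order all_algebra.
From mathcomp Require Import all_classical all_reals all_analysis.
From mathcomp Require Import zify ring lra.
Set Implicit Arguments.
Unset Strict Implicit.
Unset Printing Implicit Defensive.
Import Order.TTheory GRing.Theory Num.Theory.
Import numFieldNormedType.Exports.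
Local Open Scope classical_set_scope.
Local Open Scope ring_scope.
Local Notation edist := Defs.edist.

(** * Distance to the nearest integer *)

(** Levels are sorted by their residue modulo [d] into separate coordinates, so inside a coordinate
    the frequencies jump by 2^d = [be * ga]. Levels beyond a given one form a geometric series of
    ratio 1/[be], levels before it one of ratio 1/[ga]; with both at least 512, the level matching a
    given distance dominates. Here s > 1 enters, [ga] being a power of 2/lam. The obstacle is that
    loops identify times. Earlier blocks still see the full time distance of an identified pair,
    hence a gap [AA] long enough for their total contribution to drop below the smallest amplitude
    of the block. Later blocks consist of waves of much shorter period, which may agree on the pair,
    so identifications could pile up from block to block; one isolated slow wave at the start of
    each block undoes those of the block before. Positive measure is a mass distribution argument
    with Lebesgue measure in time. In the last claim the exceptional set turns out to be empty: what
    counts in a chain configuration is the ratio of step to distance, which similarities preserve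
    and bi-Lipschitz maps change by at most L^2. *)

Section DistInt.
Variable R : realType.
Implicit Types a b u v : R.

Definition dz a : R := Num.min (a - (Num.floor a)%:~R) ((Num.floor a)%:~R + 1 - a).

Lemma floor_bounds a : (Num.floor a)%:~R <= a /\ a < (Num.floor a)%:~R + 1.
Proof. by split; [exact: floor_le | have := floorD1_gt a; rewrite intrD]. Qed.

Lemma floor_unique a (z : int) : z%:~R <= a -> a < z%:~R + 1 -> Num.floor a = z.
Proof. by move=> h1 h2; apply: floor_def; rewrite h1 intrD. Qed.

Lemma floor_shift a (z : int) : Num.floor (z%:~R + a) = z + Num.floor a.
Proof.
have [h1 h2] := floor_bounds a.
by apply: floor_unique; rewrite intrD; lra.
Qed.

Lemma dz_ge0 a : 0 <= dz a.
Proof. by have [h1 h2] := floor_bounds a; rewrite /dz le_min; apply/andP; split; lra. Qed.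

Lemma dz_le_half a : dz a <= 1 / 2.
Proof.
have [h1 h2] := floor_bounds a; rewrite /dz ge_min.
by apply/orP; have [h|h] := leP (a - (Num.floor a)%:~R) (1/2); [left|right; lra].
Qed.

Lemma dz_shift a (z : int) : dz (z%:~R + a) = dz a.
Proof. by rewrite /dz floor_shift intrD; congr Num.min; lra. Qed.

Lemma dz_le_abs a : dz a <= `|a|.
Proof.
have [h1 h2] := floor_bounds a; rewrite /dz ge_min; apply/orP.
have [h|h] := leP 0 a; [left|right].
  have hz : 0 <= (Num.floor a)%:~R :> R by rewrite ler0z floor_ge0.
  by rewrite ger0_norm; lra.
have h3 : Num.floor a < 0 by rewrite floor_lt_int.
have h4 : Num.floor a <= -1 by lia.
have hz : (Num.floor a)%:~R <= -1 :> R by move: h4; rewrite -(ler_int R).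
by rewrite ltr0_norm //; lra.
Qed.

Lemma dz_ex a : exists2 z : int, dz a = `|a - z%:~R| & `|a - z%:~R| <= 1 / 2.
Proof.
have [h1 h2] := floor_bounds a; have hh := dz_le_half a.
have [h|h] := leP (a - (Num.floor a)%:~R) ((Num.floor a)%:~R + 1 - a).
  have e : dz a = a - (Num.floor a)%:~R by rewrite /dz min_l.
  by exists (Num.floor a); rewrite ger0_norm ?subr_ge0 // -e.
have e : dz a = (Num.floor a)%:~R + 1 - a by rewrite /dz min_r // ltW.
by exists (Num.floor a + 1); rewrite distrC ger0_norm intrD ?subr_ge0 ?(ltW h2) // -e.
Qed.

Lemma dz_le_dist a (z : int) : dz a <= `|a - z%:~R|.
Proof. by rewrite -(dz_shift a (- z)) (le_trans (dz_le_abs _)) // intrN addrC. Qed.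

Lemma dzN a : dz (- a) = dz a.
Proof.
have le b : dz (- b) <= dz b.
  have [z -> _] := dz_ex b; rewrite (le_trans (dz_le_dist _ (- z))) //.
  by rewrite intrN opprK distrC addrC.
by apply/eqP; rewrite eq_le le -{1}(opprK a) le.
Qed.

Lemma dzC a b : dz (a - b) = dz (b - a).
Proof. by rewrite -opprB dzN. Qed.

Lemma dzD a b : dz (a + b) <= dz a + dz b.
Proof.
have [z -> _] := dz_ex a; have [z' -> _] := dz_ex b.
rewrite (le_trans (dz_le_dist _ (z + z'))) // (le_trans _ (ler_normD _ _)) //.
by rewrite intrD opprD addrACA.
Qed.

Lemma dz_lip a b : `|dz a - dz b| <= dz (a - b).
Proof.
have h1 := dzD (a - b) b; have h2 := dzD (b - a) a; rewrite !subrK in h1 h2.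
by rewrite ler_norml -(dzC a b) in h2 *; apply/andP; split; lra.
Qed.

Lemma dz_small a : `|a| <= 1 / 2 -> dz a = `|a|.
Proof.
move=> ha; apply/eqP; rewrite eq_le dz_le_abs /=.
have [z -> _] := dz_ex a.
have [->|z0] := eqVneq z 0; first by rewrite subr0.
have h1 : 1 <= `|z%:~R| :> R.
  by rewrite -intr_norm -[1]/(1%:~R) ler_int; lia.
have := lerB_dist z%:~R a; rewrite (distrC a); lra.
Qed.

Lemma dz_natM (m : nat) a : dz (m%:R * a) <= m%:R * dz a.
Proof.
have [z -> _] := dz_ex a; rewrite (le_trans (dz_le_dist _ (m%:Z * z))) //.
by rewrite intrM -mulrBr normrM normr_nat.
Qed.

Lemma dz_pow2M (n : nat) a : dz (2 ^+ n * a) <= 2 ^+ n * dz a.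
Proof. by rewrite -natrX dz_natM. Qed.

Lemma dz_int (z : int) : dz z%:~R = 0.
Proof. by apply/eqP; rewrite eq_le dz_ge0 (le_trans (dz_le_dist _ z)) // subrr normr0. Qed.

(** The two values play the parts of sine and cosine. Subtracting 1/4 makes the shifted wave vanish
    at integers too, so that integer phases disappear from the sums. *)
Definition wave (c : bool) a : R := if c then dz (a + 1 / 4) - 1 / 4 else dz a.

Lemma wave_abs c a : `|wave c a| <= 1 / 2.
Proof.
rewrite /wave ler_norml; have := dz_ge0 a; have := dz_le_half a.
by have := dz_ge0 (a + 1 / 4); have := dz_le_half (a + 1 / 4); case: c => *; apply/andP; split; lra.
Qed.

Lemma wave_lip c a b : `|wave c a - wave c b| <= dz (a - b).
Proof.
case: c; rewrite /wave; last exact: dz_lip.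
have := dz_lip (a + 1 / 4) (b + 1 / 4).
have -> : a + 1 / 4 - (b + 1 / 4) = a - b by lra.
by have -> : forall x y : R, x - 1 / 4 - (y - 1 / 4) = x - y by move=> x y; lra.
Qed.

Lemma wave_shift c a (z : int) : wave c (z%:~R + a) = wave c a.
Proof. by case: c; rewrite /wave -?addrA dz_shift. Qed.

Lemma wave_int c (z : int) : wave c z%:~R = 0.
Proof.
case: c; rewrite /wave; last exact: dz_int.
by rewrite dz_shift dz_small ger0_norm; lra.
Qed.

Lemma dz_quarter a (z : int) (al := a - z%:~R) : `|al| <= 1 / 2 ->
  dz (a + 1 / 4) = if al <= 1 / 4 then `|al + 1 / 4| else 3 / 4 - al.
Proof.
move=> h; have /ler_normlP[h1 h2] := h.
case: ifPn => [h3|]; last rewrite -ltNge => h3.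
  rewrite -(dz_shift _ (- z)) intrN.
  have -> : - z%:~R + (a + 1 / 4) = al + 1 / 4 by rewrite /al; lra.
  by rewrite dz_small // ler_norml; apply/andP; split; lra.
rewrite -(dz_shift _ (- z - 1)) intrD intrN.
have -> : - z%:~R + (-1)%:~R + (a + 1 / 4) = al - 3 / 4 by rewrite /al; lra.
have hn : `|al - 3 / 4| = 3 / 4 - al by rewrite ler0_norm; lra.
by rewrite dz_small hn //; lra.
Qed.

Lemma dz_sub_both a b (z z' : int) (al := a - z%:~R) (be := b - z'%:~R) :
  dz (a - b) <= `|al - be| /\ dz (a - b) <= `|1 - `|al - be| |.
Proof.
split.
  rewrite (le_trans (dz_le_dist _ (z - z'))) // intrB.
  by have -> : a - b - (z%:~R - z'%:~R) = al - be by rewrite /al /be; lra.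
have [h|h] := ger0P (al - be).
  rewrite (le_trans (dz_le_dist _ (z - z' + 1))) // intrD intrB mulr1z distrC.
  by have -> : z%:~R - z'%:~R + 1 - (a - b) = 1 - (al - be) by rewrite /al /be; lra.
rewrite (le_trans (dz_le_dist _ (z - z' - 1))) // intrD intrB mulrN1z.
by have -> : a - b - (z%:~R - z'%:~R - 1) = 1 - - (al - be) by rewrite /al /be; lra.
Qed.

(** Nearly mirror-image remainders are what the even function [dz] confuses. The copy shifted by 1/4
    is monotone between its folds at -1/4 and 1/4 and sees their difference. *)
Lemma wave_sep_opp (al be D : R) : 0 <= al <= 1 / 2 -> - (1 / 2) <= be <= 0 ->
  D <= al - be -> D <= 1 - (al - be) -> 2 * `|al + be| < D ->
  D <= 2 * `|(if al <= 1 / 4 then `|al + 1 / 4| else 3 / 4 - al) -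
             (if be <= 1 / 4 then `|be + 1 / 4| else 3 / 4 - be)|.
Proof.
move=> /andP[a1 a2] /andP[b1 b2] d1 d2; have [p|p] := ger0P (al + be) => h0.
all: rewrite (_ : be <= 1 / 4); last lra.
all: have [i1|i1] := leP al (1 / 4).
all: rewrite ?(ger0_norm (_ : 0 <= al + 1 / 4)); try lra.
all: have [s1|s1] := ger0P (be + 1 / 4).
all: have key : forall x : R, D <= 2 * x -> D <= 2 * `|x|
  by move=> x hx; apply: le_trans hx _; rewrite ler_pM2l // ler_norm.
all: by apply: key; lra.
Qed.

(* [c |-> wave c] maps the circle R/Z onto a square, with comparable metrics. *)
Lemma wave_sep a b : exists c, dz (a - b) <= 2 * `|wave c a - wave c b|.
Proof.
have [z ea ha] := dz_ex a; have [z' eb hb] := dz_ex b.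
have qa := dz_quarter ha; have qb := dz_quarter hb.
have [d1 d2] := dz_sub_both a b z z'.
move: ea eb ha hb qa qb d1 d2; rewrite /=.
set al := a - z%:~R; set be := b - z'%:~R => ea eb ha hb qa qb d1 d2.
have /ler_normlP[ha1 ha2] := ha; have /ler_normlP[hb1 hb2] := hb.
have [c0|] := leP (dz (a - b)) (2 * `|wave false a - wave false b|).
  by exists false.
rewrite /wave ea eb => c0; exists true; rewrite qa qb.
have -> : forall x y : R, x - 1 / 4 - (y - 1 / 4) = x - y by move=> x y; lra.
have [s1|s1] := leP 0 al; have [s2|s2] := leP 0 be.
- by rewrite (ger0_norm s1) (ger0_norm s2) in c0; have := normr_ge0 (al - be); move=> ?; lra.
- rewrite (ger0_norm s1) (ltr0_norm s2) opprK in c0.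
  rewrite ger0_norm in d1; last lra.
  rewrite !ger0_norm in d2; [|lra..].
  by apply: wave_sep_opp; rewrite ?s1; lra.
- rewrite (ltr0_norm s1) (ger0_norm s2) -opprD normrN in c0.
  rewrite ler0_norm in d1; last lra.
  rewrite (ler0_norm (_ : al - be <= 0)) in d2; last lra.
  rewrite ger0_norm in d2; last lra.
  by rewrite distrC; apply: wave_sep_opp; rewrite ?(addrC be); lra.
- by rewrite (ltr0_norm s1) (ltr0_norm s2) -opprD normrN in c0; have := normr_ge0 (al - be); move=> ?; lra.
Qed.

Lemma max0P a : (0 <= a /\ Num.max 0 a = a) \/ (a <= 0 /\ Num.max 0 a = 0).
Proof. by have [h|h] := leP 0 a; [left | right; rewrite ltW]. Qed.

Lemma min1P a : (a <= 1 /\ Num.min 1 a = a) \/ (1 <= a /\ Num.min 1 a = 1).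
Proof. by have [h|h] := leP a 1; [left | right; rewrite ltW]. Qed.

Lemma intr_succ_le (p q : int) : p < q -> p%:~R + 1 <= q%:~R :> R.
Proof. by move=> h; rewrite -[1]/(1%:~R) -intrD ler_int; lia. Qed.

Section Path.
Variable S : int -> bool.

(* In a cell marked by [S] the path first runs once around a loop ([pathY], a coordinate modulo 1, while
   [pathX] stays at the left end) and then crosses the cell at double speed. *)
Definition pathX v : R := let q := Num.floor v in
  if S q then q%:~R + Num.max 0 (2 * (v - q%:~R) - 1) else v.
Definition pathY v : R := let q := Num.floor v in
  if S q then Num.min 1 (2 * (v - q%:~R)) else 0.

Lemma pathX_near v : v - 1 / 2 <= pathX v <= v.
Proof.
have [h1 h2] := floor_bounds v; rewrite /pathX /=.
case: ifP => _; last by apply/andP; split; lra.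
by rewrite /Num.max; case: ltP => h; apply/andP; split; lra.
Qed.

Lemma pathX_floor v (q := (Num.floor v)%:~R : R) :
  [/\ q <= pathX v, pathX v < q + 1, pathX v - q <= 2 * (v - q) &
      q + 1 - pathX v <= 2 * (q + 1 - v)].
Proof.
have [h1 h2] := floor_bounds v; rewrite /q /pathX /=.
case: ifP => _; last by split; lra.
by rewrite /Num.max; case: ltP => h; split; lra.
Qed.

Lemma pathX_lip u v : u <= v -> 0 <= pathX v - pathX u <= 2 * (v - u).
Proof.
move=> uv; have [u1 u2] := floor_bounds u; have [v1 v2] := floor_bounds v.
have [x1 x2 x3 x4] := pathX_floor u; have [y1 y2 y3 y4] := pathX_floor v.
have pq : Num.floor u <= Num.floor v by exact: le_floor.
have [e|ne] := eqVneq (Num.floor u) (Num.floor v).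
  rewrite /pathX /= e; case: ifP => _; last by apply/andP; split; lra.
  have [[h1 ->]|[h1 ->]] := max0P (2 * (v - (Num.floor v)%:~R) - 1);
  have [[h2 ->]|[h2 ->]] := max0P (2 * (u - (Num.floor v)%:~R) - 1);
  by apply/andP; split; lra.
have := @intr_succ_le (Num.floor u) (Num.floor v); rewrite lt_neqAle ne pq => /(_ isT) h.
by apply/andP; split; lra.
Qed.

Lemma pathY_itv v : 0 <= pathY v <= 1.
Proof.
have [h1 h2] := floor_bounds v; rewrite /pathY /=.
case: ifP => _; last by apply/andP; split; lra.
by rewrite /Num.min; case: ltP => h; apply/andP; split; lra.
Qed.

Lemma dz_pathY_ends v (q := (Num.floor v)%:~R : R) :
  dz (pathY v) <= 2 * (v - q) /\ dz (pathY v) <= 2 * (q + 1 - v).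
Proof.
have [h1 h2] := floor_bounds v; rewrite /q /pathY /=.
case: ifP => _; last by rewrite (dz_int 0); split; lra.
have k1 := dz_le_abs (Num.min 1 (2 * (v - (Num.floor v)%:~R))).
have k2 := dz_le_dist (Num.min 1 (2 * (v - (Num.floor v)%:~R))) 1.
move: k1 k2; rewrite /Num.min; case: ltP => h.
  by rewrite subrr normr0 => _ k; split; lra.
by rewrite ger0_norm ?ler0_norm; [move=> *; split; lra | lra..].
Qed.

Lemma pathY_lip u v : dz (pathY u - pathY v) <= 2 * `|u - v|.
Proof.
wlog uv : u v / u <= v.
  by move=> H; have [/H//|/ltW/H] := leP u v; rewrite dzC distrC.
have [u1 u2] := floor_bounds u; have [v1 v2] := floor_bounds v.
rewrite distrC ger0_norm ?subr_ge0 //.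
have pq : Num.floor u <= Num.floor v by exact: le_floor.
have [e|ne] := eqVneq (Num.floor u) (Num.floor v).
  rewrite (le_trans (dz_le_abs _)) // /pathY /= e; case: ifP => _; last by rewrite subrr normr0; lra.
  have [[h1 ->]|[h1 ->]] := min1P (2 * (v - (Num.floor v)%:~R));
  have [[h2 ->]|[h2 ->]] := min1P (2 * (u - (Num.floor v)%:~R));
  by rewrite ler_norml; apply/andP; split; lra.
have := @intr_succ_le (Num.floor u) (Num.floor v); rewrite lt_neqAle ne pq => /(_ isT) h.
have [_ y1] := dz_pathY_ends u; have [y2 _] := dz_pathY_ends v.
rewrite (le_trans (dzD _ _)) // dzN; lra.
Qed.

(** A loop has length 1 and is run at double speed, so within time 1/4 the loop coordinate moves by
    at most 1/2 and [dz] is the true distance. Where loop and line meet, one coordinate alone still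
    accounts for half of the elapsed time. *)
Lemma path_local u v : `|u - v| <= 1 / 4 ->
  `|u - v| / 2 <= Num.max `|pathX u - pathX v| (dz (pathY u - pathY v)).
Proof.
wlog uv : u v / u <= v.
  by move=> H; have [/H//|/ltW/H] := leP u v; rewrite dzC distrC (distrC (pathX u)).
have [u1 u2] := floor_bounds u; have [v1 v2] := floor_bounds v.
rewrite distrC ger0_norm ?subr_ge0 // => uv4.
have pq : Num.floor u <= Num.floor v by exact: le_floor.
rewrite le_max distrC (ger0_norm (x := pathX v - _)); last by have /andP[] := pathX_lip uv.
rewrite dzC.
have [e|ne] := eqVneq (Num.floor u) (Num.floor v).
  rewrite /pathX /pathY /= e; rewrite e in u1 u2.
  case: ifP => _; last by apply/orP; left; lra.
  set q := (Num.floor v)%:~R in u1 u2 v1 v2 *.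
  have [cu|cu] := leP u (q + 1 / 2); have [cv|cv] := leP v (q + 1 / 2).
  - apply/orP; right; rewrite !(min_r (_ : _ <= 1)); [|lra..].
    by rewrite dz_small ger0_norm; lra.
  - rewrite (min_r (_ : 2 * (u - q) <= 1)) ?(min_l (_ : 1 <= 2 * (v - q))); [|lra..].
    rewrite (max_l (_ : 2 * (u - q) - 1 <= 0)) ?(max_r (_ : 0 <= 2 * (v - q) - 1)); [|lra..].
    rewrite dz_small ger0_norm; [|lra..].
    by have [|] := leP ((v - u) / 2) (q + (2 * (v - q) - 1) - (q + 0)) => // ?; lra.
  - lra.
  - apply/orP; left; rewrite !(max_r (_ : 0 <= _)); lra.
have := @intr_succ_le (Num.floor u) (Num.floor v); rewrite lt_neqAle ne pq => /(_ isT) h.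
have e : Num.floor v = Num.floor u + 1.
  by apply: floor_unique; rewrite intrD; lra.
rewrite e intrD mulr1z in v1 v2; rewrite /pathX /pathY /= e intrD mulr1z.
(* Since [v] is in the next cell and at most 1/4 away, [u] is in the second half of its cell: a loop
   there is already completed, and its coordinate 0 or 1 drops out modulo 1. *)
have -> : (if S (Num.floor u) then Num.min 1 (2 * (u - (Num.floor u)%:~R)) else 0) =
  (S (Num.floor u))%:~R.
  by case: ifP => // _; rewrite min_l //; lra.
have -> : forall y : R, dz (y - (S (Num.floor u))%:~R) = dz y.
  by move=> y; rewrite addrC -mulrNz dz_shift.
set q := (Num.floor u)%:~R in u1 u2 v1 v2 *.
set X := if S (Num.floor u) then _ else _.
have hX : q + 1 - X >= q + 1 - u.
  by rewrite /X; case: ifP => _; [rewrite max_r|]; lra.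
case: ifP => _; last by apply/orP; left; lra.
rewrite (min_r (_ : 2 * (v - (q + 1)) <= 1)) ?(max_l (_ : 2 * (v - (q + 1)) - 1 <= 0)); [|lra..].
rewrite dz_small ger0_norm; [|lra..].
by have [|] := leP ((v - u) / 2) (q + 1 + 0 - X) => // ?; lra.
Qed.

End Path.

Lemma path_shift (S S' : int -> bool) (Q : int) v :
  S (Q + Num.floor v) = S' (Num.floor v) ->
  pathX S (Q%:~R + v) = Q%:~R + pathX S' v /\ pathY S (Q%:~R + v) = pathY S' v.
Proof.
move=> e; rewrite /pathX /pathY /= floor_shift e intrD.
have -> : Q%:~R + v - (Q%:~R + (Num.floor v)%:~R) = v - (Num.floor v)%:~R by lra.
by case: ifP; rewrite ?addrA.
Qed.

End DistInt.

(** * Lacunary sums *)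

Section Lacunary.
Variable R : realType.

Lemma limn_dist (f : nat -> R) : cvgn f -> forall e : R, 0 < e ->
  exists N, forall n, (N <= n)%N -> `|limn f - f n| <= e.
Proof.
by move=> cf e e0; have /cvgrPdist_le/(_ _ e0)[N _ HN] := cf; exists N => n; exact: HN.
Qed.

Lemma cauchy_limn (f e : nat -> R) :
  (forall p q, (p <= q)%N -> `|f q - f p| <= e p) ->
  (forall r : R, 0 < r -> exists p, e p <= r) ->
  forall p, `|limn f - f p| <= e p.
Proof.
move=> fe e0; have cf : cvgn f.
  apply/cauchy_cvgP/cauchy_exP => r r0; have [p hp] := e0 (r / 2) (divr_gt0 r0 (ltr0Sn _ 1)).
  exists (f p); exists p => // q /= pq; rewrite /ball /= distrC.
  by rewrite (le_lt_trans (fe _ _ pq)) // (le_lt_trans hp) //; lra.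
move=> p; apply/ler_addgt0Pr => r r0; have [N HN] := limn_dist cf r0.
have -> : limn f - f p = (limn f - f (maxn N p)) + (f (maxn N p) - f p) by ring.
rewrite (le_trans (ler_normD _ _)) // (addrC (e p)) lerD //.
  by rewrite HN // leq_maxl.
by rewrite fe // leq_maxr.
Qed.

Lemma pow_unbounded (x a : R) : 1 < x -> exists N, forall n, (N <= n)%N -> a <= x ^+ n.
Proof.
move=> x1; have bern n : 1 + n%:R * (x - 1) <= x ^+ n.
  elim: n => [|n IH]; first by rewrite mul0r expr0 addr0.
  rewrite exprS -natr1; have x0 : 0 < x by lra.
  apply: le_trans (_ : x * (1 + n%:R * (x - 1)) <= _); last by rewrite ler_pM2l.
  have : 0 <= n%:R * (x - 1) * (x - 1) by rewrite -mulrA -expr2 mulr_ge0 ?sqr_ge0.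
  by move=> h; lra.
exists (Num.bound (`|a| / (x - 1))) => n hn.
have h0 : 0 <= `|a| / (x - 1) by rewrite divr_ge0 // subr_ge0 ltW.
have h1 := archi_boundP h0.
have h2 : `|a| / (x - 1) <= n%:R by rewrite (le_trans (ltW h1)) // ler_nat.
move: h2; rewrite ler_pdivrMr ?subr_gt0 // => h2.
by rewrite (le_trans (ler_norm a)) // (le_trans h2) // (le_trans _ (bern n)) // lerDr.
Qed.

Lemma pow_small (x a : R) : 1 < x -> 0 < a ->
  exists N, forall n, (N <= n)%N -> x ^- n <= a.
Proof.
move=> x1 a0; have [N HN] := pow_unbounded a^-1 x1; exists N => n /HN h.
by rewrite -[leRHS]invrK lef_pV2 ?posrE ?invr_gt0 ?exprn_gt0 //; lra.
Qed.

Lemma geom_sum_le (g : R) P : 1 < g -> \sum_(p < P) g ^+ p <= g ^+ P / (g - 1).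
Proof.
move=> g1; rewrite ler_pdivlMr ?subr_gt0 // mulrC -subrX1.
by rewrite lerBlDr lerDl.
Qed.

Variables (be ga : R).

Definition psum (D : nat -> R) P := \sum_(p < P) be ^- p * D p.
Definition lsum (D : nat -> R) := limn (psum D).

Let beX p : 2 <= be -> 0 < be ^- p.
Proof. by move=> h; rewrite invr_gt0 exprn_gt0 //; lra. Qed.

Lemma psum_tail D P Q : 2 <= be -> (forall p, `|D p| <= 1) -> (P <= Q)%N ->
  `|psum D Q - psum D P| <= 2 * be ^- P.
Proof.
move=> be2 D1 PQ; have be0 := beX _ be2; apply: le_trans (_ : 2 * be ^- P - 2 * be ^- Q <= _); last first.
  by rewrite gerBl mulr_ge0 // ltW.
rewrite -(subnK PQ); elim: (Q - P)%N => [|n IH]; first by rewrite !subrr normr0.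
rewrite /psum addSn big_ord_recr /= -/(psum D _) addrAC (le_trans (ler_normD _ _)) //.
rewrite normrM (gtr0_norm (be0 _)).
have h : be ^- (n + P) * `|D (n + P)%N| <= be ^- (n + P) by rewrite ler_piMr // ltW.
have h2 : 2 * be ^- (n + P).+1 <= be ^- (n + P).
  rewrite exprS invfM mulrA ler_piMl ?(ltW (be0 _)) // ler_pdivrMr; lra.
by move: IH; lra.
Qed.

Lemma lsum_tail D P : 2 <= be -> (forall p, `|D p| <= 1) -> `|lsum D - psum D P| <= 2 * be ^- P.
Proof.
move=> be2 D1; apply: (@cauchy_limn _ (fun P => 2 * be ^- P)) => [p q pq|r r0].
  exact: psum_tail.
have b1 : 1 < be by lra.
have [N HN] := @pow_small be (r / 2) b1 (divr_gt0 r0 (ltr0Sn _ 1)).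
by exists N; have := HN N (leqnn _); lra.
Qed.

Lemma small_eq0 (C x : R) : 2 <= be -> (forall p, `|x| <= C * be ^- p) -> x = 0.
Proof.
move=> be2 h; have be0 := beX _ be2; apply/eqP; rewrite -normr_le0; apply/ler_addgt0Pr => r r0; rewrite add0r.
have [||N HN] := @pow_small be (r / (`|C| + 1)); first by lra.
  by rewrite divr_gt0 // ltr_wpDl.
apply: le_trans (h N) _; apply: le_trans (_ : _ <= (`|C| + 1) * be ^- N) _.
  by rewrite ler_pM2r // (le_trans (ler_norm C)) // lerDl.
have := HN N (leqnn _); rewrite ler_pdivlMr 1?mulrC // ltr_wpDl.
Qed.

Lemma lsumB D D' : 2 <= be -> (forall p, `|D p| <= 1 / 2) -> (forall p, `|D' p| <= 1 / 2) ->
  lsum D - lsum D' = lsum (fun p => D p - D' p).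
Proof.
move=> be2 h h'; apply/eqP; rewrite -subr_eq0; apply/eqP/(@small_eq0 6) => // P.
have t1 : `|lsum D - psum D P| <= 2 * be ^- P.
  by apply: lsum_tail => // p; apply: le_trans (h p) _; lra.
have t2 : `|lsum D' - psum D' P| <= 2 * be ^- P.
  by apply: lsum_tail => // p; apply: le_trans (h' p) _; lra.
have t3 : `|lsum (fun p => D p - D' p) - psum (fun p => D p - D' p) P| <= 2 * be ^- P.
  apply: lsum_tail => // p; apply: le_trans (ler_normB _ _) _.
  by have := h p; have := h' p; lra.
have e : psum (fun p => D p - D' p) P = psum D P - psum D' P.
  by rewrite /psum -sumrB; apply: eq_bigr => p _; rewrite mulrBr.
rewrite e in t3.
have -> : lsum D - lsum D' - lsum (fun p => D p - D' p) =
  (lsum D - psum D P) - (lsum D' - psum D' P) -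
  (lsum (fun p => D p - D' p) - (psum D P - psum D' P)) by ring.
apply: le_trans (ler_normB _ _) _; apply: le_trans (lerD (ler_normB _ _) (lexx _)) _.
have -> : 6 * be ^- P = 2 * be ^- P + 2 * be ^- P + 2 * be ^- P by ring.
by apply: lerD t3; apply: lerD t1 t2.
Qed.

(** Before [P] the Lipschitz bound at frequency [(be * ga) ^+ p] applies and the terms grow like
    [ga ^+ p]; from [P] on only boundedness is used. Both parts are governed by the terms next to
    [P]. *)
Lemma lsum_upper D P (E : R) : 2 <= be -> 2 <= ga -> (forall p, `|D p| <= 1) -> 0 <= E ->
  (forall p, (p < P)%N -> `|D p| <= (be * ga) ^+ p * E) ->
  `|lsum D| <= E * ga ^+ P + 2 * be ^- P.
Proof.
move=> be2 ga2 D1 E0 h; have be0 := beX _ be2; rewrite -(subrK (psum D P) (lsum D)) addrC (le_trans (ler_normD _ _)) //.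
apply: lerD; last exact: lsum_tail.
rewrite (le_trans (ler_norm_sum _ _ _)) //.
apply: le_trans (_ : \sum_(p < P) E * ga ^+ p <= _).
  apply: ler_sum => p _; rewrite normrM (gtr0_norm (be0 _)).
  apply: le_trans (_ : be ^- p * ((be * ga) ^+ p * E) <= _).
    by rewrite ler_pM2l //; exact: h.
  by rewrite exprMn -mulrA mulKf 1?mulrC // gt_eqF // exprn_gt0 //; lra.
rewrite -mulr_sumr ler_wpM2l // (le_trans (geom_sum_le _ _)) //; first lra.
rewrite ler_pdivrMr; last lra.
by rewrite ler_peMr ?exprn_ge0; lra.
Qed.

(** The term at [P0] is meant to dominate: later terms cost a fraction 2/[be] of its amplitude,
    earlier ones a geometric sum with factor 1/([ga] - 1). [E2] is the displacement seen by all
    earlier levels, [E1] an extra one seen only up to [M], where the loops of the current block are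
    not yet felt. *)
Lemma lsum_lower D P0 M (E1 E2 : R) : 2 <= be -> 2 <= ga -> (forall p, `|D p| <= 1) -> 0 <= E1 -> 0 <= E2 ->
  (forall p, (p < P0)%N ->
     `|D p| <= (be * ga) ^+ p * (E2 + (if (p <= M)%N then E1 else 0))) ->
  be ^- P0 * (`|D P0| - 2 / be - (be * ga) ^+ P0 * E2 / (ga - 1))
    - E1 * ga ^+ M.+1 / (ga - 1) <= `|lsum D|.
Proof.
move=> be2 ga2 D1 E10 E20 h; have be0 := beX _ be2; have bp : 0 < be by lra.
have t := lsum_tail P0.+1 be2 D1.
have g1 : 0 < ga - 1 by lra.
have s : `|psum D P0| <= E2 * ga ^+ P0 / (ga - 1) + E1 * ga ^+ M.+1 / (ga - 1).
  rewrite (le_trans (ler_norm_sum _ _ _)) //.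
  apply: le_trans (_ : \sum_(p < P0) (E2 * ga ^+ p + (if (p <= M)%N then E1 * ga ^+ p else 0)) <= _).
    apply: ler_sum => p _; rewrite normrM (gtr0_norm (be0 _)).
    apply: le_trans (_ : be ^- p * ((be * ga) ^+ p * (E2 + (if (p <= M)%N then E1 else 0))) <= _).
      by rewrite ler_pM2l //; exact: h.
    rewrite exprMn -mulrA mulKf ?gt_eqF ?exprn_gt0 // mulrC mulrDl.
    by case: ifP; rewrite ?mul0r.
  rewrite big_split /=; apply: lerD.
    by rewrite -mulr_sumr -mulrA ler_wpM2l // geom_sum_le //; lra.
  apply: le_trans (_ : \sum_(p < M.+1) E1 * ga ^+ p <= _); last first.
    by rewrite -mulr_sumr -mulrA ler_wpM2l // geom_sum_le //; lra.
  have nn p : 0 <= E1 * ga ^+ p by rewrite mulr_ge0 // exprn_ge0 //; lra.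
  rewrite -big_mkcond /= -(big_mkord (fun p => (p <= M)%N) (fun p => E1 * ga ^+ p)).
  rewrite -(big_mkord xpredT (fun p => E1 * ga ^+ p)).
  rewrite (big_nat_widen 0 P0 _ _ _ (leq_maxl P0 M.+1)).
  rewrite (big_nat_widen 0 M.+1 _ _ _ (leq_maxr P0 M.+1)) big_mkcond [leRHS]big_mkcond /=.
  by apply: ler_sum => p _; rewrite ltnS; case: (p <= M)%N; case: (p < P0)%N.
have e : psum D P0.+1 = psum D P0 + be ^- P0 * D P0 by rewrite /psum big_ord_recr.
rewrite e in t.
have n1 : be ^- P0 * `|D P0| <= `|lsum D| + `|lsum D - (psum D P0 + be ^- P0 * D P0)| + `|psum D P0|.
  have -> : be ^- P0 * `|D P0| = `|be ^- P0 * D P0| by rewrite normrM gtr0_norm.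
  have {1}-> : be ^- P0 * D P0 = lsum D - (lsum D - (psum D P0 + be ^- P0 * D P0)) - psum D P0 by ring.
  by apply: le_trans (ler_normB _ _) _; rewrite lerD2r ler_normB.
have i1 : 2 * be ^- P0.+1 = be ^- P0 * (2 / be) by rewrite exprS invfM; ring.
have i2 : E2 * ga ^+ P0 / (ga - 1) = be ^- P0 * ((be * ga) ^+ P0 * E2 / (ga - 1)).
  by rewrite exprMn; field; rewrite gt_eqF //= gt_eqF // exprn_gt0.
rewrite i1 in t; rewrite i2 in s.
set a := be ^- P0 * (2 / be) in t; set b := be ^- P0 * ((be * ga) ^+ P0 * E2 / (ga - 1)) in s.
rewrite !mulrBr -/a -/b; set c := E1 * _ / _ in s *.
set d := be ^- P0 * _ in n1 *; move: n1 s t.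
by set n := `|lsum D|; set n' := `|lsum D - _|; set n'' := `|psum _ _|; lra.
Qed.

End Lacunary.

(** * Euclidean distance and tangents *)

Section Euclid.
Variable R : realType.

Section Norm.
Variable n : nat.
Implicit Types u v x y z : 'rV[R]_n.

Lemma enorm_ge0 v : 0 <= enorm v. Proof. exact: sqrtr_ge0. Qed.

Lemma sqr_enorm v : enorm v ^+ 2 = \sum_(i < n) v ord0 i ^+ 2.
Proof. by rewrite sqr_sqrtr // sumr_ge0 // => i _; rewrite sqr_ge0. Qed.

Lemma enorm_coord v i : `|v ord0 i| <= enorm v.
Proof.
rewrite -sqrtr_sqr ler_wsqrtr // (bigD1 i) //= lerDl sumr_ge0 // => j _.
by rewrite sqr_ge0.
Qed.

Lemma enorm_le_sum v : enorm v <= \sum_(i < n) `|v ord0 i|.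
Proof.
have s0 : 0 <= \sum_(i < n) `|v ord0 i| by rewrite sumr_ge0.
rewrite -(ler_pXn2r (ltn0Sn 1)) ?nnegrE ?enorm_ge0 // sqr_enorm expr2 mulr_suml.
apply: ler_sum => i _; rewrite -(ger0_norm (sqr_ge0 (v ord0 i))).
by rewrite normrX expr2 ler_wpM2l // (bigD1 i) //= lerDl sumr_ge0.
Qed.

Lemma enorm0 : enorm (0 : 'rV[R]_n) = 0.
Proof. by rewrite /enorm big1 ?sqrtr0 // => i _; rewrite mxE expr0n. Qed.

Lemma enormZ a v : enorm (a *: v) = `|a| * enorm v.
Proof.
rewrite /enorm -sqrtr_sqr -sqrtrM ?sqr_ge0 // mulr_sumr.
by congr Num.sqrt; apply: eq_bigr => i _; rewrite mxE exprMn.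
Qed.

Lemma enormN v : enorm (- v) = enorm v.
Proof. by rewrite -scaleN1r enormZ normrN1 mul1r. Qed.

Lemma enorm_eq0 v : enorm v = 0 -> v = 0.
Proof.
move=> h; apply/rowP => i; rewrite mxE; apply/eqP; rewrite -normr_le0 -h.
exact: enorm_coord.
Qed.

Lemma cauchy_schwarz u v : \sum_(i < n) u ord0 i * v ord0 i <= enorm u * enorm v.
Proof.
set C := \sum_(i < n) _; set A := enorm u; set B := enorm v.
have A0 : 0 <= A := enorm_ge0 u; have B0 : 0 <= B := enorm_ge0 v.
have [b0|bN] := eqVneq B 0.
  have v0 := enorm_eq0 b0; rewrite b0 mulr0 /C big1 // => i _.
  by rewrite v0 mxE mulr0.
have Bp : 0 < B by rewrite lt_neqAle eq_sym bN.
have h : 0 <= \sum_(i < n) (B ^+ 2 * u ord0 i - C * v ord0 i) ^+ 2.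
  by rewrite sumr_ge0 // => i _; rewrite sqr_ge0.
have aux (b c : R) : \sum_(i < n) (b ^+ 2 * u ord0 i - c * v ord0 i) ^+ 2 =
    b ^+ 4 * (\sum_(i < n) u ord0 i ^+ 2) - 2 * b ^+ 2 * c * (\sum_(i < n) u ord0 i * v ord0 i)
    + c ^+ 2 * (\sum_(i < n) v ord0 i ^+ 2).
  by rewrite !mulr_sumr -sumrB -big_split /=; apply: eq_bigr => i _; ring.
have e : \sum_(i < n) (B ^+ 2 * u ord0 i - C * v ord0 i) ^+ 2 = B ^+ 2 * (B ^+ 2 * A ^+ 2 - C ^+ 2).
  by rewrite aux -!sqr_enorm -/A -/B -/C; ring.
move: h; rewrite e pmulr_rge0 ?exprn_gt0 // subr_ge0 -exprMn => h.
have AB : 0 <= B * A by rewrite mulr_ge0.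
rewrite mulrC (le_trans (ler_norm C)) // -(ler_pXn2r (ltn0Sn 1)) ?nnegrE //.
by rewrite -normrX ger0_norm ?sqr_ge0.
Qed.

Lemma enormD u v : enorm (u + v) <= enorm u + enorm v.
Proof.
rewrite -(ler_pXn2r (ltn0Sn 1)) ?nnegrE ?addr_ge0 ?enorm_ge0 // sqr_enorm sqrrD.
have -> : \sum_(i < n) (u + v) ord0 i ^+ 2 =
  enorm u ^+ 2 + (\sum_(i < n) u ord0 i * v ord0 i) *+ 2 + enorm v ^+ 2.
  rewrite !sqr_enorm -sumrMnl -!big_split /=; apply: eq_bigr => i _.
  by rewrite mxE sqrrD.
by rewrite lerD2r lerD2l lerMn2r /= cauchy_schwarz.
Qed.

Lemma edist_ge0 x y : 0 <= edist x y. Proof. exact: enorm_ge0. Qed.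
Lemma edistxx x : edist x x = 0. Proof. by rewrite /edist subrr enorm0. Qed.
Lemma edistC x y : edist x y = edist y x.
Proof. by rewrite /edist -enormN opprB. Qed.
Lemma edist_triangle y x z : edist x z <= edist x y + edist y z.
Proof. by rewrite /edist; have -> : x - z = (x - y) + (y - z); rewrite ?enormD // addrA subrK. Qed.
Lemma edist_eq0 x y : edist x y = 0 -> x = y.
Proof. by move=> /enorm_eq0/eqP; rewrite subr_eq0 => /eqP. Qed.
Lemma edist0 x : edist x 0 = enorm x. Proof. by rewrite /edist subr0. Qed.
Lemma edist_coord x y i : `|x ord0 i - y ord0 i| <= edist x y.
Proof. by have := enorm_coord (x - y) i; rewrite !mxE. Qed.
Lemma edist_scale a x y : edist (a *: x) (a *: y) = `|a| * edist x y.
Proof. by rewrite /edist -scalerBr enormZ. Qed.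
Lemma edist_shift z x y : edist (x - z) (y - z) = edist x y.
Proof. by rewrite /edist opprB addrA subrK. Qed.
Lemma edist_lip x y z : `|edist x z - edist y z| <= edist x y.
Proof.
have h1 := edist_triangle y x z; have h2 := edist_triangle x y z.
by rewrite ler_norml (edistC y x) in h2 *; apply/andP; split; lra.
Qed.

(** The topology on row vectors is that of the maximum norm, which controls the Euclidean one up to
    the dimension; [n.+1] also covers dimension 0. *)
Lemma edist_nbhs x (e : R) : 0 < e -> nbhs x [set y | edist x y < e].
Proof.
move=> e0; apply/nbhs_ballP; exists (e / n.+1%:R); first by rewrite /= divr_gt0.
move=> y xy /=; apply: le_lt_trans (enorm_le_sum _) _.
apply: (@le_lt_trans _ _ (\sum_(i < n) (e / n.+1%:R))).
  by apply: ler_sum => i _; rewrite !mxE; apply: ltW; exact: (xy.2 ord0 i).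
rewrite sumr_const card_ord -[_ *+ n]mulr_natr mulrAC ltr_pdivrMr //.
by rewrite ltr_pM2l // ltr_nat.
Qed.

Lemma nbhs_edist x (A : set 'rV[R]_n) : nbhs x A ->
  exists2 e : R, 0 < e & forall y, edist x y < e -> A y.
Proof.
move=> /nbhs_ballP[e /= e0 he]; exists e => // y xy; apply: he; split=> // i j.
by rewrite /ball /= (ord1 i); apply: le_lt_trans (edist_coord x y j) xy.
Qed.

Lemma closed_edist (T : set 'rV[R]_n) :
  (forall y, (forall e : R, 0 < e -> exists2 x, T x & edist y x < e) -> T y) -> closed T.
Proof.
move=> h y cy; apply: h => e e0; have [x [Tx xy]] := cy _ (edist_nbhs y e0).
by exists x.
Qed.

End Norm.

Lemma within_continuous_edist n m (A : set 'rV[R]_n) (f : 'rV[R]_n -> 'rV[R]_m) a (e : R) :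
  {within A, continuous f} -> A a -> 0 < e ->
  exists2 dl : R, 0 < dl & forall b, A b -> edist a b < dl -> edist (f a) (f b) < e.
Proof.
move=> /subspace_continuousP cf Aa e0.
have [dl dl0 hd] := nbhs_edist (cf _ Aa _ (edist_nbhs (f a) e0)).
by exists dl => // b Ab ab; apply: hd.
Qed.

Section Excess.
Variable n : nat.
Implicit Types A B X T : set 'rV[R]_n.

Lemma exc_le A B (e : R) : 0 <= e ->
  (forall a, A a -> exists2 b, B b & edist a b <= e) -> (exc A B <= e%:E)%E.
Proof.
move=> e0 h; rewrite /exc ge_max lee_fin e0 /=; apply: ge_ereal_sup => _ [a Aa <-].
have [b Bb ab] := h a Aa; apply: le_trans (_ : (edist a b)%:E <= _)%E; last by rewrite lee_fin.
by apply: ereal_inf_lbound; exists b.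
Qed.

Lemma exc_lt A B (e : R) a : (exc A B < e%:E)%E -> A a -> exists2 b, B b & edist a b < e.
Proof.
rewrite /exc gt_max => /andP[_ h] Aa.
have : (ereal_inf [set (edist a b)%:E | b in B] < e%:E)%E.
  by apply: le_lt_trans h; apply: ereal_sup_ubound; exists a.
by move=> /ereal_inf_lt[_ [b Bb <-]]; rewrite lte_fin => ab; exists b.
Qed.

Lemma exc_ge0 A B : (0 <= exc A B)%E.
Proof. by rewrite /exc le_max lexx. Qed.

Lemma exc_cvg (A B : nat -> set 'rV[R]_n) :
  (forall e : R, 0 < e -> exists M, forall m, (M <= m)%N ->
     forall a, A m a -> exists2 b, B m b & edist a b <= e) ->
  (fun m => exc (A m) (B m)) @ \oo --> 0%E.
Proof.
move=> h; have h' (e : R) : 0 < e -> \forall m \near \oo, (exc (A m) (B m) <= e%:E)%E.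
  by move=> e0; have [M HM] := h e e0; exists M => // m /= Mm; apply: exc_le; [exact: ltW | exact: HM].
have fn : \forall m \near \oo, exc (A m) (B m) \is a fin_num.
  near=> m; rewrite fin_numElt (lt_le_trans _ (exc_ge0 _ _)) ?ltNy0 //=.
  by rewrite (@le_lt_trans _ _ 1%:E) ?ltry //; near: m; exact: h'.
apply/fine_cvgP; split=> //; apply/cvgrPdist_le => e e0; near=> m.
rewrite sub0r normrN ger0_norm ?fine_ge0 ?exc_ge0 // -lee_fin fineK; first by near: m; exact: h'.
by near: m.
Unshelve. all: by end_near. Qed.

Lemma cvg_exc (A B : nat -> set 'rV[R]_n) (e : R) :
  (fun m => exc (A m) (B m)) @ \oo --> 0%E -> 0 < e ->
  exists M, forall m, (M <= m)%N -> forall a, A m a -> exists2 b, B m b & edist a b < e.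
Proof.
move=> /fine_cvgP[[M1 _ H1] c] e0; have /cvgrPdist_lt/(_ _ e0)[M2 _ H2] := c.
exists (maxn M1 M2) => m; rewrite geq_max => /andP[m1 m2] a; apply: exc_lt.
have := H2 m m2; rewrite /= sub0r normrN ger0_norm ?fine_ge0 ?exc_ge0 // => h.
by rewrite -(fineK (H1 m m1)) lte_fin.
Qed.

Lemma Tan_intro X x T (r : nat -> R) : X x -> closed T -> T 0 ->
  (forall m, 0 < r m) -> (forall m, r m.+1 <= r m) ->
  (forall e : R, 0 < e -> exists m, r m <= e) ->
  (forall R0 e : R, 0 < R0 -> 0 < e -> exists M, forall m, (M <= m)%N ->
    (forall y, X y -> edist y x <= R0 * r m -> exists2 v, T v & edist ((r m)^-1 *: (y - x)) v <= e) /\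
    (forall v, T v -> enorm v <= R0 -> exists2 y, X y & edist v ((r m)^-1 *: (y - x)) <= e)) ->
  Tan X x T.
Proof.
move=> Xx cT T0 r0 rd rs h; split=> //; exists r; split=> //.
  apply/cvgrPdist_le => e e0; have [M HM] := rs _ e0; exists M => // m /= Mm.
  rewrite sub0r normrN gtr0_norm // (le_trans _ HM) // -(subnK Mm).
  by elim: (m - M)%N => //= k IH; rewrite addSn (le_trans (rd _)).
move=> R0 R00; split; apply: exc_cvg => e e0; have [M HM] := h R0 e R00 e0;
  exists M => m Mm; have [h1 h2] := HM m Mm.
  move=> _ [[y Xy <-]]; rewrite /cball0 /= enormZ gtr0_norm ?invr_gt0 // => yr.
  by apply: h1 => //; rewrite mulrC -ler_pdivrMl.
by move=> v [Tv vr]; have [y Xy hy] := h2 v Tv vr; exists ((r m)^-1 *: (y - x)) => //; exists y.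
Qed.

(** Both excesses are made small at one common scale, arbitrarily fine; the exclusion argument needs
    a single such scale, so the sequence is forgotten. *)
Lemma Tan_elim X x T : Tan X x T -> [/\ X x, closed T, T 0 &
  forall R0 e r0 : R, 0 < R0 -> 0 < e -> 0 < r0 -> exists r : R, [/\ 0 < r, r <= r0,
    (forall y, X y -> edist y x <= R0 * r -> exists2 v, T v & edist (r^-1 *: (y - x)) v < e) &
    (forall v, T v -> enorm v <= R0 -> exists2 y, X y & edist v (r^-1 *: (y - x)) < e)]].
Proof.
move=> [Xx cT T0 [r [rp _ rc aw]]]; split=> // R0 e r0 R00 e0 r00.
have [c1 c2] := aw R0 R00.
have [M1 H1] := cvg_exc c1 e0; have [M2 H2] := cvg_exc c2 e0.
have /cvgrPdist_le/(_ _ r00)[M3 _ H3] := rc.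
pose m := maxn M1 (maxn M2 M3).
have m1 : (M1 <= m)%N by rewrite leq_maxl.
have m2 : (M2 <= m)%N by rewrite /m !leq_max leqnn orbT.
have m3 : (M3 <= m)%N by rewrite /m !leq_max leqnn !orbT.
exists (r m); split=> //.
- by have := H3 m m3; rewrite sub0r normrN gtr0_norm.
- move=> y Xy yr; apply: (H1 m m1); split; first by exists y.
  by rewrite /cball0 /= enormZ gtr0_norm ?invr_gt0 // ler_pdivrMl // mulrC.
by move=> v Tv vr; have [|_ [y Xy <-] h] := H2 m m2 v; [split | exists y].
Qed.

End Excess.
End Euclid.

(** * Hausdorff measure *)

Section Hausdorff.
Variables (R : realType) (n : nat).
Implicit Types A B U : set 'rV[R]_n.

Lemma hcontent_ge0 t U : (0 <= hcontent t U)%E.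
Proof.
by rewrite /hcontent; destruct (pselect (U !=set0)) => //; rewrite /epow; case: (diam U) => [r| |] //; rewrite lee_fin powR_ge0.
Qed.

Lemma diam_le U (d : R) : (forall x y, U x -> U y -> edist x y <= d) -> (diam U <= d%:E)%E.
Proof. by move=> h; apply: ge_ereal_sup => _ [x Ux [y Uy <-]]; rewrite lee_fin h. Qed.

Lemma le_diam U (d : R) x y : (diam U <= d%:E)%E -> U x -> U y -> edist x y <= d.
Proof.
move=> h Ux Uy; rewrite -lee_fin; apply: le_trans h.
by apply: ereal_sup_ubound; exists x => //; exists y.
Qed.

Lemma hcontent_le t U (d : R) : 0 < t -> 0 <= d ->
  (forall x y, U x -> U y -> edist x y <= d) -> (hcontent t U <= (d `^ t)%:E)%E.
Proof.
move=> t0 d0 h; rewrite /hcontent; destruct (pselect (U !=set0)) as [[x Ux]|]; last by rewrite lee_fin powR_ge0.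
have h1 := diam_le h; have h0 : (0%:E <= diam U)%E.
  by apply: ereal_sup_ubound; exists x => //; exists x; rewrite ?edistxx.
move: h1 h0; case: (diam U) => [r| |] //=; rewrite !lee_fin => r1 r0.
by apply: ge0_ler_powR; rewrite ?nnegrE // ltW.
Qed.

Lemma hausdorff_null t A :
  (forall dl e : R, 0 < dl -> 0 < e -> exists U : nat -> set 'rV[R]_n,
    [/\ A `<=` \bigcup_i U i, (forall i, (diam (U i) <= dl%:E)%E) &
        (\sum_(i <oo) hcontent t (U i) <= e%:E)%E]) -> hausdorff t A = 0%E.
Proof.
move=> h; apply/eqP; rewrite eq_le; apply/andP; split.
  apply: ge_ereal_sup => _ [dl /= dl0 <-]; apply/lee_addgt0Pr => e e0; rewrite add0e.
  have [U [U1 U2 U3]] := h dl e dl0 e0; apply: le_trans U3.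
  by apply: ereal_inf_lbound; exists U.
apply: le_trans (_ : hausdorff_delta t 1 A <= _)%E; last first.
  by apply: ereal_sup_ubound; exists 1 => //=; exact: ltr01.
apply: le_ereal_inf_tmp => _ [U [_ _ ->]].
by apply: nneseries_ge0 => i _ _; exact: hcontent_ge0.
Qed.

(** The measure is a supremum over the mesh, so its value at mesh 1 is already a lower bound. *)
Lemma hausdorff_gt0 t A (c : R) : 0 < c ->
  (forall U : nat -> set 'rV[R]_n, A `<=` \bigcup_i U i ->
     (forall i, (diam (U i) <= 1%:E)%E) -> (c%:E <= \sum_(i <oo) hcontent t (U i))%E) ->
  (0 < hausdorff t A)%E.
Proof.
move=> c0 h; apply: lt_le_trans (_ : c%:E <= _)%E; first by rewrite lte_fin.
apply: le_trans (_ : hausdorff_delta t 1 A <= _)%E; last first.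
  by apply: ereal_sup_ubound; exists 1 => //=; exact: ltr01.
by apply: le_ereal_inf_tmp => _ [U [U1 U2 ->]]; exact: h.
Qed.

(** A finite stretch of the enumeration of pairs lies in a square, where nonnegative terms can be
    summed row by row. *)
Lemma pair_sum (phi : nat * nat -> R) (b : nat -> R) (e : R) :
  (forall x, 0 <= phi x) -> (forall k P, \sum_(p < P) phi (k, p : nat) <= b k) ->
  (forall K, \sum_(k < K) b k <= e) ->
  forall M, \sum_(n < M) (if pickle_inv n is Some x then phi x else 0) <= e.
Proof.
move=> phi0 hb he M.
pose s : seq (nat * nat) := pmap pickle_inv (iota 0 M).
have us : uniq s.
  rewrite /s; apply: (@pmap_uniq _ _ _ pickle); last exact: iota_uniq.
  by move=> i; have := @pickle_invK (nat * nat)%type i; rewrite /ocancel.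
have -> : \sum_(n < M) (if pickle_inv n is Some x then phi x else 0) = \sum_(x <- s) phi x.
  rewrite -(big_mkord xpredT (fun n => if pickle_inv n is Some x then phi x else 0)).
  rewrite /s /index_iota subn0; elim: (iota 0 M) => [|m l IH]; first by rewrite !big_nil.
  by rewrite big_cons IH /=; case: (pickle_inv m) => [x|] /=; rewrite ?big_cons ?add0r.
pose K := (\max_(x <- s) maxn x.1 x.2).+1.
pose g := [seq (k, p) | k <- iota 0 K, p <- iota 0 K].
have sg : {subset s <= g}.
  move=> [k p] xs; apply/allpairsP; exists (k, p); rewrite !mem_iota /= !add0n !ltnS.
  have := @leq_bigmax_seq _ s predT (fun x : nat * nat => maxn x.1 x.2) (k, p) xs isT.
  by rewrite /= geq_max => /andP[].
have ug : uniq g by apply: allpairs_uniq; rewrite ?iota_uniq // => -[a b'] [a' b''].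
have -> : \sum_(x <- s) phi x = \sum_(x <- [seq x <- g | x \in s]) phi x.
  apply: perm_big; apply: uniq_perm => //; first exact: filter_uniq.
  by move=> x; rewrite mem_filter; case xs: (x \in s) => //=; rewrite sg.
rewrite big_filter; apply: le_trans (_ : \sum_(x <- g) phi x <= _).
  by rewrite big_mkcond /=; apply: ler_sum => x _; case: ifP.
rewrite big_allpairs; apply: le_trans (he K).
rewrite -(big_mkord xpredT b) /index_iota subn0; apply: ler_sum => k _.
by have := hb k K; rewrite -(big_mkord xpredT (fun p => phi (k, p))) /index_iota subn0.
Qed.

Lemma nneseries_le (f : nat -> \bar R) (e : R) : (forall i, 0 <= f i)%E ->
  (forall M, \sum_(i < M) f i <= e%:E)%E -> (\sum_(i <oo) f i <= e%:E)%E.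
Proof.
move=> f0 h; apply: lime_le; first by apply: is_cvg_nneseries => i _ _; exact: f0.
by near=> M; rewrite big_mkord.
Unshelve. all: by end_near. Qed.

Lemma half_geom (e : R) K : 0 <= e -> \sum_(k < K) e * 2 ^- k.+1 <= e.
Proof.
move=> e0; have -> : \sum_(k < K) e * 2 ^- k.+1 = e - e * 2 ^- K.
  elim: K => [|K IH]; first by rewrite big_ord0 expr0 invr1 mulr1 subrr.
  by rewrite big_ord_recr /= IH exprS invfM; field; rewrite expf_neq0.
by rewrite gerBl mulr_ge0 // invr_ge0 exprn_ge0.
Qed.

Lemma hausdorff_null_union t A (B : nat -> set 'rV[R]_n) : 0 < t ->
  A `<=` \bigcup_k B k ->
  (forall k (dl e : R), 0 < dl -> 0 < e -> exists (m : nat) (U : nat -> set 'rV[R]_n) (c : R),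
    [/\ forall x, B k x -> exists2 p, (p < m)%N & U p x,
        forall p x y, U p x -> U p y -> edist x y <= c,
        0 <= c, c <= dl & m%:R * c `^ t <= e]) ->
  hausdorff t A = 0%E.
Proof.
move=> t0 AB h; apply: hausdorff_null => dl e dl0 e0.
have h' k : exists w : nat * (nat -> set 'rV[R]_n) * R,
   [/\ forall x, B k x -> exists2 p, (p < w.1.1)%N & w.1.2 p x,
       forall p x y, w.1.2 p x -> w.1.2 p y -> edist x y <= w.2,
       0 <= w.2, w.2 <= dl & w.1.1%:R * w.2 `^ t <= e * 2 ^- k.+1].
  have [|m [U [c [h1 h2 h3 h4 h5]]]] := h k dl (e * 2 ^- k.+1) dl0.
    by rewrite mulr_gt0 // invr_gt0 exprn_gt0.
  by exists (m, U, c).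
have [w hw] := choice h'.
pose V n := if @pickle_inv (nat * nat)%type n is Some x then
  (if (x.2 < (w x.1).1.1)%N then (w x.1).1.2 x.2 else set0) else set0.
pose phi (x : nat * nat) := if (x.2 < (w x.1).1.1)%N then (w x.1).2 `^ t else 0.
have phi0 x : 0 <= phi x by rewrite /phi; case: ifP; rewrite ?powR_ge0.
have hV i : (hcontent t (V i) <= (if @pickle_inv (nat * nat)%type i is Some x then phi x else 0)%:E)%E.
  have h00 : hcontent t (set0 : set 'rV[R]_n) = 0%E.
    by rewrite /hcontent; destruct (pselect _) as [[]|].
  rewrite /V /phi; case: pickle_inv => [[k p]|] /=; last by rewrite h00.
  case: ifP => _; last by rewrite h00.
  by have [h1 h2 h3 h4 h5] := hw k; apply: hcontent_le => //; exact: h2.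
exists V; split.
- move=> x /AB[k _ Bx]; have [h1 h2 h3 h4 h5] := hw k; have [p pm Ux] := h1 x Bx.
  by exists (pickle (k, p)) => //; rewrite /V pickleK_inv /= pm.
- move=> i; rewrite /V; case: pickle_inv => [[k p]|] /=; last by apply: diam_le.
  have [h1 h2 h3 h4 h5] := hw k; case: ifP => _; last by apply: diam_le.
  by apply: diam_le => x y Ux Uy; apply: le_trans h4; exact: h2 Ux Uy.
apply: nneseries_le => [i|M]; first exact: hcontent_ge0.
pose w' i := if @pickle_inv (nat * nat)%type i is Some x then phi x else 0.
apply: (@le_trans _ _ (\sum_(i < M) (w' i)%:E)%E); first by apply: lee_sum => i _; exact: hV.
rewrite sumEFin lee_fin.
apply: (@pair_sum phi (fun k => e * 2 ^- k.+1)) => // [k P|K]; last exact: half_geom (ltW e0).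
have [h1 h2 h3 h4 h5] := hw k; apply: le_trans h5.
have -> : \sum_(p < P) phi (k, p : nat) = (minn P (w k).1.1)%:R * (w k).2 `^ t.
  elim: P => [|P IH]; first by rewrite big_ord0 min0n mul0r.
  rewrite big_ord_recr /= IH /phi /=; case: ltnP => hP.
    by rewrite (minn_idPl hP) -natr1 mulrDl mul1r.
  by rewrite (minn_idPr (leqW hP)) addr0.
by rewrite ler_wpM2r ?powR_ge0 // ler_nat geq_minr.
Qed.

End Hausdorff.

Definition loopS (k : nat) (q : int) : bool := (0 <= q) && (q < k%:Z).

(** * Lines with loops *)

Section LoopPath.
Variable R : realType.
Implicit Types u v : R.

Lemma path0 k : pathX (loopS k) 0 = 0 :> R /\ pathY (loopS k) 0 = 0 :> R.
Proof.
rewrite /pathX /pathY floor0 /= subr0 mulr0 sub0r.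
by rewrite max_l ?min_r ?addr0 ?lerN10 ?ler01 //; case: ifP.
Qed.

(** This is the max metric of line times circle pulled back to time; it vanishes exactly at times
    identified by a loop. *)
Definition rhoF k (u v : R) : R := Num.max `|pathX (loopS k) u - pathX (loopS k) v|
  (dz (pathY (loopS k) u - pathY (loopS k) v)).

Lemma rhoF_X k u v : `|pathX (loopS k) u - pathX (loopS k) v| <= rhoF k u v.
Proof. by rewrite /rhoF le_max lexx. Qed.

Lemma rhoF_Y k u v : dz (pathY (loopS k) u - pathY (loopS k) v) <= rhoF k u v.
Proof. by rewrite /rhoF le_max lexx orbT. Qed.

Lemma path_loop k q (f : R) : (q < k)%N -> 0 <= f -> f < 1 ->
  pathX (loopS k) (q%:R + f) = q%:R + Num.max 0 (2 * f - 1) /\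
  pathY (loopS k) (q%:R + f) = Num.min 1 (2 * f).
Proof.
move=> qk f0 f1; rewrite /pathX /pathY.
have E : Num.floor (q%:R + f) = q%:Z by apply: floor_unique; rewrite -?pmulrn; lra.
have -> : loopS k (Num.floor (q%:R + f)) by rewrite E /loopS.
by rewrite E -pmulrn /=; have -> : q%:R + f - q%:R = f by ring.
Qed.

Lemma path_line k u : u < 0 -> pathX (loopS k) u = u /\ pathY (loopS k) u = 0.
Proof.
move=> u0; rewrite /pathX /pathY.
have /negbTE -> : ~~ loopS k (Num.floor u) by rewrite /loopS -floor_lt0 in u0 *; rewrite leNgt u0.
by [].
Qed.

Lemma dz0_int (a : R) : dz a <= 0 -> exists z : int, a = z%:~R.
Proof.
have [z -> _] := dz_ex a; rewrite normr_le0 subr_eq0 => /eqP->; by exists z.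
Qed.

Lemma pathX_ge0 k u : 0 <= u -> 0 <= pathX (loopS k) u.
Proof.
move=> u0; have [h _ _ _] := pathX_floor (loopS k) u; apply: le_trans h.
by rewrite ler0z floor_ge0.
Qed.

Lemma pathX_far k u : k%:R <= u -> pathX (loopS k) u = u.
Proof.
move=> ku; rewrite /pathX; have h : k%:Z <= Num.floor u by rewrite floor_ge_int -pmulrn.
by rewrite /loopS [_ < k%:Z]ltNge h andbF.
Qed.

Lemma nat_frac u : 0 <= u -> exists q (f : R), [/\ u = q%:R + f, 0 <= f & f < 1].
Proof.
move=> u0; have [f1 f2] := floor_bounds u; have f0 : 0 <= Num.floor u by rewrite floor_ge0.
have E : (absz (Num.floor u))%:R = (Num.floor u)%:~R :> R by rewrite -[in RHS](gez0_abs f0).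
by exists (absz (Num.floor u)), (u - (Num.floor u)%:~R); rewrite E; split; lra.
Qed.

Lemma int_neg1 (z : int) : -2 < z -> z < 0 -> z = -1.
Proof. by lia. Qed.

(* The path meets itself only where it closes up its loops. *)
Lemma rhoF_eq0 k u v : u < v -> rhoF k u v <= 0 ->
  exists q, [/\ (q < k)%N, u = q%:R & v = q%:R + 1 / 2].
Proof.
move=> uv r0.
have /eqP : `|pathX (loopS k) u - pathX (loopS k) v| == 0.
  by rewrite eq_le normr_ge0 (le_trans (rhoF_X k u v) r0).
move=> /normr0_eq0/eqP; rewrite subr_eq0 => /eqP hX.
have [z hz] := dz0_int (le_trans (rhoF_Y k u v) r0).
have [u0|u0] := ltP u 0.
  have [xu _] := path_line k u0; have [v0|v0] := ltP v 0.
    by have [xv _] := path_line k v0; rewrite xu xv in hX; lra.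
  by have := pathX_ge0 k v0; rewrite -hX xu; lra.
have v0 : 0 <= v by lra.
have [ku|uk] := leP k%:R u.
  by rewrite !pathX_far // in hX; lra.
have [q [f [eu f0 f1]]] := nat_frac u0; have [q' [g [ev g0 g1]]] := nat_frac v0.
have qk : (q < k)%N by rewrite -(ltr_nat R); lra.
have [xu yu] := path_loop qk f0 f1; rewrite -eu in xu yu.
have xu1 : pathX (loopS k) u < q%:R + 1.
  by rewrite xu; have [[_ ->]|[_ ->]] := max0P (2 * f - 1); lra.
have qq' : q' = q.
  apply/eqP; rewrite eqn_leq; apply/andP; split.
    have : q'%:R <= pathX (loopS k) v.
      have [kv|vk] := leP k%:R v; first by rewrite pathX_far //; lra.
      have qk' : (q' < k)%N by rewrite -(ltr_nat R); lra.
      by have [xe _] := path_loop qk' g0 g1; rewrite ev xe lerDl le_max lexx.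
    rewrite -hX => h; rewrite -ltnS -(ltr_nat R).
    have -> : q.+1%:R = q%:R + 1 :> R by rewrite natr1.
    exact: le_lt_trans h xu1.
  rewrite -ltnS -(ltr_nat R); have -> : q'.+1%:R = q'%:R + 1 :> R by rewrite natr1.
  by lra.
rewrite qq' in ev; have [xv yv] := path_loop qk g0 g1; rewrite -ev in xv yv.
move: hX hz; rewrite xu xv yu yv.
(* Both times lie in the loop half of the cell; their loop coordinates differ by an integer strictly
   between -2 and 0, hence by one full turn. *)
have flat : 2 * f - 1 <= 0 -> 2 * g - 1 <= 0 -> Num.min 1 (2 * f) - Num.min 1 (2 * g) = z%:~R ->
    exists q0, [/\ (q0 < k)%N, u = q0%:R & v = q0%:R + 1 / 2].
  move=> h1 h2; rewrite !min_r; [|lra|lra] => hz.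
  have z1 : -2 < z by rewrite -(ltr_int R); lra.
  have z2 : z < 0 by rewrite -(ltr_int R); lra.
  by rewrite (int_neg1 z1 z2) mulrN1z in hz; exists q; split; [exact: qk | lra | lra].
have [[h1 ->]|[h1 ->]] := max0P (2 * f - 1); have [[h2 ->]|[h2 ->]] := max0P (2 * g - 1) => hX.
- by move=> _; lra.
- by move=> _; lra.
- by apply: flat; lra.
- by apply: flat; lra.
Qed.

Lemma dz_gt0 (a : R) : 0 < a -> a < 1 -> 0 < dz a.
Proof.
move=> a0 a1; rewrite ltNge; apply/negP => /dz0_int[z az].
have z0 : 0 < z by rewrite -(ltr_int R); lra.
have z1 : z < 1 by rewrite -(ltr_int R); lra.
by lia.
Qed.

Lemma dzB1 (a : R) : dz (a - 1) = dz a.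
Proof. by rewrite addrC (_ : -1 = (-1)%:~R) ?dz_shift // mulrN1z. Qed.

(** The three values stand for before the loop, on the loop and after it. The values at the two
    times of the crossing itself are immaterial. *)
Definition piece q u : nat := if u < q%:R then 0 else if u < q%:R + 1 / 2 then 1 else 2.

Lemma pieceP q u : u <> q%:R -> u <> q%:R + 1 / 2 ->
  [\/ u < q%:R /\ piece q u = 0%N,
      q%:R < u /\ u < q%:R + 1 / 2 /\ piece q u = 1%N |
      q%:R + 1 / 2 < u /\ piece q u = 2%N].
Proof.
move=> /eqP n1 /eqP n2; rewrite /piece; case: ltP => h1; first exact: Or31.
have h1' : q%:R < u by rewrite lt_neqAle eq_sym n1.
case: ltP => h2; first exact: Or32.
by apply: Or33; split=> //; rewrite lt_neqAle eq_sym n2.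
Qed.

Lemma path_before k q u : u < q%:R -> pathX (loopS k) u < q%:R.
Proof. by move=> uq; have /andP[_ h] := pathX_near (loopS k) u; apply: le_lt_trans h uq. Qed.

Lemma path_on k q u : (q < k)%N -> q%:R < u -> u < q%:R + 1 / 2 ->
  pathX (loopS k) u = q%:R /\ pathY (loopS k) u = 2 * (u - q%:R).
Proof.
move=> qk u1 u2; have [||] := @path_loop k q (u - q%:R) qk; [lra|lra|].
by rewrite addrC subrK max_l ?min_r ?addr0; [|lra|lra].
Qed.

Lemma path_after k q u : (q < k)%N -> q%:R + 1 / 2 < u ->
  q%:R < pathX (loopS k) u /\
  (q%:R + 1 <= pathX (loopS k) u \/ pathY (loopS k) u = 1).
Proof.
move=> qk u1; have [u2|u2] := ltP u (q%:R + 1).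
  have [||] := @path_loop k q (u - q%:R) qk; [lra|lra|].
  rewrite addrC subrK max_r ?min_l; [|lra|lra] => -> ->; split; last by right.
  by lra.
have h : q%:R + 1 <= pathX (loopS k) u.
  have [f1 _ _ _] := pathX_floor (loopS k) u; apply: le_trans f1.
  have -> : q%:R + 1 = (q.+1%:Z)%:~R :> R by rewrite -pmulrn natr1.
  by rewrite ler_int floor_ge_int -pmulrn -natr1.
by split; [lra | left].
Qed.

Lemma path_end k q v : (q < k)%N -> q%:R - 1 / 2 <= v -> v < q%:R ->
  pathY (loopS k) v = 0 \/ pathY (loopS k) v = 1.
Proof.
case: q => [|q] qk v1 v2; first by have [_ ->] := path_line k v2; left.
have E : q.+1%:R = q%:R + 1 :> R by rewrite natr1.
rewrite E in v1 v2; right; have [||] := @path_loop k q (v - q%:R) (ltnW qk); [lra|lra|].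
by rewrite addrC subrK [Num.min _ _]min_l; [|lra].
Qed.

(** Points before and after the loop are kept from the rest by their position, points on the loop by
    their loop coordinate. For the latter the half cell before [q] needs care: there the loop
    coordinate is 0 or 1, the same modulo 1. Further back the position differs by 1/2, whence the
    minimum. *)
Lemma cross_sep k q u : (q < k)%N -> u <> q%:R -> u <> q%:R + 1 / 2 ->
  exists2 dl : R, 0 < dl & forall v, v <> q%:R -> v <> q%:R + 1 / 2 ->
    piece q u <> piece q v -> dl <= rhoF k u v.
Proof.
move=> qk u1 u2; have [[h1 pu]|[h1 [h1' pu]]|[h1 pu]] := pieceP u1 u2.
- exists (q%:R - pathX (loopS k) u); first by rewrite subr_gt0 path_before.
  move=> v v1 v2; rewrite pu; have [[_ ->]//|[h2 [h2' _]]|[h2 _]] := pieceP v1 v2 => _;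
    apply: le_trans (rhoF_X _ _ _); rewrite distrC; apply: le_trans (ler_norm _).
    by have [-> _] := path_on qk h2 h2'.
  by have [h _] := path_after qk h2; rewrite lerD2r ltW.
- have [xu yu] := path_on qk h1 h1'.
  have dY : 0 < dz (pathY (loopS k) u) by rewrite yu; apply: dz_gt0; lra.
  exists (Num.min (1 / 2) (dz (pathY (loopS k) u))); first by rewrite lt_min dY andbT; lra.
  have Y01 (y : R) : y = 0 \/ y = 1 -> dz (pathY (loopS k) u - y) = dz (pathY (loopS k) u).
    by move=> [->|->]; rewrite ?subr0 ?dzB1.
  move=> v v1 v2; rewrite pu; have [[h2 _]|[h2 [h2' ->//]]|[h2 _]] := pieceP v1 v2 => _.
    have [v3|v3] := leP (q%:R - 1 / 2) v.
      by apply: le_trans (rhoF_Y _ _ _); rewrite (Y01 _ (path_end qk v3 h2)) ge_min lexx orbT.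
    apply: le_trans (rhoF_X _ _ _); apply: le_trans (ler_norm _); rewrite xu.
    have /andP[_ h] := pathX_near (loopS k) v; rewrite ge_min; apply/orP; left; lra.
  have [_ [h|h]] := path_after qk h2.
    apply: le_trans (rhoF_X _ _ _); rewrite distrC; apply: le_trans (ler_norm _); rewrite xu.
    by rewrite ge_min; apply/orP; left; lra.
  by apply: le_trans (rhoF_Y _ _ _); rewrite (Y01 _ (or_intror h)) ge_min lexx orbT.
have [h h'] := path_after qk h1; exists (pathX (loopS k) u - q%:R); first by rewrite subr_gt0.
move=> v v1 v2; rewrite pu; have [[h2 _]|[h2 [h2' _]]|[_ ->]//] := pieceP v1 v2 => _;
  apply: le_trans (rhoF_X _ _ _); apply: le_trans (ler_norm _).
  by rewrite lerD2l lerN2 ltW // path_before.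
by have [-> _] := path_on qk h2 h2'.
Qed.

(** The indicator of the level set of [f a] is continuous on the interval; if the end values
    differed, it would have to take the value 1/2. *)
Lemma locally_constant (f : R -> nat) a b : a <= b ->
  (forall x, a <= x <= b -> exists2 e : R, 0 < e & forall y, a <= y <= b -> `|x - y| < e -> f x = f y) ->
  f a = f b.
Proof.
move=> ab h; apply/eqP/negPn/negP => ne.
pose g x : R := (f x == f a)%:R.
have cg : {within `[a, b], continuous g}.
  apply/subspace_continuousP => x; rewrite /= in_itv /= => xab.
  have [e e0 he] := h x xab.
  apply/cvgrPdist_lt => z z0; rewrite near_withinE; apply/nbhs_ballP; exists e => // y xy.
  rewrite /= in_itv /= => yab; rewrite /from_subspace /g (he y yab xy).
  by rewrite subrr normr0.
have ga : g a = 1 by rewrite /g eqxx.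
have gb : g b = 0 by rewrite /g eq_sym (negbTE ne).
have [|c _] := @IVT R g a b (1 / 2) ab cg.
  by rewrite ga gb min_r ?max_l ?ler01 //; apply/andP; split; lra.
by rewrite /g; case: eqP => _ /=; lra.
Qed.

End LoopPath.

(* The number of such points is the topological invariant that tells the tangents apart. *)
Definition trisects (R : realType) n (T : set 'rV[R]_n) (p : 'rV[R]_n) := T p /\
  exists chi : 'rV[R]_n -> nat,
    (forall x, T x -> x <> p -> exists2 e : R, 0 < e &
       forall y, T y -> y <> p -> edist x y < e -> chi x = chi y) /\
    forall c, (c < 3)%N -> exists x, [/\ T x, x <> p & chi x = c].

Lemma trisects_homeo (R : realType) n m (A : set 'rV[R]_n) (B : set 'rV[R]_m) f g p :
  f @` A = B -> g @` B = A -> {within A, continuous f} ->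
  (forall a, A a -> g (f a) = a) -> (forall b, B b -> f (g b) = b) ->
  trisects B p -> trisects A (g p).
Proof.
move=> fA gB cf gf fg [Bp [chi [loc sur]]].
have fAB a : A a -> B (f a) by move=> Aa; rewrite -fA; exists a.
have gBA b : B b -> A (g b) by move=> Bb; rewrite -gB; exists b.
have ne a : A a -> a <> g p -> f a <> p by move=> Aa h fp; apply: h; rewrite -fp gf.
split; first exact: gBA.
exists (chi \o f); split=> [x Ax xp|c c3].
  have [e e0 he] := loc _ (fAB x Ax) (ne x Ax xp).
  have [dl dl0 hd] := within_continuous_edist cf Ax e0.
  by exists dl => // y Ay yp xy; apply: he; [exact: fAB | exact: ne | exact: hd].
have [x [Bx xp <-]] := sur c c3; exists (g x); split; first exact: gBA.
  by move=> h; apply: xp; rewrite -(fg x Bx) h fg.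
by rewrite /= fg.
Qed.

Section LoopCurves.
Variables (R : realType) (N : nat) (F : nat -> R -> 'rV[R]_N) (al C : R).
Hypotheses (al0 : 0 < al) (C0 : 0 <= C).
Hypothesis Fhold : forall k u v, edist (F k u) (F k v) <= C * `|u - v| `^ al.
Hypothesis Flow : forall k u v, 0 < rhoF k u v -> rhoF k u v `^ al / 64 <= edist (F k u) (F k v).
Hypothesis Fcross : forall k q, (q < k)%N -> F k q%:R = F k (q%:R + 1 / 2).

Lemma F_sep k u v (dl : R) : 0 < dl -> dl <= rhoF k u v -> dl `^ al / 64 <= edist (F k u) (F k v).
Proof.
move=> d0 h; apply: le_trans (Flow (lt_le_trans d0 h)); rewrite ler_pM2r ?invr_gt0 ?ltr0n //.
by apply: ge0_ler_powR; rewrite ?nnegrE ?(ltW al0) //; lra.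
Qed.

Lemma F_unif (z : R) : 0 < z -> exists2 dl : R, 0 < dl &
  forall k u v, `|u - v| < dl -> edist (F k u) (F k v) < z.
Proof.
move=> z0; have c1 : 0 < C + 1 by have := C0; move=> ?; lra.
exists ((z / (C + 1)) `^ al^-1); first by rewrite powR_gt0 // divr_gt0.
move=> k u v uv; apply: le_lt_trans (Fhold k u v) _.
have h : `|u - v| `^ al <= z / (C + 1).
  have e2 : z / (C + 1) = ((z / (C + 1)) `^ al^-1) `^ al.
    by rewrite -powRrM mulVf ?powRr1 ?gt_eqF // ltW // divr_gt0.
  by rewrite e2; apply: ge0_ler_powR; rewrite ?nnegrE ?powR_ge0 // ltW.
apply: (@le_lt_trans _ _ (C * (z / (C + 1)))); first by rewrite ler_wpM2l.
by rewrite mulrA ltr_pdivrMr // mulrDr mulr1 mulrC; lra.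
Qed.

Lemma F_eq k u v : u < v -> F k u = F k v -> exists q, [/\ (q < k)%N, u = q%:R & v = q%:R + 1 / 2].
Proof.
move=> uv E; apply: rhoF_eq0 => //; rewrite leNgt; apply/negP => h.
have := Flow h; rewrite E edistxx leNgt divr_gt0 ?powR_gt0 ?ltr0n //.
Qed.

(** The colour of a point is the piece of some chosen parameter. The choice does no harm, because
    two parameters of one point other than the crossing always lie in the same piece. *)
Lemma F_trisects k q : (q < k)%N -> trisects (range (F k)) (F k q%:R).
Proof.
move=> qk; split; first by exists q%:R.
set p := F k q%:R.
have pE u : F k u <> p -> u <> q%:R /\ u <> q%:R + 1 / 2.
  by move=> h; split=> E; apply: h; rewrite E // -Fcross.
have pN u : u <> q%:R -> u <> q%:R + 1 / 2 -> F k u <> p.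
  move=> u1 u2 E; have [uq|uq|//] := ltgtP u q%:R.
    have [q' [_ e1 e2]] := F_eq uq E.
    have q2 : (2 * q)%:R = (2 * q' + 1)%:R :> R by rewrite natrD !natrM; lra.
    by move/eqP: q2; rewrite eqr_nat; lia.
  have [q' [_ e1 e2]] := F_eq uq (esym E).
  have E' : q = q' by apply/eqP; rewrite -(eqr_nat R) e1.
  by apply: u2; rewrite e2 E'.
have lift x : exists u, range (F k) x -> F k u = x.
  by have [[u _ <-]|no] := pselect (range (F k) x); [exists u | exists 0].
have [inv hinv] := choice lift.
have sep u v : F k u <> p -> F k v <> p -> piece q u <> piece q v -> F k u <> F k v.
  move=> /pE[u1 u2] /pE[v1 v2] h E.
  have [dl d0 hd] := cross_sep qk u1 u2.
  have := F_sep d0 (hd v v1 v2 h); rewrite E edistxx leNgt divr_gt0 ?powR_gt0 ?ltr0n //.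
have pinv u : F k u <> p -> piece q (inv (F k u)) = piece q u.
  move=> up; have E := hinv (F k u) (ex_intro2 _ _ u I erefl).
  by apply/eqP/negPn/negP => /eqP h; apply: (sep _ u _ up h) => //; rewrite E.
exists (piece q \o inv); split=> [_ [u _ <-] up|c c3].
  have [u1 u2] := pE u up; have [dl d0 hd] := cross_sep qk u1 u2.
  exists (dl `^ al / 64); first by rewrite divr_gt0 ?powR_gt0 ?ltr0n.
  move=> _ [v _ <-] vp uv /=; rewrite !pinv //; have [v1 v2] := pE v vp.
  apply/eqP/negPn/negP => /eqP h.
  by have := F_sep d0 (hd v v1 v2 h); rewrite leNgt uv.
have [u [u1 u2 pu]] : exists u : R, [/\ u <> q%:R, u <> q%:R + 1 / 2 & piece q u = c].
  case: c c3 => [|[|[|//]]] _.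
  - by exists (q%:R - 1); split; [lra|lra|rewrite /piece ifT //; lra].
  - by exists (q%:R + 1 / 4); split; [lra|lra|rewrite /piece ifF ?ifT //; [lra|apply/negbTE; rewrite -leNgt; lra]].
  - exists (q%:R + 1); split; [lra|lra|rewrite /piece ifF ?ifF //; apply/negbTE; rewrite -leNgt; lra].
have up := pN u u1 u2; exists (F k u); split => //.
by rewrite /= pinv.
Qed.

(** A point with a single parameter leaves the images of two open half-lines, and a locally constant
    colouring is constant on each, so only two colours can occur. A point with two parameters is a
    crossing. *)
Lemma F_nontrisects k p : trisects (range (F k)) p -> exists2 q, (q < k)%N & p = F k q%:R.
Proof.
move=> [[u0 _ <-] [chi [loc sur]]]; apply: contrapT => no.
have ne u : u <> u0 -> F k u <> F k u0.
  move=> uu E; apply: no; have [h|h|//] := ltgtP u u0.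
    by have [q [qk e1 e2]] := F_eq h E; exists q; rewrite // e2 Fcross.
  by have [q [qk e1 e2]] := F_eq h (esym E); exists q; rewrite // e1.
have cst a b : a <= b -> (b < u0 \/ u0 < a) -> chi (F k a) = chi (F k b).
  move=> ab side; apply: (@locally_constant _ (chi \o F k)) => // x /andP[x1 x2].
  have out y : a <= y <= b -> F k y <> F k u0.
    by move=> /andP[y1 y2]; apply: ne => yu; move: side; rewrite -yu; case=> ?; lra.
  have [|e e0 he] := loc (F k x) (ex_intro2 _ _ x I erefl); first by apply: out; rewrite x1.
  have [dl d0 hd] := F_unif e0; exists dl => // y yab xy; apply: he; [by exists y | exact: out | exact: hd].
have cst2 a b : (a < u0 /\ b < u0) \/ (u0 < a /\ u0 < b) -> chi (F k a) = chi (F k b).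
  move=> side; have [ab|ba] := leP a b; first by apply: cst => //; case: side => -[? ?]; [left|right].
  by apply/esym/cst; rewrite ?ltW //; case: side => -[? ?]; [left|right].
have side u : u <> u0 -> u < u0 \/ u0 < u by have [h|h|h] := ltgtP u u0; [left|right|].
have [x0 [[a _ <-] an ca]] := sur 0%N isT; have [x1 [[b _ <-] bn cb]] := sur 1%N isT.
have [x2 [[c _ <-] cn cc]] := sur 2%N isT.
have off u : F k u <> F k u0 -> u <> u0 by move=> h E; apply: h; rewrite E.
case: (side a (off _ an)) => ha; case: (side b (off _ bn)) => hb; case: (side c (off _ cn)) => hc.
- by have := cst2 a b (or_introl (conj ha hb)); rewrite ca cb.
- by have := cst2 a b (or_introl (conj ha hb)); rewrite ca cb.
- by have := cst2 a c (or_introl (conj ha hc)); rewrite ca cc.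
- by have := cst2 b c (or_intror (conj hb hc)); rewrite cb cc.
- by have := cst2 b c (or_introl (conj hb hc)); rewrite cb cc.
- by have := cst2 a c (or_intror (conj ha hc)); rewrite ca cc.
- by have := cst2 a b (or_intror (conj ha hb)); rewrite ca cb.
- by have := cst2 a b (or_intror (conj ha hb)); rewrite ca cb.
Qed.

(** The crossings are the trisecting points, so a homeomorphism maps the [j] crossings of one curve
    injectively into the [i] crossings of the other. *)
Lemma homeo_le i j : homeomorphic (range (F i)) (range (F j)) -> (j <= i)%N.
Proof.
move=> [f [g [fA gB [cf cg] gf fg]]].
have H (q : 'I_j) : exists q' : 'I_i, g (F j q%:R) = F i q'%:R.
  have [q' qi E] := F_nontrisects (trisects_homeo fA gB cf gf fg (F_trisects (ltn_ord q))).
  by exists (Ordinal qi).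
have [h hh] := choice H.
have inj : injective h.
  move=> q q' E; have : F j q%:R = F j q'%:R.
    by rewrite -(fg (F j q%:R)) ?hh ?E -?hh ?fg //; eexists.
  move=> E2; apply/val_inj/eqP; rewrite -(eqr_nat R); apply/eqP.
  (* A value is repeated only at times half a unit apart, which two integers never are. *)
  have [l|l|//] := ltgtP (q%:R : R) q'%:R.
    have [a [_ e1 e2]] := F_eq l E2.
    have : (2 * q')%:R = (2 * q + 1)%:R :> R by rewrite natrD !natrM; lra.
    by move/eqP; rewrite eqr_nat; lia.
  have [a [_ e1 e2]] := F_eq l (esym E2).
  have : (2 * q)%:R = (2 * q' + 1)%:R :> R by rewrite natrD !natrM; lra.
  by move/eqP; rewrite eqr_nat; lia.
by have := leq_card h inj; rewrite !card_ord.
Qed.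

Lemma homeomorphic_sym n m (A : set 'rV[R]_n) (B : set 'rV[R]_m) : homeomorphic A B -> homeomorphic B A.
Proof. by move=> [f [g [fA gB [cf cg] gf fg]]]; exists g, f. Qed.

Lemma not_homeomorphic i j : i <> j -> ~ homeomorphic (range (F i)) (range (F j)).
Proof.
move=> ij h; apply: ij; apply/eqP; rewrite eqn_leq.
by rewrite (homeo_le h) (homeo_le (homeomorphic_sym h)).
Qed.

End LoopCurves.

(** * Triods and self-similar sets *)

Section Links.
Variables (R : realType) (n : nat).
Implicit Types (X Y : set 'rV[R]_n) (a b c : 'rV[R]_n) (h : R).

(** Chains of step [h] replace paths because, unlike connectedness, they pass to any set that is
    close in the sense of the excess. *)
Inductive link X h a : 'rV[R]_n -> Prop :=
| link_refl : X a -> link X h a a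
| link_step b c : link X h a b -> X c -> edist b c <= h -> link X h a c.

Lemma link_mem X h a b : link X h a b -> X a /\ X b.
Proof. by elim=> [//|b' c _ [Xa _] Xc _]. Qed.

Lemma link_trans X h a b c : link X h a b -> link X h b c -> link X h a c.
Proof. by move=> hab; elim=> [//|b' c' _ IH Xc bc]; exact: link_step IH Xc bc. Qed.

Lemma link_sym X h a b : link X h a b -> link X h b a.
Proof.
elim=> [|b' c l IH Xc bc]; first exact: link_refl.
have [_ Xb] := link_mem l; apply: link_trans IH.
by apply: link_step (link_refl h Xc) Xb _; rewrite edistC.
Qed.

Lemma link_approx X Y h dl h' a b : 0 <= h -> h + 2 * dl <= h' ->
  (forall x, X x -> exists2 y, Y y & edist x y <= dl) -> link X h a b ->
  forall a' b', Y a' -> Y b' -> edist a a' <= dl -> edist b b' <= dl -> link Y h' a' b'.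
Proof.
move=> h0 hh XY; elim=> [Xa|b0 c l IH Xc bc] a' b' Ya' Yb' aa' bb'.
  apply: link_step (link_refl h' Ya') Yb' _.
  by have := edist_triangle a a' b'; rewrite (edistC a' a); lra.
have [_ Xb] := link_mem l; have [b1 Yb1 bb1] := XY b0 Xb.
apply: link_step (IH a' b1 Ya' Yb1 aa' bb1) Yb' _.
have := edist_triangle b0 b1 b'; have := edist_triangle c b0 b'.
by rewrite (edistC b1 b0); lra.
Qed.

(** Tangents are approximated only inside balls; a chain, being finite, lies in one. *)
Lemma link_bounded X h a b : link X h a b ->
  exists r0, forall r, r0 <= r -> link (X `&` [set x | enorm x <= r]) h a b.
Proof.
elim=> [Xa|b0 c l [r0 IH] Xc bc]; first by exists (enorm a) => r ar; apply: link_refl.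
exists (Num.max r0 (enorm c)) => r; rewrite ge_max => /andP[rr cr].
exact: link_step (IH r rr) (conj Xc cr) bc.
Qed.

Definition away X c (sg : R) := [set x | X x /\ sg <= edist x c].

(* Three points, each joined to the other two away from the third one: a tripod or a loop contains such
   a configuration for all [h], while an arc does not. *)
Definition triod X (sg h : R) := exists a b c,
  [/\ link (away X c sg) h a b, link (away X a sg) h b c & link (away X b sg) h a c].

Lemma triod_approx X Y sg h dl sg' h' : 0 <= h -> h + 2 * dl <= h' -> sg' + 2 * dl <= sg ->
  (forall x, X x -> exists2 y, Y y & edist x y <= dl) -> triod X sg h -> triod Y sg' h'.
Proof.
move=> h0 hh sgs XY [a [b [c [hab hbc hac]]]].
have [[Xa _] [Xb _]] := link_mem hab; have [_ [Xc _]] := link_mem hbc.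
have [a' Ya' aa'] := XY a Xa; have [b' Yb' bb'] := XY b Xb; have [c' Yc' cc'] := XY c Xc.
have far p p' x y : edist p p' <= dl -> edist x y <= dl -> sg <= edist x p -> sg' <= edist y p'.
  rewrite /= => pp' xy xp; have := edist_triangle y x p; have := edist_triangle p' y p.
  by rewrite (edistC p' p); lra.
have key p p' u v u' v' : edist p p' <= dl -> link (away X p sg) h u v -> Y u' -> Y v' ->
    edist u u' <= dl -> edist v v' <= dl -> link (away Y p' sg') h' u' v'.
  move=> pp' l Yu' Yv' uu' vv'; have [[_ up] [_ vp]] := link_mem l.
  apply: (link_approx h0 hh _ l) (uu') (vv') => //.
  - move=> x [Xx xp]; have [y Yy xy] := XY x Xx; exists y => //; split => //; exact: far pp' xy xp.
  - split => //; exact: far pp' uu' up.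
  - split => //; exact: far pp' vv' vp.
exists a', b', c'; split; [exact: key cc' hab _ _ _ _ | exact: key aa' hbc _ _ _ _ | exact: key bb' hac _ _ _ _].
Qed.

Lemma triod_bounded X sg h : triod X sg h ->
  exists2 r, 0 < r & triod (X `&` [set x | enorm x <= r]) sg h.
Proof.
move=> [a [b [c [/link_bounded[r1 h1] /link_bounded[r2 h2] /link_bounded[r3 h3]]]]].
pose r := Num.max 1 (Num.max r1 (Num.max r2 r3)).
have eqA p : away X p sg `&` [set x | enorm x <= r] = away (X `&` [set x | enorm x <= r]) p sg.
  by apply/seteqP; split => x /= => [[[? ?] ?]|[[? ?] ?]].
exists r; first by rewrite lt_max ltr01.
exists a, b, c; rewrite -!eqA; split; [apply: h1|apply: h2|apply: h3]; by rewrite !le_max lexx ?orbT.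
Qed.

Lemma link_path (G : R -> 'rV[R]_n) X h u v : u <= v ->
  (exists2 dl : R, 0 < dl & forall x y, `|x - y| < dl -> edist (G x) (G y) < h) ->
  (forall t, u <= t <= v -> X (G t)) -> link X h (G u) (G v).
Proof.
move=> uv [dl d0 hd] hX; have d1 : 0 < dl^-1 by rewrite invr_gt0.
pose m := Num.bound ((v - u) / dl).
have hm : (v - u) / dl < m%:R by apply: archi_boundP; rewrite divr_ge0 ?subr_ge0 // ltW.
have m0 : 0 < m%:R :> R by apply: le_lt_trans hm; rewrite divr_ge0 ?subr_ge0 // ltW.
pose st := (v - u) / m%:R.
have st0 : 0 <= st by rewrite divr_ge0 ?subr_ge0.
have std : st < dl by rewrite ltr_pdivrMr // mulrC -ltr_pdivrMr.
have stm : m%:R * st = v - u by rewrite /st mulrC divfK // gt_eqF.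
have key k : (k <= m)%N -> link X h (G u) (G (u + k%:R * st)).
  elim: k => [|k IH] km.
    by rewrite mul0r addr0; apply/link_refl/hX; rewrite lexx.
  have kst : k.+1%:R * st <= m%:R * st by rewrite ler_wpM2r // ler_nat.
  apply: link_step (IH (ltnW km)) _ _.
    by apply: hX; rewrite lerDl mulr_ge0 //= -lerBrDl -stm.
  apply/ltW/hd; have -> : u + k%:R * st - (u + k.+1%:R * st) = - st by rewrite -natr1; ring.
  by rewrite normrN ger0_norm.
by have := key m (leqnn m); rewrite stm addrC subrK.
Qed.

Section Arc.
Variables (G : R -> 'rV[R]_n) (p q al C h sg : R).
Hypotheses (al0 : 0 < al) (C0 : 0 <= C) (h0 : 0 <= h) (hsg : 64 * C * h < sg).
Let I := [set t : R | p <= t <= q].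
Hypothesis Glow : forall u v, I u -> I v -> `|u - v| `^ al / 64 <= edist (G u) (G v).
Hypothesis Gup : forall u v, I u -> I v -> edist (G u) (G v) <= C * `|u - v| `^ al.

(** Stepping over [w] takes at least the time from [u] to [w]. The lower bound turns the step [h]
    into a bound on time, and the upper bound turns this into distance at most 64 C h. *)
Lemma arc_step u v w : I u -> I v -> I w -> edist (G u) (G v) <= h -> (v < w) != (u < w) ->
  edist (G u) (G w) < sg.
Proof.
move=> Iu Iv Iw uvh side; apply: le_lt_trans hsg; apply: le_trans (Gup Iu Iw) _.
have uw : `|u - w| <= `|u - v|.
  case: (ltP u w) side => uw; case: (ltP v w) => vw // _.
    by rewrite (ltr0_norm (_ : u - w < 0)) ?ler0_norm; lra.
  by rewrite (ger0_norm (_ : 0 <= u - w)) ?ger0_norm; lra.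
have : `|u - w| `^ al <= `|u - v| `^ al by apply: ge0_ler_powR; rewrite ?nnegrE // ltW.
have := Glow Iu Iv => h1 h2; rewrite [64 * C]mulrC -mulrA; apply: ler_wpM2l => //.
by apply: le_trans h2 _; lra.
Qed.

Lemma arc_side w u y : I w -> I u -> link (away (G @` I) (G w) sg) h (G u) y ->
  forall v, I v -> y = G v -> (v < w) = (u < w).
Proof.
move=> Iw Iu; elim=> [[_ uw] v Iv E|b c l IH _ bc v Iv E].
  apply/eqP/negPn/negP => side.
  have := @arc_step u v w Iu Iv Iw; rewrite E edistxx => /(_ h0 side).
  by rewrite -E ltNge uw.
have [_ [[v' Iv' bE] bw]] := link_mem l.
rewrite -(IH v' Iv' (esym bE)); apply/eqP/negPn/negP => side.
by have := @arc_step v' v w Iv' Iv Iw; rewrite bE -E => /(_ bc side); rewrite ltNge bw.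
Qed.

(** Of the three parameters one lies between the other two, and the chain joining those two while
    avoiding its point would have to step over it. *)
Lemma arc_no_triod : ~ triod (G @` I) sg h.
Proof.
have sg0 : 0 < sg by apply: le_lt_trans hsg; rewrite !mulr_ge0.
move=> [a [b [c [hab hbc hac]]]].
have [[[u Iu ua] ac] [[v Iv vb] bc]] := link_mem hab; have [_ [[w Iw wc] ca]] := link_mem hbc.
have [[_ ab] _] := link_mem hac.
move: hab hbc hac ac bc ca ab; rewrite -ua -vb -wc => hab hbc hac ac bc ca ab.
have s1 := arc_side Iw Iu hab Iv erefl; have s2 := arc_side Iu Iv hbc Iw erefl.
have s3 := arc_side Iv Iu hac Iw erefl.
have ne x y : sg <= edist (G x) (G y) -> x != y.
  by move=> xy; apply/eqP => E; move: xy; rewrite E edistxx leNgt sg0.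
have := ne _ _ ac; have := ne _ _ bc; have := ne _ _ ab; move: s1 s2 s3.
by case: (ltgtP u v); case: (ltgtP u w); case: (ltgtP v w).
Qed.
End Arc.
End Links.

Lemma triod_image (R : realType) n m (f : 'rV[R]_n -> 'rV[R]_m) X Y (sg h sg' h' : R) :
  (forall x, X x -> Y (f x)) ->
  (forall x y, X x -> X y -> sg <= edist x y -> sg' <= edist (f x) (f y)) ->
  (forall x y, X x -> X y -> edist x y <= h -> edist (f x) (f y) <= h') ->
  triod X sg h -> triod Y sg' h'.
Proof.
move=> XY hsg hh [a [b [c [hab hbc hac]]]].
have [[Xa _] [Xb _]] := link_mem hab; have [_ [Xc _]] := link_mem hbc.
have key p u v : X p -> link (away X p sg) h u v -> link (away Y (f p) sg') h' (f u) (f v).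
  move=> Xp; elim=> [[Xu up]|b' c' l IH [Xc' cp] bc].
    by apply: link_refl; split; [exact: XY | exact: hsg].
  have [_ [Xb' _]] := link_mem l.
  by apply: link_step IH _ _; [split; [exact: XY | exact: hsg] | exact: hh].
by exists (f a), (f b), (f c); split; apply: key.
Qed.

Lemma triod_sub (R : realType) n (X Y : set 'rV[R]_n) sg h sg' h' : X `<=` Y -> sg' <= sg -> h <= h' ->
  triod X sg h -> triod Y sg' h'.
Proof.
move=> XY s1 h1; apply: (@triod_image _ _ _ id) => // x y _ _; first exact: le_trans s1.
by move=> xy; apply: le_trans xy h1.
Qed.

(** The product serves as a common positive lower bound without choosing a minimum over the
    family. *)
Lemma prod_lower (R : realType) (k : nat) (r : 'I_k -> R) : (forall i, 0 < r i <= 1) ->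
  0 < \prod_i r i /\ forall i, \prod_i r i <= r i.
Proof.
move=> hr; have r0 i : 0 < r i by have /andP[] := hr i.
split; first exact: prodr_gt0.
move=> i; rewrite (bigD1 i) //= -[leRHS]mulr1 ler_pM2l //.
by apply: prodr_ile1 => j _; have /andP[/ltW-> ->] := hr j.
Qed.

Lemma compact_diam (R : realType) n (Q : set 'rV[R]_n) : compact Q ->
  exists2 D : R, 0 < D & forall x y, Q x -> Q y -> edist x y <= D.
Proof.
move=> cQ; have [[q0 Qq0]|no] := pselect (Q !=set0); last first.
  by exists 1 => // x y Qx; case: no; exists x.
have cf : {within Q, continuous (fun x : 'rV[R]_n => edist x q0)}.
  apply: continuous_subspaceT => x; apply/(cvgrPdist_lt (FF := nbhs_filter x)) => z z0.
  have := edist_nbhs x z0; apply: filterS => y /= xy.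
  by apply: le_lt_trans (edist_lip _ _ _) xy.
have [c _ hc] := EVT_max_rV (ex_intro _ q0 Qq0) cQ cf.
have h x : Q x -> edist x q0 <= edist c q0 by move=> Qx; apply: hc; rewrite inE.
exists (2 * edist c q0 + 1); first by have := edist_ge0 c q0; lra.
move=> x y Qx Qy; have := edist_triangle q0 x y; rewrite (edistC q0 y).
by have := h x Qx; have := h y Qy; lra.
Qed.

(** Maps are composed along an address of [y] until the ratio first drops to [l]; the last factor
    costs at most [a], the product of all ratios. Since every ratio is at most 1 - b, with b the
    product of the numbers [1 - r i], this happens after finitely many steps. *)
Lemma self_similar_copy (R : realType) n (Q : set 'rV[R]_n) : self_similar Q ->
  exists2 a : R, 0 < a & forall l y, 0 < l -> l < 1 -> Q y ->
    exists psi (rho : R), [/\ a * l <= rho, rho <= l, forall u v, edist (psi u) (psi v) = rho * edist u v,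
      forall x, Q x -> Q (psi x) & exists2 y', Q y' & psi y' = y].
Proof.
move=> [k [phi [k0 sim _ [_ _ QE]]]].
have [r hr] := choice sim.
have r0 i : 0 < r i by have [/andP[]] := hr i.
have r1 i : r i < 1 by have [/andP[]] := hr i.
have [|a0 ha] := @prod_lower _ _ r; first by move=> i; rewrite r0 ltW.
have [|b0 hb] := @prod_lower _ _ (fun i => 1 - r i); first by move=> i; have := r0 i; have := r1 i; move=> ? ?; apply/andP; split; lra.
set a := \prod_i r i in a0 ha *; set b := \prod_i (1 - r i) in b0 hb.
have b1 : 0 < 1 - b.
  by have := hb (Ordinal k0); have := r0 (Ordinal k0); move=> ? ?; lra.
have Qphi i x : Q x -> Q (phi i x) by move=> Qx; rewrite QE; exists i => //; exists x.
exists a => // l y l0 l1 Qy.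
have key m : exists psi (rho : R), [/\ 0 < rho, forall u v, edist (psi u) (psi v) = rho * edist u v,
    forall x, Q x -> Q (psi x), exists2 y', Q y' & psi y' = y &
    (a * l <= rho /\ rho <= l) \/ (l < rho /\ rho <= (1 - b) ^+ m)].
  elim: m => [|m [psi [rho [p0 ps pQ [y' Qy' py'] side]]]].
    exists id, 1; split => //; [by move=> u v; rewrite mul1r | by exists y | by right; rewrite expr0].
  case: side => [side|[s1 s2]]; first by exists psi, rho; split=> //; [exists y' | left].
  have [i _ [y2 Qy2 hy2]] : (\bigcup_i (phi i @` Q)) y' by rewrite -QE.
  exists (psi \o phi i), (rho * r i); split.
  - by rewrite mulr_gt0.
  - by move=> u v /=; rewrite ps; have [_ ->] := hr i; rewrite mulrA.
  - by move=> x Qx /=; apply/pQ/Qphi.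
  - by exists y2; rewrite //= hy2.
  have [le1|lt1] := leP (rho * r i) l; [left | right].
    split => //; rewrite mulrC; apply: ler_pM => //; exact: ltW.
  split=> //; rewrite exprSr; apply: ler_pM => //; try exact: ltW.
  by have := hb i; move=> ?; lra.
have inv1 : 1 < (1 - b)^-1 by rewrite invf_gt1 //; lra.
have [m hm] := pow_small inv1 l0; have {}hm := hm m (leqnn m); rewrite exprVn invrK in hm.
have [psi [rho [p0 ps pQ py side]]] := key m; exists psi, rho.
case: side => [[? ?]|[s1 s2]]; first by split.
by have := le_trans s2 hm; rewrite leNgt s1.
Qed.

Section Exclusion.
Variables (R : realType) (N : nat) (F : nat -> R -> 'rV[R]_N) (al C : R).
Hypotheses (al0 : 0 < al) (C0 : 0 <= C).
Hypothesis Fhold : forall k u v, edist (F k u) (F k v) <= C * `|u - v| `^ al.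
Hypothesis Flow : forall k u v, 0 < rhoF k u v -> rhoF k u v `^ al / 64 <= edist (F k u) (F k v).
Hypothesis Fcross : forall k q, (q < k)%N -> F k q%:R = F k (q%:R + 1 / 2).

(** The points lie before the loop, after it, and on it opposite to where it closes. The way from
    the first to the second skips the loop at the crossing, where the times 0 and 1/2 give the same
    point. *)
Lemma F1_triod : exists2 sg : R, 0 < sg & forall h, 0 < h -> triod (range (F 1)) sg h.
Proof.
pose sg : R := (1 / 2) `^ al / 64; have h2 : 0 < 1 / 2 :> R by lra.
exists sg; first by rewrite divr_gt0 ?powR_gt0 ?ltr0n.
move=> h h0; have [dl d0 hd] := F_unif al0 C0 Fhold h0.
have sep u v : 1 / 2 <= rhoF 1 u v -> sg <= edist (F 1 u) (F 1 v) by exact: F_sep.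
have path u v w : u <= v -> (forall t, u <= t <= v -> 1 / 2 <= rhoF 1 t w) ->
    link (away (range (F 1)) (F 1 w) sg) h (F 1 u) (F 1 v).
  move=> uv hw; apply: link_path => //; first by exists dl => // x y; exact: hd.
  by move=> t /hw/sep.
have x2 : pathX (loopS 1) 2 = 2 :> R by rewrite pathX_far // ler1n.
have [xm _] : pathX (loopS 1) (-1) = -1 :> R /\ pathY (loopS 1) (-1) = 0 :> R.
  by apply: path_line; rewrite ltrN10.
have [||xc yc] := @path_loop R 1 0 (1 / 4) isT; [lra|lra|].
rewrite !add0r in xc yc; rewrite max_l in xc; last lra; rewrite min_r in yc; last lra.
have dh : dz (1 / 2 : R) = 1 / 2.
  have := dz_gt0; rewrite /dz; have -> : Num.floor (1 / 2 : R) = 0 by apply: floor_unique; lra.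
  by move=> _; rewrite subr0 add0r min_l; lra.
exists (F 1 (-1)), (F 1 2), (F 1 (1 / 4)); split.
- apply: (@link_trans _ _ _ _ _ (F 1 0)).
    apply: path; first by lra.
    move=> t /andP[t1 t2]; have [t0|t0] := ltP t 0.
      apply: le_trans (rhoF_Y _ _ _); have [_ ->] := path_line 1 t0.
      by rewrite yc sub0r dzN (_ : 2 * (1 / 4) = 1 / 2 :> R) ?dh //; lra.
    have -> : t = 0 by lra.
    apply: le_trans (rhoF_Y _ _ _); have [_ ->] := path0 R 1.
    by rewrite yc sub0r dzN (_ : 2 * (1 / 4) = 1 / 2 :> R) ?dh //; lra.
  have -> : F 1 0 = F 1 (1 / 2) by have := Fcross (ltn0Sn 0); rewrite add0r.
  apply: path; first by lra.
  move=> t /andP[t1 t2]; have [t3|t3] := ltP t 1.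
    apply: le_trans (rhoF_Y _ _ _); have [||_] := @path_loop R 1 0 t isT; [lra|lra|].
    rewrite add0r min_l; last lra; move=> ->; rewrite yc.
    by rewrite (_ : 1 - 2 * (1 / 4) = 1 / 2 :> R) ?dh //; lra.
  apply: le_trans (rhoF_X _ _ _); rewrite xc pathX_far // subr0.
  by apply: le_trans (ler_norm _); lra.
- apply: link_sym; apply: path; first by lra.
  move=> t /andP[t1 t2]; apply: le_trans (rhoF_X _ _ _); rewrite xm opprK.
  apply: le_trans (ler_norm _); have := @pathX_ge0 R 1 t; lra.
- apply: path; first by lra.
  move=> t /andP[t1 t2]; apply: le_trans (rhoF_X _ _ _); rewrite x2 distrC.
  by apply: le_trans (ler_norm _); have /andP[_ h3] := pathX_near (loopS 1) t; lra.
Qed.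

Lemma line_arc k u v : u < 0 -> v < 0 -> `|u - v| `^ al / 64 <= edist (F k u) (F k v).
Proof.
move=> u0 v0; have [->|uv] := eqVneq u v.
  by rewrite subrr normr0 powR0 ?gt_eqF // mul0r edist_ge0.
apply: F_sep => //; first by rewrite normr_gt0 subr_eq0.
have [xu _] := path_line k u0; have [xv _] := path_line k v0.
by have := rhoF_X k u v; rewrite xu xv.
Qed.

(** The time -5 is well away from the loop, and 1/64 is what [Flow] guarantees at distance 1 along
    the line. *)
Lemma near_line u : edist (F 1 u) (F 1 (-5)) < 64^-1 -> -6 <= u <= -4.
Proof.
move=> h; have [x5 _] : pathX (loopS 1) (-5) = -5 :> R /\ pathY (loopS 1) (-5) = 0 :> R.
  by apply: path_line; lra.
have far : `|pathX (loopS 1) u + 5| < 1.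
  rewrite ltNge; apply/negP => h1; move: h; rewrite ltNge => /negP; apply.
  have := @F_sep _ _ _ _ al0 Flow 1 u (-5) 1 ltr01; rewrite powR1 mul1r; apply.
  by apply: le_trans (rhoF_X _ _ _); rewrite x5 opprK.
have /ltr_normlP[f1 f2] := far.
have [u0|u0] := ltP u 0; last by have := pathX_ge0 1 u0; lra.
by have [xu _] := path_line 1 u0; rewrite xu in f1 f2; apply/andP; split; lra.
Qed.

Lemma no_small_triod (sg h : R) (rho : R) : 0 <= h -> 64 * C * h < sg -> rho < 64^-1 ->
  ~ triod (range (F 1) `&` [set x | edist x (F 1 (-5)) <= rho]) sg h.
Proof.
move=> h0 hsg rho1 /triod_sub tri.
have sub : range (F 1) `&` [set x | edist x (F 1 (-5)) <= rho] `<=` F 1 @` [set t | -6 <= t <= -4].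
  by move=> _ [[u _ <-] /= ur]; exists u => //; apply: near_line; apply: le_lt_trans ur rho1.
apply: (@arc_no_triod _ _ (F 1) (-6) (-4) al C h sg) (tri _ _ _ sub (lexx _) (lexx _)) => //.
by move=> u v /= /andP[? ?] /andP[? ?]; apply: line_arc; lra.
Qed.

(** The bi-Lipschitz map costs a factor L^2 in the ratio of step to distance, and passing from the
    tangent to a blow-up of [Q] only an error in both that can be prescribed. Undoing the blow-up
    multiplies both by [r] and leaves the ratio alone. *)
Lemma self_similar_triods n (Q : set 'rV[R]_n) z T' : Tan Q z T' -> bilip_equiv (range (F 1)) T' ->
  forall e, 0 < e -> exists sg h, [/\ 0 < sg, 0 <= h, h <= e * sg & triod Q sg h].
Proof.
move=> /Tan_elim[Qz _ _ tan] [f [L [L0 [fT hf]]]] e e0.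
have [sg0 s0 tri] := F1_triod.
have m0 : 0 < Num.min 1 e by rewrite lt_min ltr01.
(* With the factor 6, after an approximation of accuracy L h0, the distance is still at least
   sg0/(2L) while the step 3 L h0 is at most e sg0/(2L). *)
pose h0 := sg0 / (6 * L ^+ 2) * Num.min 1 e.
have L2 : 0 < L ^+ 2 by rewrite exprn_gt0.
have h00 : 0 < h0 by rewrite mulr_gt0 // divr_gt0 // mulr_gt0.
have hL : L * h0 = sg0 / L / 6 * Num.min 1 e by rewrite /h0; field; rewrite gt_eqF.
have tL : 0 < sg0 / L by rewrite divr_gt0.
have Lh0 : 0 < L * h0 by rewrite mulr_gt0.
have Lh1 : L * h0 <= sg0 / L / 6.
  by rewrite hL ler_piMr ?ge_min ?lexx // divr_ge0 // ltW.
have Lhe : L * h0 <= sg0 / L / 6 * e.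
  by rewrite hL ler_wpM2l ?ge_min ?lexx ?orbT // divr_ge0 // ltW.
have /triod_bounded[R0 R00 triT'] : triod T' (sg0 / L) (L * h0).
  apply: triod_image (tri h0 h00); first by move=> x Tx; rewrite -fT; exists x.
    move=> x y Tx Ty xy; have /andP[h1 _] := hf x y Tx Ty; apply: le_trans h1.
    by rewrite mulrC ler_pM2l ?invr_gt0.
  by move=> x y Tx Ty xy; have /andP[_ h1] := hf x y Tx Ty; apply: le_trans h1 _; rewrite ler_pM2l.
have [r [r0 _ _ near]] := tan R0 (L * h0) 1 R00 Lh0 ltr01.
exists (r * (sg0 / L - 2 * (L * h0))), (r * (L * h0 + 2 * (L * h0))); split.
- by rewrite mulr_gt0 //; lra.
- by rewrite mulr_ge0 ?(ltW r0) //; lra.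
- rewrite [leRHS]mulrCA ler_pM2l //.
  have : e * (sg0 / L / 2) <= e * (sg0 / L - 2 * (L * h0)) by rewrite ler_pM2l //; lra.
  have : sg0 / L / 6 * e * 3 = e * (sg0 / L / 2) by field; rewrite gt_eqF.
  by lra.
have : triod [set r^-1 *: (y - z) | y in Q] (sg0 / L - 2 * (L * h0)) (L * h0 + 2 * (L * h0)).
  apply: (triod_approx (dl := L * h0) _ _ _ _ triT'); [exact: ltW | by [] | by rewrite subrK |].
  move=> v [Tv vr]; have [y Qy vy] := near v Tv vr; exists (r^-1 *: (y - z)); first by exists y.
  exact: ltW.
have iso x y : edist (z + r *: x) (z + r *: y) = r * edist x y.
  by rewrite ![z + _]addrC -[z]opprK edist_shift edist_scale gtr0_norm.
apply: (triod_image (f := fun w => z + r *: w)) => [_ [y Qy <-]|x y _ _|x y _ _]; rewrite ?iso ?ler_pM2l //.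
by rewrite scalerA mulfV ?gt_eqF // scale1r addrC subrK.
Qed.

Lemma triod_constants (e del q h : R) : 0 < e -> 0 < del -> 0 < q -> del <= q / 8 -> del <= q * e / 8 ->
  0 <= h -> h <= q * e / 4 ->
  [/\ 0 < q - 2 * del, 0 <= h + 2 * del & h + 2 * del <= e * (q - 2 * del)].
Proof.
move=> e0 del0 q0 dq1 dq2 h0 hq.
have : 0 <= e * (q / 2 - 2 * del) by apply: mulr_ge0; lra.
by move=> ?; split; lra.
Qed.

(** A triod of [Q] is copied by a similarity into [Q] near a point [y0] that represents [p] in the
    blow-up, and from there approximated in [T']. The copy has a size proportional to the blow-up
    scale, so the accuracy can be fixed before that scale is known. *)
Lemma tangent_local_triods n (Q : set 'rV[R]_n) z T' p : self_similar Q -> Tan Q z T' ->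
  (forall e, 0 < e -> exists sg h, [/\ 0 < sg, 0 <= h, h <= e * sg & triod Q sg h]) -> T' p ->
  forall rho e, 0 < rho -> 0 < e -> exists sg h, [/\ 0 < sg, 0 <= h, h <= e * sg &
    triod (T' `&` [set x | edist x p <= rho]) sg h].
Proof.
move=> ssQ /Tan_elim[Qz _ _ tan] triQ Tp rho e rho0 e0.
have [a a0 copy] := self_similar_copy ssQ.
have [D D0 hD] : exists2 D : R, 0 < D & forall x y, Q x -> Q y -> edist x y <= D.
  by have [k [phi [_ _ _ [cQ _ _]]]] := ssQ; exact: compact_diam.
have e4 : 0 < e / 4 by rewrite divr_gt0.
have [sQ [hQ [sQ0 hQ0 hsQ tri]]] := triQ _ e4.
(* This makes [kap * D] at most rho/2: a copy of ratio at most [r * kap] stays, after blow-up,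
   within rho/2 of the image of [y0]. *)
pose kap := rho / (2 * (D + rho)).
have kap0 : 0 < kap by rewrite divr_gt0 // mulr_gt0 // addr_gt0.
have kap1 : kap < 1 by rewrite ltr_pdivrMr ?mul1r; lra.
have kapD : kap * D <= rho / 2.
  by rewrite /kap mulrAC ler_pdivrMr ?mulr_gt0 ?addr_gt0 //; nra.
have m0 : 0 < Num.min 1 e by rewrite lt_min ltr01.
(* The number [a * kap * sQ] bounds the size of the copied triod after blow-up from below, whatever
   the scale [r]. *)
pose del := Num.min (rho / 4) (a * kap * sQ * Num.min 1 e / 8).
have q00 : 0 < a * kap * sQ * Num.min 1 e by rewrite mulr_gt0 // mulr_gt0 // mulr_gt0.
have del0 : 0 < del by rewrite lt_min !divr_gt0.
have del1 : del <= rho / 4 by rewrite ge_min lexx.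
have del2 : del <= a * kap * sQ * Num.min 1 e / 8 by rewrite ge_min lexx orbT.
pose R0 := enorm p + rho + 1; have R00 : 0 < R0 by have := enorm_ge0 p; rewrite /R0; lra.
have [r [r0 r1 fwd bwd]] := tan R0 del 1 R00 del0 ltr01.
have pR : enorm p <= R0 by rewrite /R0; lra.
have [y0 Qy0 py0] := bwd p Tp pR.
have rk0 : 0 < r * kap by rewrite mulr_gt0.
have rk1 : r * kap < 1 by apply: le_lt_trans kap1; rewrite ler_piMl // ltW.
have [psi [rp [p1 p2 ps pQ [y' Qy' py']]]] := copy (r * kap) y0 rk0 rk1 Qy0.
have ri : 0 < r^-1 by rewrite invr_gt0.
pose tau := rp / r.
have tau1 : a * kap <= tau by rewrite /tau ler_pdivlMr // -mulrA [kap * r]mulrC.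
have ak0 : 0 < a * kap by rewrite mulr_gt0.
have tau0 : 0 < tau by apply: lt_le_trans tau1.
pose f x := r^-1 *: (psi x - z).
have iso x y : edist (f x) (f y) = tau * edist x y.
  by rewrite edist_scale edist_shift ps (gtr0_norm ri) /tau mulrA [r^-1 * _]mulrC.
pose Y := [set r^-1 *: (y - z) | y in Q `&` [set y | edist y y0 <= r * (rho / 2)]].
have triY : triod Y (tau * sQ) (tau * hQ).
  apply: (triod_image (f := f)) tri => [x Qx|x y _ _|x y _ _]; rewrite ?iso ?ler_pM2l //.
  exists (psi x) => //; split; first exact: pQ.
  rewrite /= -py' ps; apply: (@le_trans _ _ (r * kap * D)).
    by apply: ler_pM; rewrite ?edist_ge0 ?hD //; apply: le_trans p1; rewrite mulr_ge0 ?ltW.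
  by rewrite -mulrA ler_pM2l.
set q := tau * sQ in triY; have q0 : 0 < q by rewrite mulr_gt0.
have qq : a * kap * sQ <= q by rewrite ler_pM2r.
have min1 : Num.min 1 e <= 1 by rewrite ge_min lexx.
have mine : Num.min 1 e <= e by rewrite ge_min lexx orbT.
have dq1 : del <= q / 8.
  apply: le_trans del2 _; rewrite ler_pM2r ?invr_gt0 ?ltr0n //.
  by apply: le_trans qq; rewrite ler_piMr // mulr_ge0 ?ltW.
have dq2 : del <= q * e / 8.
  apply: le_trans del2 _; rewrite ler_pM2r ?invr_gt0 ?ltr0n //.
  by apply: ler_pM => //; apply: ltW => //; apply: mulr_gt0.
have th : tau * hQ <= q * e / 4.
  have -> : q * e / 4 = tau * (e / 4 * sQ) by rewrite /q; field.
  by rewrite ler_pM2l.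
have th0 : 0 <= tau * hQ by rewrite mulr_ge0 // ltW.
have [qd hd0 hqd] := triod_constants e0 del0 q0 dq1 dq2 th0 th.
exists (q - 2 * del), (tau * hQ + 2 * del); split=> //.
apply: (triod_approx (dl := del) _ _ _ _ triY) => //; first by rewrite subrK.
move=> _ [y [Qy yy0] <-]; set w := r^-1 *: (y - z).
have wp : edist w p <= rho / 2 + del.
  apply: le_trans (edist_triangle (r^-1 *: (y0 - z)) _ _) _; apply: lerD; last by rewrite edistC ltW.
  by rewrite edist_scale edist_shift (gtr0_norm ri) mulrC ler_pdivrMr // mulrC.
have yz : edist y z <= R0 * r.
  have -> : edist y z = enorm w * r by rewrite /w enormZ (gtr0_norm ri) mulrAC mulVf ?mul1r // gt_eqF.
  rewrite ler_pM2r //; have := edist_triangle p w 0; rewrite !edist0 /R0; lra.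
have [v Tv wv] := fwd y Qy yz; exists v; last exact: ltW.
split => //=; have := edist_triangle w v p; rewrite (edistC v w); lra.
Qed.

(** Small triods exist at every point of the tangent, in particular at the image of [F 1 (-5)];
    pulled back they would sit on an arc. *)
Lemma not_bilip n (Q : set 'rV[R]_n) z T' : self_similar Q -> Tan Q z T' ->
  ~ bilip_equiv (range (F 1)) T'.
Proof.
move=> ssQ tanQ bi; have triQ := self_similar_triods tanQ bi.
have [f [L [L0 [fT hf]]]] := bi.
have L1 : 0 < L^-1 by rewrite invr_gt0.
have C1 : 0 < C + 1 by have := C0; move=> ?; lra.
have Tp : T' (f (F 1 (-5))) by rewrite -fT; exists (F 1 (-5)) => //; exists (-5).
have k0 : 0 < 64 * (C + 1) * L ^+ 2 by rewrite !mulr_gt0 // ?exprn_gt0 // ltr0n.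
(* Pulled back, this radius becomes 1/128 < 1/64. The ratio chosen next absorbs the loss L^2 and
   stays below 1/(64 C); [C + 1] keeps it defined and strict. *)
have rho0 : 0 < (L * 128)^-1 by rewrite invr_gt0 mulr_gt0 // ltr0n.
have e0 : 0 < (64 * (C + 1) * L ^+ 2)^-1 by rewrite invr_gt0.
have [sg [h [s0 h0 hs tri]]] := tangent_local_triods ssQ tanQ triQ Tp rho0 e0.
have lift y : exists x, T' y -> range (F 1) x /\ f x = y.
  have [Ty|no] := pselect (T' y); last by exists 0.
  by move: Ty; rewrite -{1}fT => -[x Tx <-]; exists x.
have [g hg] := choice lift.
have gup x y : T' x -> T' y -> edist (g x) (g y) <= L * edist x y.
  move=> /hg[gx ex] /hg[gy ey]; have /andP[h1 _] := hf _ _ gx gy; rewrite ex ey in h1.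
  by rewrite mulrC -ler_pdivrMr // mulrC.
have glow x y : T' x -> T' y -> edist x y / L <= edist (g x) (g y).
  move=> /hg[gx ex] /hg[gy ey]; have /andP[_ h1] := hf _ _ gx gy; rewrite ex ey in h1.
  by rewrite ler_pdivrMr // mulrC.
have gp : g (f (F 1 (-5))) = F 1 (-5).
  have [gx ex] := hg _ Tp; apply: edist_eq0.
  have /andP[h1 _] := hf _ _ gx (ex_intro2 _ _ (-5) I erefl); rewrite ex edistxx in h1.
  by apply/eqP; rewrite eq_le edist_ge0 andbT -(ler_pM2l L1) mulr0.
have small : 128^-1 < 64^-1 :> R by rewrite ltf_pV2 ?posrE ?ltr0n // ltr_nat.
apply: (@no_small_triod (sg / L) (L * h) 128^-1) => //.
- by rewrite mulr_ge0 // ltW.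
- rewrite ltr_pdivlMr //.
  have k1 : 64 * (C + 1) * L ^+ 2 * h <= sg by rewrite mulrC -ler_pdivlMr // mulrC.
  have -> : 64 * C * (L * h) * L = 64 * C * (L ^+ 2 * h) by ring.
  have [hz|hz] := eqVneq h 0; first by rewrite hz !mulr0.
  have : 0 < L ^+ 2 * h by rewrite mulr_gt0 ?exprn_gt0 // lt_neqAle eq_sym hz.
  by move: k1; rewrite -mulrA; move: (L ^+ 2 * h) => x; lra.
apply: (triod_image (f := g)) tri.
- move=> x [Tx /= xp]; split; first by have [] := hg x Tx.
  rewrite /= -gp; apply: le_trans (gup _ _ Tx Tp) _.
  by rewrite mulrC -ler_pdivlMr // -invfM mulrC.
- by move=> x y [Tx _] [Ty _] xy; apply: le_trans (glow x y Tx Ty); rewrite ler_pM2r.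
- by move=> x y [Tx _] [Ty _] xy; apply: le_trans (gup x y Tx Ty) _; rewrite ler_pM2l.
Qed.
End Exclusion.

(** * Dyadic levels and scale arithmetic *)

Lemma dyadic_level (R : realType) (x : R) : 0 < x -> x <= 1 / 2 ->
  exists l : nat, 1 / 4 < 2 ^+ l * x /\ 2 ^+ l * x <= 1 / 2.
Proof.
move=> x0 x2.
have ex : exists l : nat, 1 / 4 < 2 ^+ l * x.
  have [N HN] := pow_unbounded (x^-1) (ltr1n R 2).
  exists N; have := HN N (leqnn _); rewrite -(ler_pM2r x0) mulVf ?gt_eqF // => h; lra.
exists (ex_minn ex); case: ex_minnP => [[|m]] hm mi; first by split=> //; rewrite expr0 mul1r.
split=> //; rewrite exprS -mulrA; have [|h] := leP (2 ^+ m * x) (1 / 4); first by lra.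
by have := mi _ h; rewrite ltnn.
Qed.

Lemma intr_pow2M (R : realType) n (z : int) : (2 ^+ n * z)%:~R = 2 ^+ n * z%:~R :> R.
Proof. by rewrite intrM rmorphXn. Qed.

Lemma scale_alg (R : realType) (K b g : R) M A B : 0 < b -> 0 < g ->
  K * g * b ^+ B <= g ^+ A -> K * (b * g) ^- (M + A) * g ^+ M.+1 <= b ^- (M + A + B).
Proof.
move=> b0 g0 h; have pb n : 0 < b ^+ n by exact: exprn_gt0.
have pg n : 0 < g ^+ n by exact: exprn_gt0.
have hb n : b ^+ n != 0 by rewrite gt_eqF.
have hg n : g ^+ n != 0 by rewrite gt_eqF.
rewrite -[leRHS]mul1r ler_pdivlMr //.
have -> : K * (b * g) ^- (M + A) * g ^+ M.+1 * b ^+ (M + A + B) = K * g * b ^+ B / g ^+ A.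
  by rewrite exprMn !exprD exprS; field; rewrite !hb !hg.
by rewrite ler_pdivrMr // mul1r.
Qed.

Lemma edist_quad (R : realType) n (x x' y y' : 'rV[R]_n) a b : edist x x' <= a -> edist y y' <= b ->
  `|edist x y - edist x' y'| <= a + b.
Proof.
move=> h1 h2; have t1 := edist_triangle x' x y; have t2 := edist_triangle y' x' y.
have t3 := edist_triangle x x' y'; have t4 := edist_triangle y x y'.
rewrite (edistC x' x) in t3; rewrite (edistC y' y) in t2.
by rewrite ler_norml; apply/andP; split; lra.
Qed.

Lemma edist_scale_sub (R : realType) n (a : R) (x y z : 'rV[R]_n) : 0 < a ->
  edist (a *: (x - y)) (a *: (x - z)) = a * edist z y.
Proof. by move=> a0; rewrite edist_scale gtr0_norm // /edist opprB addrC addrA subrK. Qed.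

Lemma dist_itv (R : realType) (c t u : R) : 0 <= t <= c -> 0 <= u <= c -> `|t - u| <= c.
Proof. by move=> /andP[? ?] /andP[? ?]; rewrite ler_norml; apply/andP; split; lra. Qed.

Section Levels.
Variable R : realType.
Implicit Types x : R.

Lemma pow2V_le a b : (a <= b)%N -> 2 ^- b <= 2 ^- a :> R.
Proof. by move=> ab; rewrite lef_pV2 ?posrE ?exprn_gt0 // ler_weXn2l // ler1n. Qed.

Lemma pow2V_lt a b : (a < b)%N -> 2 * 2 ^- b <= 2 ^- a :> R.
Proof.
move=> ab; rewrite ler_pdivrMr ?exprn_gt0 // mulrC ler_pdivlMr ?exprn_gt0 // -exprS.
by rewrite ler_weXn2l // ler1n.
Qed.

Lemma level_ge x a l : x <= 2 ^- a / 2 -> 1 / 4 < 2 ^+ l * x -> (a <= l)%N.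
Proof.
move=> xa h; rewrite leqNgt; apply/negP => /pow2V_lt la.
have p : 0 < 2 ^+ l :> R by rewrite exprn_gt0.
have : x <= 2 ^- l / 4 by lra.
by rewrite -(ler_pM2l p) mulrA mulfV ?gt_eqF //; lra.
Qed.

Lemma level_lt x b l : 2 ^- b <= x -> 2 ^+ l * x <= 1 / 2 -> (l < b)%N.
Proof.
move=> xb h; rewrite ltnNge; apply/negP => /pow2V_le bl.
have p : 0 < 2 ^+ l :> R by rewrite exprn_gt0.
have : 2 ^- l <= x by lra.
by rewrite -(ler_pM2l p) mulfV ?gt_eqF //; lra.
Qed.

End Levels.

(** * The curve *)

Section Blocks.
Variable e : nat.
Hypothesis e1 : (0 < e)%N.

(* Block [i] has [kk i] loops per cluster and clusters at distance [2 ^ ww i]; writing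
   [i.+1 = 2^k * 3^m * 5^z], every pair [(k, k + m + 4)] occurs for infinitely many [i]. The loops of block
   [i] live at level [NN i]; the gaps [AA i] and [BB i] keep the blocks from interfering. *)
Definition kk i := logn 2 i.+1.
Definition ww i := (kk i + logn 3 i.+1 + 4)%N.
Definition BB i := (i.+1 + ww i)%N.
Definition AA i := (e * BB i)%N.
Fixpoint MM i := if i is i'.+1 then (MM i' + AA i' + BB i')%N else 0%N.
Definition NN i := (MM i + AA i)%N.

Lemma BB_AA i : (BB i <= AA i)%N. Proof. by rewrite /AA leq_pmull. Qed.
Lemma MMS i : MM i.+1 = (NN i + BB i)%N. Proof. by []. Qed.
Lemma MM_lt_NN i : (MM i < NN i)%N. Proof. by have := BB_AA i; rewrite /NN /BB; lia. Qed.
Lemma NN_lt_MM i : (NN i < MM i.+1)%N. Proof. by rewrite MMS /BB; lia. Qed.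
Lemma MM_lt i : (MM i < MM i.+1)%N.
Proof. exact: ltn_trans (MM_lt_NN i) (NN_lt_MM i). Qed.

Lemma MM_mono i j : (i <= j)%N -> (MM i <= MM j)%N.
Proof.
move=> /subnK <-; elim: (j - i)%N => //= n IH.
exact: leq_trans IH (ltnW (MM_lt _)).
Qed.

Lemma NN_mono i j : (i < j)%N -> (NN i < NN j)%N.
Proof.
move=> ij; apply: leq_trans (NN_lt_MM i) _; apply: leq_trans (MM_mono ij) _.
exact: ltnW (MM_lt_NN _).
Qed.

Fixpoint blk p := if p is p'.+1 then
  (if (MM (blk p').+1 <= p)%N then (blk p').+1 else blk p') else 0%N.

Lemma blkP p : (MM (blk p) <= p < MM (blk p).+1)%N.
Proof.
elim: p => [|p /andP[h1 h2]]; first by rewrite [blk 0]/= (leq_ltn_trans _ (MM_lt 0)).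
rewrite [blk _]/=; case: ifPn => h; last by rewrite ltnNge h (leqW h1).
by rewrite h (leq_ltn_trans h2 (MM_lt _)).
Qed.

Lemma blk_eq p i : (MM i <= p < MM i.+1)%N -> blk p = i.
Proof.
move=> /andP[h1 h2]; have /andP[k1 k2] := blkP p.
apply/eqP; rewrite eqn_leq; apply/andP; split; rewrite leqNgt; apply/negP => /MM_mono.
  by move=> h; have := leq_ltn_trans (leq_trans h k1) h2; rewrite ltnn.
by move=> h; have := leq_ltn_trans (leq_trans h h1) k2; rewrite ltnn.
Qed.

Definition act i (q : int) : bool :=
  let z := (q %% (2 ^ ww i)%N%:Z)%Z in
  ((2 ^ (ww i).-1)%N%:Z <= z) && (z < (2 ^ (ww i).-1 + kk i)%N%:Z).

Lemma kk_small i : (kk i <= 2 ^ (ww i - 2))%N.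
Proof.
have h : (kk i < 2 ^ kk i)%N by rewrite ltn_expl.
apply: leq_trans (ltnW h) _; rewrite leq_exp2l // /ww; lia.
Qed.

(** A cluster starts in the middle of its period and occupies at most a quarter of it, so the
    quarter period on either side of its start shows this one cluster and otherwise plain line. *)
Lemma act_window i (h z : int) :
  - (2 ^ (ww i - 2))%N%:Z <= z -> z <= (2 ^ (ww i - 2))%N%:Z ->
  act i ((2 ^ ww i)%N%:Z * h + (2 ^ (ww i).-1)%N%:Z + z) = (0 <= z) && (z < (kk i)%:Z).
Proof.
have ks := kk_small i.
have e2 : (2 ^ (ww i).-1 = 2 * 2 ^ (ww i - 2))%N by rewrite -expnS /ww; congr expn; lia.
have e4 : (2 ^ ww i = 4 * 2 ^ (ww i - 2))%N.
  by rewrite (_ : 4 = 2 ^ 2)%N // -expnD /ww; congr expn; lia.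
have p0 : (0 < 2 ^ (ww i - 2))%N by rewrite expn_gt0.
rewrite /act; move: (2 ^ (ww i - 2))%N (2 ^ (ww i).-1)%N (2 ^ ww i)%N e2 e4 p0 ks => a b c -> -> a0 ka z1 z2.
rewrite -addrA mulrC modzMDl modz_small; last by lia.
by apply/idP/idP => /andP[h1 h2]; apply/andP; split; lia.
Qed.

End Blocks.
Arguments MM : simpl never.

Section Curve.
Variables (R : realType) (s : R) (d e : nat).
Let lam : R := 2 `^ s^-1.
Let mu : R := 2 / lam.
Let be := lam ^+ d.
Let ga := mu ^+ d.
(** The bound 512 keeps the losses 2/[be] and 3/([ga] - 1) below half of a wave difference 1/32. The
    hypothesis [he] on [e] lets a gap of [e] levels at rate [ga] pay for one level at rate [be],
    with all constants. *)
Hypotheses (s1 : 1 < s) (d4 : (4 <= d)%N) (e1 : (0 < e)%N) (be512 : 512 <= be) (ga512 : 512 <= ga).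
Hypothesis he : 2 ^+ d.+2 * ga * be <= ga ^+ e.
Notation MM := (MM e).
Notation NN := (NN e).
Notation blk := (blk e).

Lemma pow2R_gt1 (x : R) : 0 < x -> 1 < 2 `^ x.
Proof.
move=> x0; have := @gt0_ltr_powR R x x0 1 2; rewrite powR1.
by apply; rewrite ?nnegrE // ltr1n.
Qed.

Lemma lam_gt1 : 1 < lam.
Proof. by apply: pow2R_gt1; rewrite invr_gt0; have := s1; move=> ?; lra. Qed.

Lemma lam_gt0 : 0 < lam. Proof. exact: lt_trans lam_gt1. Qed.

Lemma mu_gt1 : 1 < mu.
Proof.
have h : 0 < 1 - s^-1 by rewrite subr_gt0 invf_lt1; have := s1; move=> ?; lra.
have e2 : lam * 2 `^ (1 - s^-1) = 2.
  have e1' : s^-1 + (1 - s^-1) = 1 by ring.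
  have := @powRD R 2 s^-1 (1 - s^-1); rewrite e1' powRr1 // => <- //.
  by rewrite pnatr_eq0 implybT.
rewrite /mu ltr_pdivlMr ?lam_gt0 // -[X in _ < X]e2 mulrC ltr_pM2l ?lam_gt0 //.
exact: pow2R_gt1.
Qed.

Lemma lam_mu : lam * mu = 2.
Proof. by rewrite /mu mulrC divfK // gt_eqF // lam_gt0. Qed.

Lemma be_ga p : (be * ga) ^+ p = 2 ^+ (d * p).
Proof. by rewrite /be /ga -exprMn lam_mu exprM. Qed.

Definition nn i := (d * NN i)%N.
Definition mm i := (d * MM i)%N.
Definition xx i (t : R) := pathX (act i) (2 ^+ nn i * t) / 2 ^+ nn i.
Definition yy i (t : R) := pathY (act i) (2 ^+ nn i * t).
(* The two coordinates of the distance along the line with loops of block [i]. *)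
Definition xi i (t u : R) := `|xx i t - xx i u|.
Definition ups i (t u : R) := dz (yy i t - yy i u) / 2 ^+ nn i.

(* [cc < 2]: position along the line; [cc >= 2]: position around the loops. The isolated wave at [p = MM i]
   separates the times at distance about [2 ^- nn i.-1] that the loops of the previous block identify. *)
Definition term (cc r p : nat) (t : R) : R :=
  let i := blk p in
  if (cc < 2)%N then wave (odd cc) (2 ^+ (r + d * p) * xx i t)
  else if (NN i <= p)%N then wave (odd cc) (2 ^+ (r + d * (p - NN i)) * yy i t)
  else if (p == MM i) && (0 < i)%N then wave (odd cc) (2 ^+ (nn i.-1 - 2) * t)
  else 0.

(** The factor [lam ^- r] completes the amplitude of the term [p] to lam^-(r + d p), so the level l
    = r + d p is found in the coordinates of index [r = l %% d]. *)
Definition coord (cc r : nat) (t : R) := lam ^- r * lsum be (fun p => term cc r p t).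

Lemma pow2_gt0 n : 0 < 2 ^+ n :> R. Proof. by rewrite exprn_gt0. Qed.

(** * Distances on the line with loops against distance in time *)

Lemma xi_le i t u : xi i t u <= 2 * `|t - u|.
Proof.
rewrite /xi; wlog ut : t u / u <= t.
  by move=> H; have [/H//|/ltW/H] := leP u t; rewrite distrC (distrC u).
have p := pow2_gt0 (nn i).
have h : 2 ^+ nn i * u <= 2 ^+ nn i * t by rewrite ler_pM2l.
have := pathX_lip (act i) h; rewrite /xx -mulrBl => /andP[h1 h2].
rewrite normrM normfV (gtr0_norm p) ler_pdivrMr // ger0_norm // (ger0_norm (x := t - u)) ?subr_ge0 //.
by rewrite (le_trans h2) // -mulrBr; lra.
Qed.

(** The path lags behind the time by at most half a cell, and a cell has length [2 ^- nn i]. *)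
Lemma xi_ge i t u : `|t - u| - 2 ^- nn i / 2 <= xi i t u.
Proof.
have p := pow2_gt0 (nn i).
have := pathX_near (act i) (2 ^+ nn i * t); have := pathX_near (act i) (2 ^+ nn i * u).
rewrite /xi /xx -mulrBl normrM normfV (gtr0_norm p) ler_pdivlMr // mulrBl.
have -> : 2 ^- nn i / 2 * 2 ^+ nn i = 1 / 2 :> R by field; rewrite gt_eqF.
have -> : `|t - u| * 2 ^+ nn i = `|2 ^+ nn i * t - 2 ^+ nn i * u|.
  by rewrite -mulrBr normrM (gtr0_norm p) mulrC.
move: (2 ^+ nn i * t) (2 ^+ nn i * u) => a b /andP[h1 h2] /andP[h3 h4].
have [k|k] := ger0P (a - b); have [k'|k'] := ger0P (pathX (act i) a - pathX (act i) b); lra.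
Qed.

Lemma ups_le i t u : ups i t u <= 2 * `|t - u|.
Proof.
have p := pow2_gt0 (nn i); rewrite /ups ler_pdivrMr // (le_trans (pathY_lip _ _ _)) //.
by rewrite -mulrBr normrM (gtr0_norm p); lra.
Qed.

Lemma ups_ge0 i t u : 0 <= ups i t u.
Proof. by rewrite divr_ge0 ?dz_ge0 // ltW // pow2_gt0. Qed.

Lemma ups_half i t u : ups i t u <= 2 ^- nn i / 2.
Proof. by rewrite /ups mulrC ler_pM2l ?invr_gt0 ?pow2_gt0 // -[2^-1]mul1r dz_le_half. Qed.

Lemma rho_local i t u : `|t - u| <= 2 ^- nn i / 4 ->
  `|t - u| / 2 <= Num.max (xi i t u) (ups i t u).
Proof.
have p := pow2_gt0 (nn i); move=> h.
have := @path_local R (act i) (2 ^+ nn i * t) (2 ^+ nn i * u).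
rewrite -mulrBr normrM (gtr0_norm p) => /(_ _).
have -> : (2 ^+ nn i * `|t - u| <= 1 / 4).
  have -> : 1 / 4 = 2 ^+ nn i * (2 ^- nn i / 4) :> R by field; rewrite gt_eqF.
  by rewrite ler_pM2l.
move=> /(_ isT); rewrite !le_max => /orP[k|k]; apply/orP; [left|right].
  rewrite /xi /xx -mulrBl normrM normfV (gtr0_norm p) ler_pdivlMr //; lra.
rewrite /ups ler_pdivlMr //; move: k; rewrite /yy; lra.
Qed.

Lemma term_abs cc r p t : `|term cc r p t| <= 1 / 2.
Proof. by rewrite /term /=; do !case: ifP => _; rewrite ?wave_abs // normr0; lra. Qed.

Lemma termB_abs cc r p t u : `|term cc r p t - term cc r p u| <= 1.
Proof.
rewrite (le_trans (ler_normB _ _)) //.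
by have := term_abs cc r p t; have := term_abs cc r p u; move=> *; lra.
Qed.

Lemma wave_mulB c n (a b : R) : `|wave c (2 ^+ n * a) - wave c (2 ^+ n * b)| <= 2 ^+ n * dz (a - b).
Proof. by rewrite (le_trans (wave_lip _ _ _)) // -mulrBr dz_pow2M. Qed.

Lemma term_xi cc r p t u : (cc < 2)%N ->
  `|term cc r p t - term cc r p u| <= 2 ^+ (d * p) * (2 ^+ r * xi (blk p) t u).
Proof.
move=> h; rewrite /term /= h mulrA -exprD addnC (le_trans (wave_mulB _ _ _ _)) //.
by rewrite ler_pM2l ?pow2_gt0 // dz_le_abs.
Qed.

(** The first level of the block is set apart because the isolated wave there depends on the time
    itself and not on the loop coordinate. *)
Lemma term_ups cc r p t u : (2 <= cc)%N -> (MM (blk p) < p)%N ->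
  `|term cc r p t - term cc r p u| <= 2 ^+ (d * p) * (2 ^+ r * ups (blk p) t u).
Proof.
move=> h hp; rewrite /term /= ltnNge h /= (gtn_eqF hp) /=.
case: ifP => hn; last by rewrite subrr normr0 mulr_ge0 ?exprn_ge0 // mulr_ge0 ?exprn_ge0 // ups_ge0.
rewrite (le_trans (wave_mulB _ _ _ _)) // /ups !mulrA -exprD mulrAC ler_wpM2r ?dz_ge0 //.
rewrite ler_pdivlMr ?pow2_gt0 // -exprD /nn -addnA -mulnDr subnK // addnC //.
Qed.

Lemma term_lip cc r p t u :
  `|term cc r p t - term cc r p u| <= 2 ^+ (d * p) * (2 ^+ r * (2 * `|t - u|)).
Proof.
have pw n := pow2_gt0 n.
have [h|h] := ltnP cc 2.
  by rewrite (le_trans (term_xi _ _ _ _ h)) // !ler_pM2l // xi_le.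
have /andP[m1 _] := blkP e1 p.
have [hp|hp] := ltnP (MM (blk p)) p.
  by rewrite (le_trans (term_ups _ _ _ h hp)) // !ler_pM2l // ups_le.
have pE : p = MM (blk p) by apply/eqP; rewrite eqn_leq hp m1.
rewrite /term /= ltnNge h /= leqNgt (leq_ltn_trans hp (MM_lt_NN e1 _)) /= -pE eqxx /=.
case: ifP => hi; last by rewrite subrr normr0 !mulr_ge0 // ?ltW.
(* The isolated wave is slow: [NN i.-1] is smaller than [MM i], so its frequency is below
   [2 ^+ (d * p)]. *)
rewrite (le_trans (wave_mulB _ _ _ _)) //.
apply: le_trans (_ : 2 ^+ (d * p) * `|t - u| <= _).
  rewrite ler_pM ?dz_ge0 ?dz_le_abs ?exprn_ge0 // ler_eXn2l ?ltr1n //.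
  rewrite (leq_trans (leq_subr _ _)) // /nn leq_mul2l pE; apply/orP; right.
  by apply: leq_trans (ltnW (NN_lt_MM e1 _)) _; rewrite prednK // -pE.
rewrite ler_pM2l // mulrA ler_peMl //.
have : 1 <= 2 ^+ r :> R by rewrite exprn_ege1 // ler1n.
lra.
Qed.

Lemma be_gt1 : 1 < be. Proof. by have := be512; move=> ?; lra. Qed.
Lemma be2 : 2 <= be. Proof. by have := be512; move=> ?; lra. Qed.
Lemma ga2 : 2 <= ga. Proof. by have := ga512; move=> ?; lra. Qed.
Lemma gaX n : 0 < ga ^+ n.
Proof. by apply: exprn_gt0; have := ga2; move=> ?; lra. Qed.
Lemma beX n : 0 < be ^+ n.
Proof. by apply: exprn_gt0; have := be2; move=> ?; lra. Qed.

Lemma coordB cc r t u : coord cc r t - coord cc r u =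
  lam ^- r * lsum be (fun p => term cc r p t - term cc r p u).
Proof.
rewrite /coord -mulrBr lsumB ?be2 // => p; exact: term_abs.
Qed.

Lemma coord_upper cc r t u P :
  `|coord cc r t - coord cc r u| <=
  2 ^+ r * (2 * `|t - u|) * ga ^+ P + 2 * be ^- P.
Proof.
have l0 := lam_gt0; have l1 := lam_gt1.
rewrite coordB normrM gtr0_norm ?invr_gt0 ?exprn_gt0 //.
apply: le_trans (_ : `|lsum be (fun p => term cc r p t - term cc r p u)| <= _).
  rewrite ler_piMl // invf_le1 ?exprn_gt0 // exprn_ege1 //; exact: ltW.
apply: (lsum_upper be2 ga2) => [p||p _]; first exact: termB_abs.
  by rewrite !mulr_ge0 ?exprn_ge0.
by rewrite be_ga term_lip.
Qed.

(** Beyond its first level, block [i] sees only the distances on its own line with loops. The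
    earlier blocks and the isolated wave are controlled by the distance in time, which loops do not
    shorten. *)
Lemma low_terms i cc r p t u (z : R) : (p < MM i.+1)%N ->
  ((cc < 2)%N -> xi i t u <= z) -> ((2 <= cc)%N -> ups i t u <= z) ->
  `|term cc r p t - term cc r p u| <=
  (be * ga) ^+ p * (2 ^+ r * z + (if (p <= MM i)%N then 2 ^+ r * (2 * `|t - u|) else 0)).
Proof.
move=> pi h1 h2; rewrite be_ga; have pw n := pow2_gt0 n.
have z0 : 0 <= z.
  have [c|c] := ltnP cc 2; first by apply: le_trans (h1 c); rewrite normr_ge0.
  by apply: le_trans (h2 c); rewrite ups_ge0.
case: ifPn => hp.
  by rewrite (le_trans (term_lip _ _ _ _ _)) // ler_pM2l // lerDr mulr_ge0 // ltW.
rewrite -ltnNge in hp.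
have b : blk p = i by apply: blk_eq; rewrite ?(ltnW hp).
rewrite addr0; have [c|c] := ltnP cc 2.
  by rewrite (le_trans (term_xi _ _ _ _ c)) // b !ler_pM2l // h1.
have := @term_ups cc r p t u c; rewrite b => /(_ hp) k.
by apply: le_trans k _; rewrite !ler_pM2l // h2.
Qed.

(** Here the gap [AA] does its work: what the levels up to [MM i] contribute at time distance
    [2 ^- nn i] stays below the amplitude reached at the end of the block. *)
Lemma scale_gap i : 2 ^+ d.+2 * 2 ^- nn i * ga ^+ (MM i).+1 <= be ^- MM i.+1.
Proof.
have be1 := be_gt1; have g2 := ga2; have b0 : 0 < be by lra.
have g0 : 0 < ga by lra.
have B1 : (0 < BB i)%N by rewrite /BB addSn.
have key : 2 ^+ d.+2 * ga * be ^+ BB i <= ga ^+ AA e i.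
  apply: le_trans (_ : (2 ^+ d.+2 * ga * be) ^+ BB i <= _); last first.
    have p1 : 0 <= 2 ^+ d.+2 * ga * be.
      by rewrite mulr_ge0 ?(ltW b0) // mulr_ge0 ?(ltW g0) // exprn_ge0.
    have p2 : 0 <= ga ^+ e by rewrite exprn_ge0 // ltW.
    by rewrite /AA exprM; apply: lerXn2r.
  rewrite [leRHS]exprMn ler_pM2r; last by rewrite exprn_gt0.
  have g1 : 1 <= ga by lra.
  have x1 : 1 <= 2 ^+ d.+2 * ga by rewrite mulr_ege1 // exprn_ege1 // ler1n.
  by rewrite -[leLHS]expr1 ler_weXn2l.
by rewrite /nn -be_ga MMS; apply: scale_alg.
Qed.

(** * Separation of images at a dyadic level *)

Lemma ga_inv : 0 < (ga - 1)^-1 <= 511^-1.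
Proof.
have g1 : 511 <= ga - 1 by have := ga512; move=> ?; lra.
have p : 0 < 511 :> R by rewrite ltr0n.
have g0 : 0 < ga - 1 by exact: lt_le_trans g1.
by rewrite invr_gt0 g0 lef_pV2 ?posrE.
Qed.

Lemma be_inv : be^-1 <= 512^-1.
Proof.
have p : 0 < 512 :> R by rewrite ltr0n.
have b0 : 0 < be by exact: lt_le_trans be512.
by rewrite lef_pV2 ?posrE.
Qed.

(** From the wave difference 1/32 at [P0] the later levels take at most 2/[be], and the earlier ones
    at most 2/([ga] - 1) through [E2] and 1/([ga] - 1) through [E1]; 1/64 remains. *)
Lemma sep_from cc r P0 M t u (E1 E2 : R) : 0 <= E1 -> 0 <= E2 ->
  1 / 32 <= `|term cc r P0 t - term cc r P0 u| ->
  (forall p, (p < P0)%N -> `|term cc r p t - term cc r p u| <=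
     (be * ga) ^+ p * (E2 + (if (p <= M)%N then E1 else 0))) ->
  2 ^+ (d * P0) * E2 <= 2 -> E1 * ga ^+ M.+1 <= be ^- P0 ->
  lam ^- (r + d * P0) / 64 <= `|coord cc r t - coord cc r u|.
Proof.
move=> E10 E20 hP hp h2 h1; have l0 := lam_gt0.
rewrite coordB normrM gtr0_norm ?invr_gt0 ?exprn_gt0 //.
rewrite exprD invfM exprM -/be -mulrA ler_pM2l ?invr_gt0 ?exprn_gt0 //.
have := lsum_lower be2 ga2 (fun p => termB_abs cc r p t u) E10 E20 hp.
set L := `|lsum _ _|; move=> h; apply: le_trans h.
have bp : 0 < be ^- P0 by rewrite invr_gt0 exprn_gt0 //; have := be2; move=> ?; lra.
have /andP[gi0 gi] := ga_inv; have bi := be_inv.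
have k1 : E1 * ga ^+ M.+1 / (ga - 1) <= be ^- P0 * 511^-1.
  have g0 : 0 <= ga by have := ga2; move=> ?; lra.
  have p1 : 0 <= E1 * ga ^+ M.+1 by rewrite mulr_ge0 // exprn_ge0.
  exact: ler_pM p1 (ltW gi0) h1 gi.
apply: le_trans (lerB (lexx _) k1); rewrite -mulrBr ler_pM2l //.
have k2 : (be * ga) ^+ P0 * E2 / (ga - 1) <= 2 * 511^-1.
  by rewrite be_ga ler_pM ?mulr_ge0 ?exprn_ge0 ?(ltW gi0).
move: hP k2; set a := `|_|; set b := _ * E2 / _ => *; lra.
Qed.

Lemma loop_index (c : bool) :
  (2 + c < 2)%N = false /\ odd (2 + c) = c /\ (2 + c < 4)%N.
Proof. by case: c. Qed.

Lemma line_index (c : bool) : (c < 2)%N /\ (c < 4)%N.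
Proof. by case: c. Qed.

(** Division of [l] by [d] selects the coordinate index and the term, the larger of the two
    distances selects line or loop waves, and [wave_sep] one of the two waves. The last hypothesis
    reflects that loop waves start only at level [nn i]. *)
Lemma sep_rho i t u l (rho := Num.max (xi i t u) (ups i t u) : R) :
  (mm i <= l < mm i.+1)%N -> 1 / 16 <= 2 ^+ l * rho -> 2 ^+ l * rho <= 1 / 2 ->
  (xi i t u < ups i t u -> (nn i <= l)%N) ->
  exists cc r, [/\ (cc < 4)%N, (r < d)%N &
    lam ^- l / 64 <= `|coord cc r t - coord cc r u|].
Proof.
move=> /andP[l1 l2] h1 h2 hl; have pw n := pow2_gt0 n; have d0 : (0 < d)%N by apply: leq_trans d4.
pose r := (l %% d)%N; pose P0 := (l %/ d)%N.
have lE : (r + d * P0)%N = l by rewrite addnC mulnC -divn_eq.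
have rd : (r < d)%N by rewrite ltn_mod.
have P1 : (MM i <= P0)%N by rewrite leq_divRL // mulnC.
have P2 : (P0 < MM i.+1)%N by rewrite ltn_divLR // mulnC.
have bP : blk P0 = i by apply: blk_eq; rewrite ?P1.
have rho0 : 0 <= rho by rewrite le_max normr_ge0.
have [cc [c4 hcc hsep]] : exists cc, [/\ (cc < 4)%N, (if (cc < 2)%N then xi i t u else ups i t u) = rho &
    1 / 32 <= `|term cc r P0 t - term cc r P0 u|].
  have [xu|ux] := ltP (xi i t u) (ups i t u).
    have rE : rho = ups i t u by rewrite /rho max_r // ltW.
    have Pn : (NN i <= P0)%N by rewrite leq_divRL // mulnC hl.
    have [c hc] := wave_sep (2 ^+ (r + d * (P0 - NN i)) * yy i t) (2 ^+ (r + d * (P0 - NN i)) * yy i u).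
    pose cc := (2 + c)%N; have [c1 [c2 c3]] := loop_index c; rewrite -/cc in c1 c2 c3; clearbody cc.
    exists cc; rewrite c1 rE; split=> //.
    rewrite /term /= bP c1 c2 /= Pn.
    have e2 : 2 ^+ (r + d * (P0 - NN i)) = 2 ^+ l / 2 ^+ nn i :> R.
      by apply/(canRL (mulfK _)); rewrite ?gt_eqF // -exprD -lE /nn -addnA -mulnDr subnK.
    move: hc; rewrite -mulrBr; set y := yy i t - yy i u.
    suff -> : dz (2 ^+ (r + d * (P0 - NN i)) * y) = 2 ^+ l * rho by move=> ?; lra.
    have [z yz zh] := dz_ex y.
    have -> : 2 ^+ (r + d * (P0 - NN i)) * y = (2 ^+ (r + d * (P0 - NN i)) * z)%:~R + 2 ^+ (r + d * (P0 - NN i)) * (y - z%:~R).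
      by rewrite intr_pow2M -mulrDr [z%:~R + _]addrC subrK.
    rewrite dz_shift; have k : `|2 ^+ (r + d * (P0 - NN i)) * (y - z%:~R)| = 2 ^+ l * rho.
      by rewrite normrM -yz gtr0_norm // e2 rE /ups -/y mulrAC mulrA.
    by rewrite dz_small k.
  have rE : rho = xi i t u by rewrite /rho max_l.
  have [c hc] := wave_sep (2 ^+ l * xx i t) (2 ^+ l * xx i u).
  have [c1 c3] := line_index c.
  exists (nat_of_bool c); rewrite c1 rE; split=> //.
  rewrite /term /= bP lE c1 oddb; move: hc; rewrite -mulrBr.
  have k : `|2 ^+ l * (xx i t - xx i u)| = 2 ^+ l * rho by rewrite normrM gtr0_norm // rE.
  by rewrite dz_small k // => ?; lra.
exists cc, r; split=> //; rewrite -lE.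
have hx : (cc < 2)%N -> xi i t u <= rho by rewrite /rho le_max lexx.
have hy : (2 <= cc)%N -> ups i t u <= rho by rewrite /rho le_max lexx orbT.
have lP z : 2 ^+ (d * P0) * (2 ^+ r * z) = 2 ^+ l * z by rewrite mulrA -exprD addnC lE.
(* Within two cells [rho] may be far smaller than the time distance, and the gap before the loops is
   needed. Farther apart [xi] is comparable with the time distance, so [rho] controls every
   level. *)
have [dl|dl] := leP `|t - u| (2 * 2 ^- nn i).
  apply: (@sep_from cc r P0 (MM i) t u (2 ^+ r * (2 * `|t - u|)) (2 ^+ r * rho) _ _ hsep).
  - by rewrite !mulr_ge0 ?exprn_ge0.
  - by rewrite !mulr_ge0 ?exprn_ge0.
  - by move=> p pP; apply: low_terms => //; exact: ltn_trans P2.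
  - by rewrite lP; lra.
  apply: le_trans (_ : be ^- MM i.+1 <= _); last first.
    have := be_gt1 => b1; have b0 : 0 < be by lra.
    have pb n : 0 < be ^+ n by exact: exprn_gt0.
    by rewrite lef_pV2 ?posrE ?pb // ler_weXn2l ?(ltnW P2) // ltW.
  apply: le_trans (scale_gap i); rewrite ler_pM2r ?gaX //.
  apply: le_trans (_ : 2 ^+ d * (2 * (2 * 2 ^- nn i)) <= _); last by rewrite !exprS; lra.
  by rewrite ler_pM ?mulr_ge0 ?exprn_ge0 // ?ler_pM2l // ler_weXn2l ?ler1n // ltnW.
have dr : `|t - u| <= 2 * rho.
  have := xi_ge i t u; have : xi i t u <= rho by rewrite /rho le_max lexx.
  move: dl; set a := 2 ^- nn i; set b := xi i t u => *; lra.
apply: (@sep_from cc r P0 (MM i) t u 0 (2 ^+ r * (4 * rho)) _ _ hsep) => //.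
- by rewrite !mulr_ge0 ?exprn_ge0.
- move=> p pP; rewrite be_ga (le_trans (term_lip _ _ _ _ _)) // ler_pM2l // if_same addr0 ler_pM2l //.
  lra.
- by rewrite lP; lra.
- by rewrite mul0r invr_ge0 exprn_ge0 //; have := be2; move=> ?; lra.
Qed.

(** Times that the loops keep together until the end of the block are told apart by the isolated
    wave that follows. Its frequency [2 ^+ (nn i - 2)] brings their difference between 1/16 and 1/2,
    where [dz] is exact. *)
Lemma sep_end i t u : xi i t u <= 2 ^- mm i.+1 / 8 -> ups i t u <= 2 ^- mm i.+1 / 8 ->
  2 ^- nn i / 4 <= `|t - u| -> `|t - u| <= 2 * 2 ^- nn i ->
  exists cc r, [/\ (cc < 4)%N, (r < d)%N &
    lam ^- (mm i.+1) / 64 <= `|coord cc r t - coord cc r u|].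
Proof.
move=> hx hy d1 d2; have pw n := pow2_gt0 n.
have n2 : (2 <= nn i)%N.
  have N0 : (0 < NN i)%N by apply: leq_ltn_trans (MM_lt_NN e1 i).
  by have := leq_mul d4 N0; rewrite muln1; apply: leq_trans.
have e4 : 2 ^+ (nn i - 2) = 2 ^+ nn i / 4 :> R.
  apply/(canRL (mulfK _)); first by rewrite pnatr_eq0.
  by rewrite (_ : 4 = 2 ^+ 2); [rewrite -exprD subnK | rewrite expr2 -natrM].
have [c hc] := wave_sep (2 ^+ (nn i - 2) * t) (2 ^+ (nn i - 2) * u).
pose cc := (2 + c)%N; have [c1 [c2 c3]] := loop_index c; rewrite -/cc in c1 c2 c3; clearbody cc.
exists cc, 0%N; split=> //; first by apply: leq_trans d4.
have bP : blk (MM i.+1) = i.+1 by apply: (blk_eq e1); rewrite leqnn MM_lt.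
have k1 : `|2 ^+ (nn i - 2) * (t - u)| = 2 ^+ nn i * `|t - u| / 4.
  by rewrite normrM gtr0_norm // e4 mulrAC.
have k2 : 1 / 4 <= 2 ^+ nn i * `|t - u|.
  by move: d1; rewrite -(ler_pM2l (pw (nn i))) mulrA mulfV ?gt_eqF.
have k3 : 2 ^+ nn i * `|t - u| <= 2.
  by move: d2; rewrite -(ler_pM2l (pw (nn i))) mulrCA mulfV ?gt_eqF // mulr1.
have -> : mm i.+1 = (0 + d * MM i.+1)%N by [].
apply: (@sep_from cc 0 (MM i.+1) (MM i) t u (2 ^+ 0 * (2 * `|t - u|)) (2 ^+ 0 * (2 ^- mm i.+1 / 8))).
- by rewrite !mulr_ge0 ?exprn_ge0.
- by rewrite !mulr_ge0 ?exprn_ge0 ?invr_ge0 ?exprn_ge0.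
- rewrite /term /= bP c1 c2 /= leqNgt (MM_lt_NN e1) /= eqxx /=.
  by move: hc; rewrite -mulrBr dz_small k1; lra.
- by move=> p pP; apply: low_terms.
- by rewrite expr0 mul1r mulrA mulfV ?gt_eqF //; lra.
apply: le_trans (scale_gap i); rewrite ler_pM2r ?gaX //.
rewrite expr0 mul1r; apply: le_trans (_ : 2 ^+ 2 * 2 ^- nn i <= _).
  by rewrite expr2; lra.
by rewrite ler_pM2r ?invr_gt0 // ler_weXn2l ?ler1n.
Qed.

(** If the dyadic level of [rho] falls just beyond the block, the last level of the block serves
    instead; the constant 1/16 in [sep_rho] leaves room for this. *)
Lemma sep_level i t u (rho := Num.max (xi i t u) (ups i t u) : R) :
  2 ^- mm i.+1 / 8 <= rho -> rho <= 2 ^- mm i / 2 ->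
  exists l cc r, [/\ (l < mm i.+1)%N, 2 ^+ l * rho <= 1 / 2, (cc < 4)%N, (r < d)%N &
    lam ^- l / 64 <= `|coord cc r t - coord cc r u|].
Proof.
move=> h1 h2; have pw n := pow2_gt0 n.
have r0 : 0 < rho by apply: lt_le_trans h1; rewrite divr_gt0 ?invr_gt0.
have i1 : 2 ^- mm i <= 1 :> R by rewrite invf_le1 // exprn_ege1 // ler1n.
have r2 : rho <= 1 / 2 by lra.
have mn : (nn i < mm i.+1)%N by rewrite ltn_pmul2l ?NN_lt_MM // (leq_trans _ d4).
have mm1 : (mm i < mm i.+1)%N by rewrite ltn_pmul2l ?MM_lt // (leq_trans _ d4).
have [l [l1 l2]] := dyadic_level r0 r2.
have hl : xi i t u < ups i t u -> (nn i <= l)%N.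
  move=> xu; apply: level_ge l1; have := ups_half i t u.
  by rewrite /rho max_r // ltW.
have ml : (mm i <= l)%N by apply: level_ge l1.
have [lm|lm] := ltnP l (mm i.+1).
  have [|||cc [r [c4 rd hs]]] := @sep_rho i t u l _ _ _ hl; rewrite ?ml //; first by rewrite -/rho; lra.
  by exists l, cc, r.
have lE : (mm i.+1).-1.+1 = mm i.+1 by rewrite prednK // (leq_trans _ mm1).
have h4 : 2 ^+ (mm i.+1).-1 * rho <= 1 / 2.
  apply: le_trans l2; rewrite ler_pM2r // ler_weXn2l ?ler1n //.
  by rewrite (leq_trans _ lm) // leq_pred.
have h3 : 1 / 16 <= 2 ^+ (mm i.+1).-1 * rho.
  move: h1; rewrite -(ler_pM2l (pw (mm i.+1))) mulrA mulfV ?gt_eqF // -lE exprS; lra.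
have [||cc [r [c4 rd hs]]] := @sep_rho i t u (mm i.+1).-1 _ h3 h4.
- by rewrite -ltnS lE mm1 leqnn.
- by move=> _; rewrite -ltnS lE.
by exists (mm i.+1).-1, cc, r; rewrite {1}lE.
Qed.

Lemma lam_lt a b : lam ^- a / 64 < lam ^- b / 64 -> (b < a)%N.
Proof.
have l0 := lam_gt0; have l1 := lam_gt1.
rewrite ltr_pM2r ?invr_gt0 ?ltr0n // => h; rewrite ltnNge; apply/negP => ab.
by move: h; rewrite ltNge lef_pV2 ?posrE ?exprn_gt0 // ler_weXn2l // ltW.
Qed.

(** The block is that of the dyadic level of 2|t - u|, a bound for [rho]. Either [rho] is comparable
    with the time distance, or the times are within two cells and a loop brings them together; then
    the levels of the block, or at its end the isolated wave, limit [J]. *)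
Lemma coord_close J t u : `|t - u| <= 1 / 8 ->
  (forall cc r, (cc < 4)%N -> (r < d)%N -> `|coord cc r t - coord cc r u| < lam ^- J / 64) ->
  `|t - u| <= 2 ^- J \/ exists i, [/\ (nn i <= J)%N, (J < mm i.+1)%N,
    `|t - u| <= 2 * 2 ^- nn i, xi i t u <= 2 ^- J & ups i t u <= 2 ^- J].
Proof.
move=> d8 hc; have pw n := pow2_gt0 n; set dl := `|t - u| in d8 *.
have dl0 : 0 <= dl by rewrite normr_ge0.
have [->|dlN] := eqVneq dl 0; first by left; rewrite invr_ge0 exprn_ge0.
have dlp : 0 < 2 * dl by rewrite mulr_gt0 // lt_neqAle eq_sym dlN.
have [|j [j1 j2]] := dyadic_level dlp; first by lra.
have d0 : (0 < d)%N by apply: leq_trans d4.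
have /andP[b1 b2] := blkP e1 (j %/ d); set i := blk _ in b1 b2.
have m1 : (mm i <= j)%N by rewrite /mm mulnC -leq_divRL.
have m2 : (j < mm i.+1)%N by rewrite /mm mulnC -ltn_divLR.
pose rho : R := Num.max (xi i t u) (ups i t u).
have hxi := xi_le i t u; have hups := ups_le i t u.
have rx : xi i t u <= rho by rewrite le_max lexx.
have ry : ups i t u <= rho by rewrite le_max lexx orbT.
have r2 : rho <= 2 * dl by rewrite ge_max hxi.
have jj : 2 ^+ j * 2 ^- j = 1 :> R by rewrite mulfV ?gt_eqF.
have dj : 2 * dl <= 2 ^- j / 2 by rewrite -(ler_pM2l (pw j)) (mulrA _ (2 ^- j)) jj; lra.
have dj2 : 2 ^- j / 4 < 2 * dl by rewrite -(ltr_pM2l (pw j)) (mulrA _ (2 ^- j)) jj.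
have jm := pow2V_le R m1; have jm2 := pow2V_lt R m2.
have level l : lam ^- l / 64 <= lam ^- l / 64 -> (exists cc r, [/\ (cc < 4)%N, (r < d)%N &
    lam ^- l / 64 <= `|coord cc r t - coord cc r u|]) -> (J < l)%N.
  by move=> _ [cc [r [c4 rd h]]]; apply: lam_lt; apply: le_lt_trans h _; exact: hc.
have big : 2 ^- mm i.+1 / 8 <= rho -> (J < mm i.+1)%N /\ rho <= 2 ^- J / 4.
  move=> h; have [|l [cc [r [l1 l2 c4 rd hs]]]] := sep_level h; first by rewrite -/rho; lra.
  have Jl : (J < l)%N by apply: level => //; exists cc, r.
  split; first exact: ltn_trans l1.
  have := pow2V_lt R Jl; have : rho <= 2 ^- l / 2.
    by rewrite -(ler_pM2l (pw l)) mulrA mulfV ?gt_eqF.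
  by move=> *; lra.
have [dn|dn] := leP dl (2 * 2 ^- nn i); last first.
  have xg := xi_ge i t u; rewrite -/dl in xg.
  have [|_ h2] := big; first by lra.
  by left; lra.
have fin : (J < mm i.+1)%N -> rho <= 2 ^- J -> dl <= 2 ^- J \/ exists i, [/\ (nn i <= J)%N, (J < mm i.+1)%N,
    dl <= 2 * 2 ^- nn i, xi i t u <= 2 ^- J & ups i t u <= 2 ^- J].
  move=> Jm rJ; have [nJ|Jn] := leqP (nn i) J.
    by right; exists i; split=> //; [exact: le_trans rx rJ | exact: le_trans ry rJ].
  by left; apply: le_trans dn (pow2V_lt R Jn).
have J0 : 0 < 2 ^- J :> R by rewrite invr_gt0.
have [rb|rb] := leP (2 ^- mm i.+1 / 8) rho.
  by have [h1 h2] := big rb; apply: fin => //; lra.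
have [dn4|dn4] := leP dl (2 ^- nn i / 4).
  by have := rho_local dn4; rewrite -/rho -/dl; lra.
have ax : xi i t u <= 2 ^- mm i.+1 / 8 by lra.
have ay : ups i t u <= 2 ^- mm i.+1 / 8 by lra.
have [cc [r [c4 rd hs]]] := sep_end ax ay (ltW dn4) dn.
have Jm : (J < mm i.+1)%N by apply: level => //; exists cc, r.
by apply: fin => //; have := pow2V_lt R Jm; lra.
Qed.

Lemma lam_pow n : lam ^+ n = (2 ^+ n) `^ s^-1.
Proof.
elim: n => [|n IH]; first by rewrite !expr0 powR1.
by rewrite !exprS IH powRM // exprn_ge0.
Qed.

Lemma pow_le1 l (x : R) : 0 <= x -> 2 ^+ l * x <= 1 -> x `^ s^-1 <= lam ^- l.
Proof.
move=> x0 h; have l0 := lam_gt0; have si : 0 <= s^-1 by rewrite invr_ge0; have := s1; move=> ?; lra.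
rewrite -[leRHS]mul1r ler_pdivlMr ?exprn_gt0 // mulrC lam_pow -powRM ?exprn_ge0 //.
have := @ge0_ler_powR R s^-1 si (2 ^+ l * x) 1; rewrite powR1.
by apply=> //; rewrite ?nnegrE ?mulr_ge0 ?exprn_ge0.
Qed.

Lemma pow_ge1 l (x : R) : 0 <= x -> 1 <= 2 ^+ l * x -> lam ^- l <= x `^ s^-1.
Proof.
move=> x0 h; have l0 := lam_gt0; have si : 0 <= s^-1 by rewrite invr_ge0; have := s1; move=> ?; lra.
rewrite -[leLHS]mul1r ler_pdivrMr ?exprn_gt0 // mulrC lam_pow -powRM ?exprn_ge0 //.
have := @ge0_ler_powR R s^-1 si 1 (2 ^+ l * x); rewrite powR1.
by apply=> //; rewrite ?nnegrE ?mulr_ge0 ?exprn_ge0.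
Qed.

Lemma coord_lower i t u (rho := Num.max (xi i t u) (ups i t u) : R) :
  2 ^- mm i.+1 <= rho -> rho <= 2 ^- mm i / 2 ->
  exists cc r, [/\ (cc < 4)%N, (r < d)%N &
    rho `^ s^-1 / 64 <= `|coord cc r t - coord cc r u|].
Proof.
move=> h1 h2; have pw n := pow2_gt0 n.
have r0 : 0 < rho by apply: lt_le_trans h1; rewrite invr_gt0.
have i1 : 2 ^- mm i <= 1 :> R by rewrite invf_le1 // exprn_ege1 // ler1n.
have r2 : rho <= 1 / 2 by lra.
have [l [l1 l2]] := dyadic_level r0 r2.
have hl : xi i t u < ups i t u -> (nn i <= l)%N.
  move=> xu; apply: level_ge l1; have := ups_half i t u.
  by rewrite /rho max_r // ltW.
have ml : (mm i <= l)%N by apply: level_ge l1.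
have lm : (l < mm i.+1)%N by apply: level_lt l2.
have [|||cc [r [c4 rd hs]]] := @sep_rho i t u l _ _ _ hl; rewrite ?ml //; first by rewrite -/rho; lra.
exists cc, r; split=> //; apply: le_trans hs; rewrite ler_pM2r ?invr_gt0 ?ltr0n //.
by apply: pow_le1; lra.
Qed.

(** The sum is split at the [P] for which 2^(d P)|t - u| <= 1 <= 2^(d (P + 1))|t - u|. There the
    growing and the decaying part both have order [be ^- P], which is |t - u|^(1/s) up to a factor
    [be]. *)
Lemma coord_holder cc r t u : (r < d)%N -> `|t - u| <= 1 ->
  `|coord cc r t - coord cc r u| <= (2 ^+ d * 4 + 2) * be * `|t - u| `^ s^-1.
Proof.
move=> rd d1; have pw n := pow2_gt0 n.
have b0 : 0 < be by have := be2; move=> ?; lra.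
have [->|tu] := eqVneq t u.
  by rewrite subrr normr0 mulr_ge0 ?powR_ge0 // mulr_ge0 ?(ltW b0) // addr_ge0 // mulr_ge0 // exprn_ge0.
set dl := `|t - u| in d1 *.
have dlp : 0 < dl / 2 by rewrite divr_gt0 // normr_gt0 subr_eq0.
have [|j [j1 j2]] := dyadic_level dlp; first by lra.
have d0 : (0 < d)%N by apply: leq_trans d4.
pose P := (j %/ d)%N.
have u1 : 2 ^+ (d * P) * dl <= 1.
  apply: le_trans (_ : 2 ^+ j * dl <= _); last by lra.
  by rewrite ler_wpM2r ?normr_ge0 // ler_weXn2l ?ler1n // mulnC leq_divM.
have u2 : 1 <= 2 ^+ (d * P.+1) * dl.
  apply: le_trans (_ : 2 ^+ j.+1 * dl <= _); first by rewrite exprS; lra.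
  by rewrite ler_wpM2r ?normr_ge0 // ler_weXn2l ?ler1n // mulnC -ltn_divLR.
have hb : be ^- P.+1 <= dl `^ s^-1 by rewrite /be -exprM; apply: pow_ge1; rewrite ?normr_ge0.
apply: le_trans (coord_upper cc r t u P) _; rewrite -/dl.
have gb : dl * ga ^+ P <= be ^- P.
  rewrite -[leRHS]mul1r ler_pdivlMr; last exact: exprn_gt0.
  by rewrite -mulrA -exprMn mulrC [ga * be]mulrC be_ga.
have e1' : be ^- P = be * be ^- P.+1.
  by rewrite exprS invfM mulrA mulfV ?mul1r // gt_eqF.
apply: le_trans (_ : (2 ^+ d * 4 + 2) * be ^- P <= _); last first.
  rewrite e1' !mulrA ler_pM2l // mulr_gt0 // addr_gt0 // mulr_gt0 //.
rewrite [leRHS]mulrDl lerD2r.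
have -> : 2 ^+ r * (2 * dl) * ga ^+ P = 2 ^+ r * 2 * (dl * ga ^+ P) by ring.
have r2 : 2 ^+ r <= 2 ^+ d :> R by rewrite ler_weXn2l ?ler1n // ltnW.
have bp : 0 < be ^- P by rewrite invr_gt0 exprn_gt0.
have p0 : 0 <= dl * ga ^+ P.
  by rewrite mulr_ge0 ?normr_ge0 // exprn_ge0 //; have := ga2; move=> ?; lra.
apply: ler_pM => //.
by have := pw d; move=> ?; lra.
Qed.

Definition ghat (t : R) : 'rV[R]_(4 * d) := \row_(j < 4 * d) coord (j %/ d) (j %% d) t.

Lemma ghat_coord cc r t u : (cc < 4)%N -> (r < d)%N ->
  `|coord cc r t - coord cc r u| <= edist (ghat t) (ghat u).
Proof.
move=> c4 rd; have d0 : (0 < d)%N by apply: leq_trans d4.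
have lt : (cc * d + r < 4 * d)%N.
  by rewrite (leq_trans (_ : _ < cc.+1 * d)%N) ?leq_mul2r ?c4 ?orbT // mulSn addnC ltn_add2r.
have := edist_coord (ghat t) (ghat u) (Ordinal lt); rewrite !mxE /=.
by rewrite divnMDl // divn_small // addn0 modnMDl modn_small.
Qed.

Definition holder_const : R := (4 * d)%:R * ((2 ^+ d * 4 + 2) * be).

Lemma holder_const_ge0 : 0 <= holder_const.
Proof.
have b0 : 0 <= be by have := be2; move=> ?; lra.
by rewrite mulr_ge0 // mulr_ge0 // addr_ge0 // mulr_ge0 // exprn_ge0.
Qed.

Lemma ghat_holder t u : `|t - u| <= 1 ->
  edist (ghat t) (ghat u) <= holder_const * `|t - u| `^ s^-1.
Proof.
move=> h; have d0 : (0 < d)%N by apply: leq_trans d4.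
apply: le_trans (enorm_le_sum _) _.
apply: (@le_trans _ _ (\sum_(j < 4 * d) (2 ^+ d * 4 + 2) * be * `|t - u| `^ s^-1)).
  by apply: ler_sum => j _; rewrite !mxE coord_holder // ltn_mod.
by rewrite sumr_const card_ord -[_ *+ (4 * d)]mulr_natl mulrA.
Qed.

Lemma ghat_close J t u : `|t - u| <= 1 / 8 -> edist (ghat t) (ghat u) < lam ^- J / 64 ->
  `|t - u| <= 2 ^- J \/ exists i, [/\ (nn i <= J)%N, (J < mm i.+1)%N,
    `|t - u| <= 2 * 2 ^- nn i, xi i t u <= 2 ^- J & ups i t u <= 2 ^- J].
Proof.
move=> h1 h2; apply: coord_close => // cc r c4 rd.
by apply: le_lt_trans h2; apply: ghat_coord.
Qed.

Lemma ghat_lower i t u (rho := Num.max (xi i t u) (ups i t u) : R) :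
  2 ^- mm i.+1 <= rho -> rho <= 2 ^- mm i / 2 ->
  rho `^ s^-1 / 64 <= edist (ghat t) (ghat u).
Proof.
move=> h1 h2; have [cc [r [c4 rd h]]] := coord_lower h1 h2.
by apply: le_trans h _; apply: ghat_coord.
Qed.

(** * Recovering a time from its image up to boundedly many branches *)

Lemma small_int_code (z : int) : -2 < z -> z < 2 ->
  exists k : nat, [/\ (k < 5)%N, (1 < k)%N & k%:Z = 3 - z].
Proof. by move=> h1 h2; exists (absz (3 - z)%R); split; lia. Qed.

Lemma nearby_int_code (p q : int) : p - 2 <= q -> q < p + 3 ->
  exists2 z : nat, (z < 5)%N & p + z%:Z - 2 = q.
Proof. by move=> h1 h2; exists (absz (q - (p - 2))%R); lia. Qed.

Lemma code_lt z k : (z < 5)%N -> (k < 5)%N -> ((z * 5 + k).+1 < 26)%N.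
Proof. by move=> h1 h2; lia. Qed.

(** These are the inverse branches of the path in a cell starting at [q]: the plain line, the
    crossing half, and for [k] = 2, 3, 4 the loop half with the integer [k - 3] added to the loop
    coordinate. *)
Definition branch (k : nat) (q x y : R) : R :=
  match k with 0 => x | 1 => (x + q + 1) / 2 | _ => q + (y + (k%:R - 3)) / 2 end.

Lemma branchE k (q x y : R) : (1 < k)%N -> branch k q x y = q + (y + (k%:R - 3)) / 2.
Proof. by case: k => [|[|k]]. Qed.

Lemma path_inverse (S : int -> bool) (x y v eps : R) : 0 <= eps -> 0 <= y <= 1 ->
  `|x - pathX S v| <= eps -> dz (y - pathY S v) <= eps ->
  exists2 k, (k < 5)%N & `|v - branch k (Num.floor v)%:~R x y| <= eps.
Proof.
move=> e0 /andP[y0 y1] hx hy; have [q1 q2] := floor_bounds v.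
have /andP[z0 z1] := pathY_itv S v; move: hx hy z0 z1; rewrite /pathX /pathY /=.
set q : R := (Num.floor v)%:~R; case: ifP => _; last by exists 0%N => //=; rewrite distrC.
have [[h1 ->]|[h1 ->]] := max0P (2 * (v - q) - 1).
  move=> hx _ _ _; exists 1%N => //=.
  have -> : v - (x + q + 1) / 2 = - (x - (q + (2 * (v - q) - 1))) / 2 by lra.
  by rewrite normrM normrN normfV (gtr0_norm (ltr0n R 2)); lra.
have -> : Num.min 1 (2 * (v - q)) = 2 * (v - q) by rewrite min_r //; lra.
move=> _ + z0 z1; have [z -> hz] := dz_ex (y - 2 * (v - q)) => hy.
have /ler_normlP[a1 a2] := hz.
have b1 : -2 < z by rewrite -(ltr_int R); lra.
have b2 : z < 2 by rewrite -(ltr_int R); lra.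
have [k [k5 k2 kz]] := small_int_code b1 b2.
have ek : k%:R = 3 - z%:~R :> R by rewrite pmulrn kz intrB.
exists k => //.
rewrite (branchE _ _ _ k2).
rewrite ek; have -> : v - (q + (y + (3 - z%:~R - 3)) / 2) = - (y - 2 * (v - q) - z%:~R) / 2 by lra.
by rewrite normrM normrN normfV (gtr0_norm (ltr0n R 2)); lra.
Qed.

Definition center (i : nat) (t0 : R) (p : nat) : R :=
  let v0 := 2 ^+ nn i * t0 in
  if p is p'.+1 then
    branch (p' %% 5) (Num.floor v0 + (p' %/ 5)%N%:Z - 2)%:~R
      (pathX (act i) v0) (pathY (act i) v0) / 2 ^+ nn i
  else t0.

(* 26 = 1 + 5 * 5: [t0] itself, or one of five neighbouring cells with two branches along the line and
   three around the loop, one for each possible integer part of the loop coordinate. *)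
Lemma close_times J t0 : exists c : nat -> R, forall u, `|t0 - u| <= 1 / 8 ->
  edist (ghat t0) (ghat u) < lam ^- J / 64 -> exists2 p, (p < 26)%N & `|u - c p| <= 2 ^- J.
Proof.
have d0 : (0 < d)%N by apply: leq_trans d4.
exists (center (blk (J %/ d)) t0) => u h1 h2; have [h|] := ghat_close h1 h2.
  by exists 0%N; rewrite //= distrC.
move=> [i [j1 j2 h3 h4 h5]].
(* The block of a loop coincidence is determined by [J] alone, so one list of centers serves all
   [u]. *)
have E : blk (J %/ d) = i.
  apply: (blk_eq e1); rewrite leq_divRL // ltn_divLR // mulnC (leq_trans _ j1); last first.
    by rewrite leq_mul2l (ltnW (MM_lt_NN e1 i)) orbT.
  by rewrite mulnC.
rewrite E; have p := pow2_gt0 (nn i).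
set K : R := 2 ^+ nn i in h3 p *; pose v0 : R := K * t0; pose v : R := K * u.
have k1 : `|v0 - v| <= 2.
  by move: h3; rewrite -mulrBr normrM (gtr0_norm p) -(ler_pM2l p) mulrCA mulfV ?gt_eqF // mulr1.
have k2 : `|pathX (act i) v0 - pathX (act i) v| <= K * 2 ^- J.
  by move: h4; rewrite /xi /xx -mulrBl normrM normfV (gtr0_norm p) ler_pdivrMr // [leRHS]mulrC.
have k3 : dz (pathY (act i) v0 - pathY (act i) v) <= K * 2 ^- J.
  by move: h5; rewrite /ups ler_pdivrMr // [leRHS]mulrC.
have e0 : 0 <= K * 2 ^- J by rewrite mulr_ge0 ?invr_ge0 ?exprn_ge0.
have [k k5 hk] := path_inverse e0 (pathY_itv (act i) v0) k2 k3.
have [q1 q2] := floor_bounds v0; have /ler_normlP[a1 a2] := k1.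
have f1 : Num.floor v0 - 2 <= Num.floor v by rewrite floor_ge_int intrB; lra.
have f2 : Num.floor v < Num.floor v0 + 3 by rewrite floor_lt_int intrD; lra.
have [z z5 ez] := nearby_int_code f1 f2.
exists (z * 5 + k).+1.
  exact: code_lt.
rewrite /center divnMDl // modnMDl (divn_small k5) (modn_small k5) addn0.
rewrite -/K -/v0 ez -(ler_pM2l p) -{1}(gtr0_norm p) -normrM mulrBr -/v.
by rewrite mulrCA mulfV ?gt_eqF // mulr1.
Qed.

(** * Positive Hausdorff measure *)

Definition curve : set 'rV[R]_(4 * d) := ghat @` [set t | 0 <= t <= 1 / 8].

Lemma measure_intervals (c : nat -> R) (l : R) m : 0 <= l ->
  (lebesgue_measure (\big[setU/set0]_(p < m) `[(c p - l)%R, (c p + l)%R]%classic) <= (m%:R * (2 * l))%:E)%E.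
Proof.
move=> l0; elim: m => [|m IH]; first by rewrite big_ord0 measure0 mul0r.
rewrite big_ord_recr /=; apply: le_trans (measureU2 _ _ _) _ => //.
  by apply: bigsetU_measurable => p _; exact: measurable_itv.
rewrite -natr1 mulrDl mul1r EFinD; apply: leeD => //.
suff : (lebesgue_measure `[(c m - l)%R, (c m + l)%R]%classic <= (2 * l)%:E)%E by [].
rewrite lebesgue_measure_itv /= lte_fin; case: ifP => _; last by rewrite lee_fin mulr_ge0.
by rewrite -EFinB lee_fin; lra.
Qed.

(** The constant is 104 = 26 * 2 * 2, for 26 intervals of length 2 * 2^-J with 2^-J at most 2w. The
    strict room between 64^s v and [w] gives the strict inequality required by [close_times] and
    covers v = 0. *)
Lemma small_preimage (U : set 'rV[R]_(4 * d)) (v w : R) : 0 <= v -> 64 `^ s * v < w ->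
  (forall x y, U x -> U y -> edist x y <= v `^ s^-1) ->
  exists W : set R, [/\ measurable W,
    (forall t, 0 <= t <= 1 / 8 -> U (ghat t) -> W t) & (lebesgue_measure W <= (104 * w)%:E)%E].
Proof.
move=> v0 vw hU; have si : 0 <= s^-1 by rewrite invr_ge0; have := s1; move=> ?; lra.
have s0 : s != 0 by rewrite gt_eqF //; have := s1; move=> ?; lra.
have w0 : 0 < w by apply: le_lt_trans vw; rewrite mulr_ge0 ?powR_ge0.
have [w1|w1] := leP 1 w.
  exists `[0, 1 / 8]%classic; split; first exact: measurable_itv.
    by move=> t ht _; rewrite /= in_itv.
  rewrite lebesgue_measure_itv /= lte_fin; case: ifP => _; last by rewrite lee_fin mulr_ge0 // ltW.
  by rewrite -EFinB lee_fin; lra.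
have wp : 0 < w / 2 by rewrite divr_gt0.
have [|J [j1 j2]] := dyadic_level wp; first by lra.
have pw : 0 < 2 ^+ J :> R := pow2_gt0 J.
have wJ : 2 ^- J <= 2 * w by rewrite -(ler_pM2l pw) mulfV ?gt_eqF //; lra.
have small x y : U x -> U y -> edist x y < lam ^- J / 64.
  move=> Ux Uy; apply: le_lt_trans (hU x y Ux Uy) _.
  rewrite ltr_pdivlMr // mulrC.
  have -> : 64 = (64 `^ s) `^ s^-1 :> R by rewrite -powRrM mulfV // powRr1.
  rewrite -powRM ?powR_ge0 //; apply: lt_le_trans (_ : w `^ s^-1 <= _).
    apply: gt0_ltr_powR; rewrite ?nnegrE ?mulr_ge0 ?powR_ge0 //; last exact: ltW.
    by rewrite invr_gt0; have := s1; move=> ?; lra.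
  by apply: pow_le1; [exact: ltW | lra].
have [[t0 [ht0 Ut0]]|none] := pselect (exists t0, 0 <= t0 <= 1 / 8 /\ U (ghat t0)); last first.
  exists set0; split=> //; first by move=> t ht Ut; case: none; exists t.
  by rewrite measure0 lee_fin mulr_ge0 // ltW.
have [c hc] := close_times J t0.
exists (\big[setU/set0]_(p < 26) `[c p - 2 ^- J, c p + 2 ^- J]%classic); split.
- by apply: bigsetU_measurable => p _; exact: measurable_itv.
- move=> t ht Ut; have [|p p26 hp] := hc t _ (small _ _ Ut0 Ut).
    by move: ht ht0 => /andP[? ?] /andP[? ?]; rewrite ler_norml; apply/andP; split; lra.
  rewrite -(bigcup_mkord 26 (fun p => `[c p - 2 ^- J, c p + 2 ^- J]%classic)); exists p => //=; rewrite in_itv /=.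
  by move: hp; rewrite ler_norml => /andP[? ?]; apply/andP; split; lra.
apply: le_trans (measure_intervals c 26 _) _; first by rewrite invr_ge0 exprn_ge0.
by rewrite lee_fin; lra.
Qed.

(** The preimages of a cover must fill a time interval of length 1/8. As 1664 = 16 * 104, the
    summable slack in [w] uses up 1/16 of it, and the other 1/16 bounds the cost of the cover from
    below. *)
Lemma curve_positive : (0 < hausdorff s curve)%E.
Proof.
have k0 : 0 < 1664 * 64 `^ s :> R by rewrite mulr_gt0 ?powR_gt0 ?ltr0n.
have s0 : 0 < s by have := s1; move=> ?; lra.
apply: (@hausdorff_gt0 _ _ _ _ (1664 * 64 `^ s)^-1); first by rewrite invr_gt0.
move=> U cov dU; set S := (\sum_(i <oo) _)%E.
have S0 : (0 <= S)%E by apply: nneseries_ge0 => i _ _; exact: hcontent_ge0.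
move: S0; case ES : S => [sv| |] //= _; last by rewrite leey.
have fin i : exists2 v : R, 0 <= v & hcontent s (U i) = v%:E.
  have := hcontent_ge0 s (U i).
  have := @hcontent_le _ _ s (U i) 1 s0 ler01 (fun x y => le_diam (dU i)).
  by case: (hcontent s (U i)) => [r| |] //= _; rewrite lee_fin; exists r.
have [v hv] : exists v : nat -> R, forall i, 0 <= v i /\ hcontent s (U i) = (v i)%:E.
  exists (fun i => fine (hcontent s (U i))) => i.
  by have [r r0 e'] := fin i; rewrite e'.
have hU i x y : U i x -> U i y -> edist x y <= v i `^ s^-1.
  move=> Ux Uy; have [v0] := hv i.
  have d1 := le_diam (dU i).
  rewrite /hcontent; destruct (pselect (U i !=set0)) as [ne|no]; last by case: no; exists x.
  have : (diam (U i) <= 1%:E)%E := dU i.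
  have : ((edist x y)%:E <= diam (U i))%E.
    by apply: ereal_sup_ubound; exists x => //; exists y.
  case: (diam (U i)) => [r| |] //=; rewrite !lee_fin => xr _ [<-].
  rewrite -powRrM mulfV ?gt_eqF // powRr1 //.
  by apply: le_trans xr; exact: edist_ge0.
pose w i := 64 `^ s * v i + 1 / 1664 * 2 ^- i.+1.
have q0 : 0 < 1 / 1664 :> R by rewrite divr_gt0 ?ltr0n ?ltr01.
have vw i : 64 `^ s * v i < w i.
  by rewrite ltrDl; apply: mulr_gt0 q0 _; rewrite invr_gt0 exprn_gt0.
have hW' i : exists W : set R, [/\ measurable W,
    (forall t, 0 <= t <= 1 / 8 -> U i (ghat t) -> W t) & (lebesgue_measure W <= (104 * w i)%:E)%E].
  by apply: small_preimage (vw i) _; [have [] := hv i | exact: hU].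
have [W hW] := choice hW'.
have sub : `[0, 1 / 8]%classic `<=` \bigcup_i W i.
  move=> t; rewrite /= in_itv /= => ht; have [|i _ Ui] := cov (ghat t); first by exists t.
  by exists i => //; have [_ h _] := hW i; exact: h.
have lm : lebesgue_measure `[(0 : R), 1 / 8]%classic = (1 / 8)%:E.
  by rewrite lebesgue_measure_itv /= lte_fin ifT -?EFinB ?subr0 //; lra.
have big : ((1 / 8)%:E <= \sum_(i <oo) lebesgue_measure (W i))%E.
  rewrite -lm; apply: (@measure_sigma_subadditive _ _ _ (@lebesgue_measure R) _ _ _ _ sub).
    by move=> i; have [] := hW i.
  exact: measurable_itv.
have up : (\sum_(i <oo) lebesgue_measure (W i) <= (104 * (64 `^ s * sv + 1 / 1664))%:E)%E.
  apply: nneseries_le => [i|M]; first exact: measure_ge0.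
  apply: (@le_trans _ _ (\sum_(i < M) (104 * w i)%:E)%E).
    by apply: lee_sum => i _; have [] := hW i.
  rewrite sumEFin lee_fin -mulr_sumr ler_pM2l // big_split /= -mulr_sumr.
  apply: lerD; last by apply: half_geom; lra.
  rewrite ler_pM2l ?powR_gt0 // -lee_fin -ES -sumEFin.
  apply: (@le_trans _ _ (\sum_(0 <= i < M) hcontent s (U i))%E).
    by rewrite big_mkord; apply: lee_sum => i _; have [_ ->] := hv i.
  by apply: nneseries_lim_ge => i _ _; exact: hcontent_ge0.
have := le_trans big up; rewrite lee_fin => h.
rewrite lee_fin -[leLHS]mul1r ler_pdivrMr //; lra.
Qed.

(** * Tangents of the curve *)

(* The rescaled limit of [term] near a cluster of [k] loops: the index [p] stands for the level
   [NN i - P + p]. *)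
Definition lterm k cc r P p (u : R) : R :=
  if (cc < 2)%N then wave (odd cc) (2 ^+ (r + d * p) / 2 ^+ (d * P) * pathX (loopS k) u)
  else if (P <= p)%N then wave (odd cc) (2 ^+ (r + d * (p - P)) * pathY (loopS k) u) else 0.

(** The factor [be ^+ P * be ^- p] is the amplitude of the level [NN i - P + p] relative to that of
    [NN i]. *)
Definition Fsum k cc r P (u : R) := \sum_(p < P + P) be ^+ P * be ^- p * lterm k cc r P p u.

Definition Fc k cc r (u : R) := limn (fun P => lam ^- r * Fsum k cc r P u).

(* The first loop of the cluster [h] of block [i], in units of [2 ^- nn i]. *)
Definition gadget i (h : nat) : R := (2 ^ ww i * h + 2 ^ (ww i).-1)%N%:R.

Lemma psum_cat (b : R) D m n : psum b D (m + n) = psum b D m + \sum_(p < n) b ^- (m + p) * D (m + p)%N.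
Proof.
elim: n => [|n IH]; first by rewrite addn0 big_ord0 addr0.
by rewrite addnS {1}/psum big_ord_recr /= -/(psum b D (m + n)) IH big_ord_recr /= addrA.
Qed.

Lemma gadget_path i h u : `|u| <= 2 ^+ (ww i - 2) - 1 ->
  pathX (act i) (gadget i h + u) = gadget i h + pathX (loopS (kk i)) u /\
  pathY (act i) (gadget i h + u) = pathY (loopS (kk i)) u.
Proof.
move=> hu; have [f1 f2] := floor_bounds u; have /ler_normlP[a1 a2] := hu.
have -> : gadget i h = ((2 ^ ww i)%N%:Z * h%:Z + (2 ^ (ww i).-1)%N%:Z)%:~R.
  by rewrite /gadget natrD natrM intrD intrM.
have e2 : (2 ^ (ww i - 2))%N%:Z%:~R = 2 ^+ (ww i - 2) :> R by rewrite -natrX.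
apply: path_shift; rewrite (act_window e1) //.
  by rewrite -(ler_int R) intrN e2; lra.
by rewrite -(ler_int R) e2; lra.
Qed.

(** Clusters start at multiples of 2^(ww i - 1), so at the levels of a window the starting point has
    an integer phase, which the waves ignore. *)
Lemma gadget_int i h a : (a < ww i)%N -> exists z : int, gadget i h / 2 ^+ a = z%:~R.
Proof.
move=> aw; have w0 : (0 < ww i)%N by apply: leq_ltn_trans aw.
exists (2 ^ (ww i - a) * h + 2 ^ ((ww i).-1 - a))%N%:Z.
apply/(canLR (mulfK _)); first by rewrite gt_eqF // pow2_gt0.
have -> : (2 ^ (ww i - a) * h + 2 ^ ((ww i).-1 - a))%N%:Z%:~R =
  (2 ^ (ww i - a) * h + 2 ^ ((ww i).-1 - a))%N%:R :> R by [].
rewrite -natrX -natrM /gadget; congr (_%:R).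
rewrite mulnDl mulnAC -!expnD subnK ?subnK //; last exact: ltnW.
by rewrite -ltnS prednK.
Qed.

Lemma window_leq N P p : (P <= N)%N -> (N <= N - P + p)%N = (P <= p)%N.
Proof. by lia. Qed.

Lemma window_sub N P p : (P <= N)%N -> (N - P + p - N = p - P)%N.
Proof. by lia. Qed.

(** This is exact because the window stays inside block [i], P being smaller than [BB i] and [AA i],
    and because near the cluster the path is the model path shifted by an integer phase. *)
Lemma window_term i h cc r P p u : (r < d)%N -> (d * P < ww i)%N -> (p < P + P)%N ->
  `|u| <= 2 ^+ (ww i - 2) - 1 ->
  term cc r (NN i - P + p) ((gadget i h + u) / 2 ^+ nn i)
  - term cc r (NN i - P + p) (gadget i h / 2 ^+ nn i) = lterm (kk i) cc r P p u.
Proof.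
move=> rd dP pP hu; have d0 : (0 < d)%N by apply: leq_trans d4.
have PB : (P < BB i)%N.
  by apply: leq_ltn_trans (_ : d * P < _)%N; rewrite ?leq_pmull // /BB addSn ltnS (leq_trans (ltnW dP)) ?leq_addl.
have PA : (P < AA e i)%N by apply: leq_trans PB (BB_AA e1 i).
have PN : (P <= NN i)%N by apply: leq_trans (ltnW PA) (leq_addl _ _).
have q1 : (MM i < NN i - P + p)%N.
  by apply: leq_trans (leq_addr _ _); rewrite ltn_subRL addnC ltn_add2l.
have q2 : (NN i - P + p < MM i.+1)%N.
  rewrite MMS -ltn_subRL; apply: leq_trans pP _.
  by rewrite leq_subRL addnC; lia.
have bE : blk (NN i - P + p) = i by apply: (blk_eq e1); rewrite (ltnW q1).
have pn := pow2_gt0 (nn i).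
have K (v : R) : 2 ^+ nn i * (v / 2 ^+ nn i) = v by rewrite mulrCA mulfV ?mulr1 // gt_eqF.
have [gx gy] := gadget_path h hu.
have h0 : `|0 : R| <= 2 ^+ (ww i - 2) - 1.
  by rewrite normr0 subr_ge0 exprn_ege1 // ler1n.
have [gx0 gy0] := gadget_path h h0; have [x0 y0] := path0 R (kk i).
rewrite addr0 x0 addr0 in gx0; rewrite addr0 y0 in gy0.
rewrite /term bE /lterm /xx /yy !K gx gy gx0 gy0.
case: ifP => _.
  have e2 : 2 ^+ (r + d * (NN i - P + p)) / 2 ^+ nn i = 2 ^+ (r + d * p) / 2 ^+ (d * P) :> R.
    have pq n : 2 ^+ n != 0 :> R by rewrite gt_eqF // pow2_gt0.
    apply/eqP; rewrite eqr_div; [|exact: pq|exact: pq].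
    rewrite -!exprD /nn -!addnA -!mulnDr; apply/eqP; congr (_ ^+ (_ + d * _)).
    by rewrite addnAC subnK // addnC.
  have pw (x : R) : 2 ^+ (r + d * (NN i - P + p)) * (x / 2 ^+ nn i) =
    2 ^+ (r + d * p) / 2 ^+ (d * P) * x by rewrite mulrA mulrAC e2.
  rewrite !pw mulrDr.
  have [z ez] := gadget_int h dP.
  have -> : 2 ^+ (r + d * p) / 2 ^+ (d * P) * gadget i h = ((2 ^+ (r + d * p) * z)%:~R : R).
    by rewrite intr_pow2M -ez mulrA mulrAC -mulrA.
  by rewrite wave_shift wave_int subr0.
rewrite (window_leq p PN).
case: ifPn => hp.
  rewrite (window_sub p PN).
  by rewrite mulr0 (_ : 0 = 0%:~R :> R) // wave_int subr0.
by rewrite (gtn_eqF q1) /= subrr.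
Qed.

(** Outside the window the slower levels contribute order [ga ^- P] times |u| and the faster ones
    order [be ^- P]; both powers are below [2 ^- P]. *)
Definition ferr (u : R) P : R := (2 ^+ d * (2 * `|u|) + 2) * 2 ^- P.

Lemma pow2_lt (a : R) : exists N, forall n, (N <= n)%N -> a <= 2 ^+ n.
Proof. by apply: pow_unbounded; rewrite ltr1n. Qed.

Lemma ferr_small u (z : R) : 0 < z -> exists P, forall Q, (P <= Q)%N -> ferr u Q <= z.
Proof.
move=> z0; have c0 : 0 < 2 ^+ d * (2 * `|u|) + 2 :> R.
  by rewrite ltr_wpDl // mulr_ge0 ?exprn_ge0 // mulr_ge0.
have [N HN] := pow2_lt ((2 ^+ d * (2 * `|u|) + 2) / z); exists N => Q /HN.
by rewrite /ferr !ler_pdivrMr // 1?[z * _]mulrC // exprn_gt0.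
Qed.

Lemma ferr_mono u P Q : (P <= Q)%N -> ferr u Q <= ferr u P.
Proof.
by move=> PQ; rewrite ler_wpM2l ?pow2V_le // addr_ge0 // mulr_ge0 ?exprn_ge0 // mulr_ge0.
Qed.

Lemma window_shift N P p : (P <= N)%N -> (P + (N - P + p) = N + p)%N.
Proof. by lia. Qed.

Lemma window_end N P : (P <= N)%N -> (N - P + (P + P) = N + P)%N.
Proof. by lia. Qed.

Lemma window_room D N1 N2 M w : (D.+1 + N1 + N2 + 2 + M <= w)%N ->
  (D < w)%N /\ (N1 <= w - 2)%N /\ (N2 <= w - 2)%N /\ (M <= w)%N.
Proof. by lia. Qed.

Lemma add_halves (a b z : R) : a * 2 <= z -> b * 2 <= z -> a + b <= z.
Proof. by move=> *; lra. Qed.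

Lemma window_scale (b g g' x y : R) : b != 0 -> g != 0 -> g' != 0 ->
  b * (x * (2 * (y / (b * (g * g')))) * g') = x * (2 * y) / g.
Proof. by move=> b0 g0 g0'; field; rewrite b0 g0 g0'. Qed.

Lemma window_sum i h cc r P u : (r < d)%N -> (d * P < ww i)%N ->
  `|u| <= 2 ^+ (ww i - 2) - 1 ->
  `|lam ^+ nn i * (coord cc r ((gadget i h + u) / 2 ^+ nn i) - coord cc r (gadget i h / 2 ^+ nn i))
    - lam ^- r * Fsum (kk i) cc r P u| <= ferr u P.
Proof.
move=> rd dP hu; have l0 := lam_gt0; have l1 := lam_gt1; have b2 := be2; have g2 := ga2.
have d0 : (0 < d)%N by apply: leq_trans d4.
have PB : (P < BB i)%N.
  by apply: leq_ltn_trans (_ : d * P < _)%N; rewrite ?leq_pmull // /BB addSn ltnS (leq_trans (ltnW dP)) ?leq_addl.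
have PN : (P <= NN i)%N.
  by apply: leq_trans (ltnW PB) _; apply: leq_trans (BB_AA e1 i) (leq_addl _ _).
rewrite coordB [_ * (_ * lsum _ _)]mulrCA -mulrBr normrM gtr0_norm ?invr_gt0 ?exprn_gt0 //.
set t := (gadget i h + u) / _; set t0 := gadget i h / _.
set D := fun p => _; set N := NN i in PN *.
apply: le_trans (_ : `|lam ^+ nn i * lsum be D - Fsum (kk i) cc r P u| <= _).
  by rewrite ler_piMl // invf_le1 ?exprn_gt0 // exprn_ege1 // ltW.
have -> : lam ^+ nn i = be ^+ N by rewrite /nn exprM.
have D1 p : `|D p| <= 1 := termB_abs cc r p t t0.
have mid : Fsum (kk i) cc r P u = be ^+ N * \sum_(p < P + P) be ^- (N - P + p) * D (N - P + p)%N.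
  rewrite /Fsum mulr_sumr; apply: eq_bigr => p _; rewrite /D window_term // mulrA; congr (_ * _).
  have bn n : be ^+ n != 0 by rewrite gt_eqF // beX.
  apply/eqP; rewrite eqr_div ?bn //; apply/eqP; rewrite -!exprD; congr (_ ^+ _).
  exact: window_shift.
have cat : psum be D (N + P) = psum be D (N - P) + \sum_(p < P + P) be ^- (N - P + p) * D (N - P + p)%N.
  by rewrite -psum_cat window_end.
have tail : `|lsum be D - psum be D (N + P)| <= 2 * be ^- (N + P) := lsum_tail _ b2 D1.
have du : `|t - t0| = `|u| / 2 ^+ nn i.
  by rewrite /t /t0 -mulrBl addrC addKr normrM normfV (gtr0_norm (pow2_gt0 _)).
have head : `|psum be D (N - P)| <= 2 ^+ r * (2 * `|t - t0|) * ga ^+ (N - P).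
  rewrite (le_trans (ler_norm_sum _ _ _)) //.
  apply: (@le_trans _ _ (\sum_(p < N - P) 2 ^+ r * (2 * `|t - t0|) * ga ^+ p)).
    apply: ler_sum => p _; rewrite normrM gtr0_norm ?invr_gt0 ?beX //.
    rewrite [leLHS]mulrC ler_pdivrMr ?beX //; apply: le_trans (term_lip cc r p t t0) _.
    by rewrite -be_ga exprMn mulrC mulrCA [be ^+ p * _]mulrC.
  rewrite -mulr_sumr ler_wpM2l ?mulr_ge0 ?exprn_ge0 // (le_trans (geom_sum_le _ _)) //; first lra.
  rewrite ler_pdivrMr; last lra.
  by rewrite ler_peMr; [by []|exact: ltW (gaX _)|lra].
have bN := beX N; have bNP := beX P; have gP := gaX P; have gNP := gaX (N - P).
rewrite mid -mulrBr normrM (gtr0_norm bN).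
have -> : lsum be D - \sum_(p < P + P) be ^- (N - P + p) * D (N - P + p)%N =
  (lsum be D - psum be D (N + P)) + psum be D (N - P) by rewrite cat; ring.
have le1 : be ^+ N * `|psum be D (N - P)| <= 2 ^+ r * (2 * `|u|) * ga ^- P.
  apply: (@le_trans _ _ (be ^+ N * (2 ^+ r * (2 * `|t - t0|) * ga ^+ (N - P)))).
    by rewrite ler_pM2l.
  rewrite du /nn -be_ga exprMn -/N -{3}(subnK PN) exprD [ga ^+ _ * ga ^+ P]mulrC.
  by rewrite window_scale // ?gt_eqF.
have le2 : be ^+ N * `|lsum be D - psum be D (N + P)| <= 2 * be ^- P.
  apply: (@le_trans _ _ (be ^+ N * (2 * be ^- (N + P)))); first by rewrite ler_pM2l.
  by rewrite exprD invfM mulrCA mulVKf // gt_eqF.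
apply: (@le_trans _ _ (2 ^+ r * (2 * `|u|) * ga ^- P + 2 * be ^- P)).
  apply: le_trans (_ : be ^+ N * (`|lsum be D - psum be D (N + P)| + `|psum be D (N - P)|) <= _).
    by rewrite ler_pM2l // ler_normD.
  by rewrite mulrDr addrC lerD.
have v2 (b : R) : 2 <= b -> b ^- P <= 2 ^- P.
  move=> h2; rewrite lef_pV2 ?posrE ?exprn_gt0 //; last by lra.
  by rewrite lerXn2r ?nnegrE //; lra.
rewrite /ferr [leRHS]mulrDl; apply: lerD; last by rewrite ler_pM2l // v2.
apply: ler_pM; rewrite ?invr_ge0 ?(ltW gP) ?v2 ?mulr_ge0 ?exprn_ge0 //.
by rewrite ler_wpM2r ?mulr_ge0 // ler_weXn2l ?ler1n // ltnW.
Qed.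

Lemma type_exists k M : exists i, [/\ (M <= i)%N, kk i = k & (M <= ww i)%N].
Proof.
have p2 : (0 < 2 ^ k)%N by rewrite expn_gt0. have p3 : (0 < 3 ^ M)%N by rewrite expn_gt0.
exists (2 ^ k * 3 ^ M).-1; have E : (2 ^ k * 3 ^ M).-1.+1 = (2 ^ k * 3 ^ M)%N by rewrite prednK // muln_gt0 p2.
have M3 : (M < 3 ^ M)%N by rewrite ltn_expl.
have k2 : kk (2 ^ k * 3 ^ M).-1 = k by rewrite /kk E lognM // !lognX /= muln1 muln0 addn0.
split=> //; first by rewrite -ltnS E (leq_trans M3) // leq_pmull.
by rewrite /ww E k2 lognM // !lognX /= muln0 muln1; lia.
Qed.

(** Both sums are compared with the same rescaled increment of the curve, taken in a block with [k]
    loops per cluster that is wide enough for both windows and for [u]. *)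
Lemma Fsum_cauchy k cc r u P Q : (r < d)%N -> (P <= Q)%N ->
  `|lam ^- r * Fsum k cc r Q u - lam ^- r * Fsum k cc r P u| <= 2 * ferr u P.
Proof.
move=> rd PQ; have [N HN] := pow2_lt (`|u| + 1).
have [i [_ ik iw]] := type_exists k ((d * Q).+1 + N + 2).
have hu : `|u| <= 2 ^+ (ww i - 2) - 1 by rewrite lerBrDr HN //; lia.
have wQ : (d * Q < ww i)%N by lia.
have wP : (d * P < ww i)%N by apply: leq_ltn_trans wQ; rewrite leq_mul2l PQ orbT.
have := window_sum 0 cc rd wQ hu; have := window_sum 0 cc rd wP hu; rewrite ik.
have := ferr_mono u PQ; set x := _ * (_ - _); set a := _ * Fsum _ _ _ P _; set b := _ * _.
rewrite !ler_norml => h /andP[? ?] /andP[? ?]; apply/andP; split; lra.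
Qed.

Lemma Fc_approx k cc r u P : (r < d)%N -> `|Fc k cc r u - lam ^- r * Fsum k cc r P u| <= 2 * ferr u P.
Proof.
move=> rd; apply: (@cauchy_limn _ (fun P => lam ^- r * Fsum k cc r P u) (fun P => 2 * ferr u P)) => [p q pq|z z0].
  exact: Fsum_cauchy.
have [N HN] := ferr_small u (divr_gt0 z0 (ltr0Sn _ 1)).
by exists N; have := HN N (leqnn _); lra.
Qed.

(** * The limit curves *)

Definition Fvec k (u : R) : 'rV[R]_(4 * d) := \row_(j < 4 * d) Fc k (j %/ d) (j %% d) u.

Lemma Fvec_approx i h P u : (d * P < ww i)%N -> `|u| <= 2 ^+ (ww i - 2) - 1 ->
  edist (lam ^+ nn i *: (ghat ((gadget i h + u) / 2 ^+ nn i) - ghat (gadget i h / 2 ^+ nn i)))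
    (Fvec (kk i) u) <= (4 * d)%:R * 3 * ferr u P.
Proof.
move=> dP hu; have d0 : (0 < d)%N by apply: leq_trans d4.
apply: le_trans (enorm_le_sum _) _.
apply: (@le_trans _ _ (\sum_(j < 4 * d) 3 * ferr u P)); last first.
  by rewrite sumr_const card_ord -[_ *+ (4 * d)]mulr_natl mulrA.
apply: ler_sum => j _; rewrite !mxE.
have rd : (j %% d < d)%N by rewrite ltn_mod.
have := window_sum h (j %/ d) rd dP hu; have := Fc_approx (kk i) (j %/ d) u P rd.
set x := _ * (_ - _); set b := _ * Fsum _ _ _ _ _.
by rewrite !ler_norml => /andP[? ?] /andP[? ?]; apply/andP; split; lra.
Qed.

Lemma Fc0 k cc r : (r < d)%N -> Fc k cc r 0 = 0.
Proof.
move=> rd; apply/eqP; rewrite -normr_le0; apply/ler_addgt0Pr => z z0; rewrite add0r.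
have [P HP] := ferr_small 0 (divr_gt0 z0 (ltr0Sn _ 1)).
have := Fc_approx k cc 0 P rd; rewrite [Fsum _ _ _ _ _](_ : _ = 0) ?mulr0 ?subr0.
  by have := HP P (leqnn _); move=> *; lra.
have [x0 y0] := path0 R k; rewrite /Fsum big1 // => p _; rewrite /lterm x0 y0.
rewrite !mulr0 (_ : 0 = 0%:~R :> R) // wave_int; case: ifP; rewrite ?if_same mulr0 //.
Qed.

Lemma Fvec0 k : Fvec k 0 = 0.
Proof.
have d0 : (0 < d)%N by apply: leq_trans d4.
by apply/rowP => j; rewrite !mxE Fc0 // ltn_mod.
Qed.

(** Through this approximation by rescaled distances the limit curves inherit the Hölder bound and
    the lower bound of [ghat]. *)
Lemma Fvec_limit k u v (z : R) M : 0 < z -> exists i, [/\ (M <= ww i)%N, kk i = k,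
  `|u| <= 2 ^+ (ww i - 2) - 1, `|v| <= 2 ^+ (ww i - 2) - 1 &
  `|lam ^+ nn i * edist (ghat ((gadget i 0 + u) / 2 ^+ nn i)) (ghat ((gadget i 0 + v) / 2 ^+ nn i)) -
    edist (Fvec k u) (Fvec k v)| <= z].
Proof.
move=> z0; have d0 : (0 < d)%N by apply: leq_trans d4.
have c0 : 0 < (4 * d)%:R * 3 :> R by rewrite mulr_gt0 // ltr0n muln_gt0.
have z1 : 0 < z / 2 / ((4 * d)%:R * 3) by rewrite !divr_gt0.
have [P1 H1] := ferr_small u z1; have [P2 H2] := ferr_small v z1.
have [N1 HN1] := pow2_lt (`|u| + 1); have [N2 HN2] := pow2_lt (`|v| + 1).
pose P := (P1 + P2)%N; have [i [_ ik iw]] := type_exists k ((d * P).+1 + N1 + N2 + 2 + M).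
have [wP [w1 [w2 w3]]] := window_room iw.
have hu : `|u| <= 2 ^+ (ww i - 2) - 1 by rewrite lerBrDr HN1.
have hv : `|v| <= 2 ^+ (ww i - 2) - 1 by rewrite lerBrDr HN2.
exists i; split => //.
have := Fvec_approx 0 wP hu; have := Fvec_approx 0 wP hv; rewrite ik.
have := H1 P (leq_addr _ _); have := H2 P (leq_addl _ _); rewrite !ler_pdivlMr // ![ferr _ _ * _]mulrC.
set a := ghat ((_ + u) / _); set b := ghat ((_ + v) / _); set c := ghat (gadget i 0 / _) => e2 e1' h2 h1.
have l0 : 0 < lam ^+ nn i by rewrite exprn_gt0 // lam_gt0.
have -> : lam ^+ nn i * edist a b = edist (lam ^+ nn i *: (a - c)) (lam ^+ nn i *: (b - c)).
  by rewrite edist_scale edist_shift gtr0_norm.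
by apply: le_trans (edist_quad h1 h2) _; apply: add_halves.
Qed.

Lemma lam_scale n (x : R) : 0 <= x -> lam ^+ n * (x / 2 ^+ n) `^ s^-1 = x `^ s^-1.
Proof.
move=> x0; have p := pow2_gt0 n; rewrite lam_pow -powRM ?(ltW p) //.
  by rewrite mulrCA mulfV ?mulr1 // gt_eqF.
by rewrite divr_ge0 // ltW.
Qed.

Lemma pow_inv n : (2 ^- n) `^ s^-1 = lam ^- n.
Proof.
have ln := exprn_gt0 n lam_gt0; apply: (mulfI (lt0r_neq0 ln)).
by rewrite -[2 ^- n]mul1r lam_scale // powR1 mulfV // gt_eqF.
Qed.

Lemma ww_nn i : (ww i <= nn i)%N.
Proof.
have d0 : (0 < d)%N by apply: leq_trans d4.
apply: (@leq_trans (NN i)); last by rewrite /nn leq_pmull.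
by apply: leq_trans (leq_addl _ _); apply: leq_trans (BB_AA e1 i); exact: leq_addl.
Qed.

Lemma nn_mm i : exists a b, [/\ nn i = (mm i + a)%N, mm i.+1 = (nn i + b)%N, (ww i <= a)%N & (ww i <= b)%N].
Proof.
have d0 : (0 < d)%N by apply: leq_trans d4.
exists (d * AA e i)%N, (d * BB i)%N; rewrite /nn /mm MMS.
have wB : (ww i <= BB i)%N by exact: leq_addl.
split; rewrite -?mulnDr //.
  by apply: leq_trans wB _; apply: leq_trans (BB_AA e1 i) (leq_pmull _ d0).
by apply: leq_trans wB (leq_pmull _ d0).
Qed.

Lemma window_dist i h u v : `|u| <= 2 ^+ (ww i - 2) - 1 -> `|v| <= 2 ^+ (ww i - 2) - 1 ->
  `|(gadget i h + u) / 2 ^+ nn i - (gadget i h + v) / 2 ^+ nn i| = `|u - v| / 2 ^+ nn i /\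
  `|u - v| / 2 ^+ nn i <= 1.
Proof.
move=> hu hv; have p := pow2_gt0 (nn i); split.
  by rewrite -mulrBl opprD addrACA subrr add0r normrM normfV (gtr0_norm p).
rewrite ler_pdivrMr // mul1r; apply: le_trans (ler_normB _ _) _.
have : 2 * 2 ^+ (ww i - 2) <= 2 ^+ nn i :> R.
  rewrite -exprS ler_weXn2l ?ler1n //; apply: leq_trans (ww_nn i).
  by rewrite /ww addnS addnC; lia.
by move=> ?; lra.
Qed.

Lemma Fvec_holder k u v : edist (Fvec k u) (Fvec k v) <= holder_const * `|u - v| `^ s^-1.
Proof.
apply/ler_addgt0Pr => z z0; have [i [_ ik hu hv]] := Fvec_limit k u v 0 z0.
have [E le1] := window_dist 0 hu hv; rewrite -E in le1.
have := ghat_holder le1; rewrite -(ler_pM2l (exprn_gt0 (nn i) lam_gt0)) mulrCA E lam_scale //.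
by move=> h1 /ler_normlP[h2 h3]; lra.
Qed.

(** A wide block has so many levels on both sides of [nn i] that the rescaled distance falls into
    the range of [ghat_lower]. *)
Lemma Fvec_lower k u v : 0 < rhoF k u v -> rhoF k u v `^ s^-1 / 64 <= edist (Fvec k u) (Fvec k v).
Proof.
set rho := rhoF k u v => r0; apply/ler_addgt0Pr => z z0.
have [M1 H1] := pow2_lt rho^-1; have [M2 H2] := pow2_lt (2 * rho).
have [i [iM ik hu hv /ler_normlP[z1 z2]]] := Fvec_limit k u v (M1 + M2) z0.
have [a [b [na mb wa wb]]] := nn_mm i.
have p := pow2_gt0 (nn i); have l0 := exprn_gt0 (nn i) lam_gt0.
set t := (_ + u) / _ in z1 z2 *; set t' := (_ + v) / _ in z1 z2 *.
have K (w : R) : 2 ^+ nn i * (w / 2 ^+ nn i) = w by rewrite mulrCA mulfV ?mulr1 // gt_eqF.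
have [gx gy] := gadget_path 0 hu; have [gx' gy'] := gadget_path 0 hv.
have E : Num.max (xi i t t') (ups i t t') = rho / 2 ^+ nn i.
  rewrite /rho /rhoF maxr_pMl ?invr_ge0 ?(ltW p) // /xi /ups /xx /yy !K gx gx' gy gy' ik.
  by rewrite -mulrBl opprD addrACA subrr add0r normrM normfV (gtr0_norm p).
have := @ghat_lower i t t'; rewrite E => h.
have h1 : 2 ^- mm i.+1 <= rho / 2 ^+ nn i.
  rewrite mb exprD invfM mulrC ler_pM2r ?invr_gt0 // -[leRHS]invrK lef_pV2 ?posrE ?invr_gt0 ?pow2_gt0 //.
  by apply: H1; apply: leq_trans wb; apply: leq_trans iM; exact: leq_addr.
have h2 : rho / 2 ^+ nn i <= 2 ^- mm i / 2.
  rewrite na exprD invfM mulrCA ler_pM2l ?invr_gt0 ?pow2_gt0 // ler_pdivrMr ?pow2_gt0 //.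
  have : 2 * rho <= 2 ^+ a.
    by apply: H2; apply: leq_trans wa; apply: leq_trans iM; exact: leq_addl.
  by move=> ?; lra.
have := h h1 h2; rewrite -(ler_pM2l l0) mulrA lam_scale ?(ltW r0) //.
by move=> ?; lra.
Qed.

Lemma powR_sV (x : R) : 0 <= x -> (x `^ s^-1) `^ s = x.
Proof.
have s0 : s != 0 by rewrite gt_eqF //; have := s1; move=> ?; lra.
by move=> x0; rewrite -powRrM mulVf // powRr1.
Qed.

Definition Fbound (r : R) : R := (64 * r) `^ s + 1.

(** The lower bound against the base point 0 controls the line position, and the path lags by at
    most 1/2. Properness reduces closedness and the excess in a ball to a compact set of
    parameters. *)
Lemma Fvec_proper k u r : enorm (Fvec k u) <= r -> `|u| <= Fbound r.
Proof.
move=> ur; have r0 : 0 <= r by apply: le_trans ur; exact: enorm_ge0.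
have := powR_ge0 (64 * r) s; rewrite /Fbound; have [x0 y0] := path0 R k.
have /andP[n1 n2] := pathX_near (loopS k) u.
have un : `|u| <= `|pathX (loopS k) u| + 1 / 2.
  have /ler_normlP[m1 m2] := lexx `|pathX (loopS k) u|.
  by rewrite ler_norml; apply/andP; split; lra.
have [h|h] := leP (rhoF k u 0) 0.
  have : `|pathX (loopS k) u| <= 0 by apply: le_trans h; rewrite /rhoF x0 subr0 le_max lexx.
  by move=> ? ?; lra.
have := Fvec_lower h; rewrite Fvec0 edist0 => h1.
have s0 : 0 <= s by have := s1; move=> ?; lra.
have : rhoF k u 0 `^ s^-1 <= 64 * r by lra.
move=> h3; have : (rhoF k u 0 `^ s^-1) `^ s <= (64 * r) `^ s.
  by apply: ge0_ler_powR; rewrite ?nnegrE ?powR_ge0 ?mulr_ge0.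
rewrite powR_sV ?(ltW h) // => h2.
have : `|pathX (loopS k) u| <= rhoF k u 0 by rewrite /rhoF x0 subr0 le_max lexx.
by move=> ? ?; lra.
Qed.

Lemma Fvec_unif k (z : R) : 0 < z -> exists2 dl : R, 0 < dl &
  forall u v, `|u - v| < dl -> edist (Fvec k u) (Fvec k v) < z.
Proof.
move=> z0; have c0 := holder_const_ge0; have c1 : 0 < holder_const + 1 by lra.
have s0 : 0 < s by have := s1; move=> ?; lra.
exists ((z / (holder_const + 1)) `^ s); first by rewrite powR_gt0 // divr_gt0.
move=> u v uv; apply: le_lt_trans (Fvec_holder k u v) _.
have h : `|u - v| `^ s^-1 <= z / (holder_const + 1).
  have s0' : s != 0 by rewrite gt_eqF.
  have e2 : z / (holder_const + 1) = ((z / (holder_const + 1)) `^ s) `^ s^-1.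
    by rewrite -powRrM mulfV // powRr1 // ltW // divr_gt0.
  rewrite e2; apply: ge0_ler_powR; rewrite ?nnegrE ?powR_ge0 ?invr_ge0 //; exact: ltW.
apply: (@le_lt_trans _ _ (holder_const * (z / (holder_const + 1)))); first by rewrite ler_wpM2l.
by rewrite mulrA ltr_pdivrMr // mulrDr mulr1 mulrC; lra.
Qed.

Lemma Fvec_closed k : closed (range (Fvec k)).
Proof.
apply: closed_edist => y hy; set U := Fbound (enorm y + 1).
have U0 : 0 <= U by rewrite /U /Fbound addr_ge0 ?powR_ge0.
pose f u := edist (Fvec k u) y.
have cf : {within `[- U, U], continuous f}.
  apply: continuous_subspaceT => u; apply/cvgrPdist_lt => z z0.
  have [dl dl0 hd] := Fvec_unif k z0.
  apply/nbhs_ballP; exists dl => //= v uv; apply: le_lt_trans (edist_lip _ _ _) _; exact: hd.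
have UU : - U <= U by lra.
have [c cU hc] := EVT_min UU cf.
have [c0|c0] := leP (f c) 0.
  by exists c => //; apply: edist_eq0; apply/eqP; rewrite eq_le c0 edist_ge0.
have m0 : 0 < Num.min (f c) 1 by rewrite lt_min c0 ltr01.
have [_ [u _ <-]] := hy _ m0; rewrite lt_min => /andP[h1 h2].
have uU : `|u| <= U.
  apply: (@Fvec_proper k); have := edist_triangle y (Fvec k u) 0.
  by rewrite !edist0 edistC; lra.
have := hc u; rewrite in_itv /= -ler_norml uU => /(_ isT).
by rewrite leNgt /f [edist (Fvec k u) y]edistC h1.
Qed.

(** The time lies so close to the start of a cluster that the difference vanishes after rescaling.
    It is required to lie after that start, which keeps clusters beyond the end of the time interval
    out. *)
Definition good (t : R) i := exists h, gadget i h <= 2 ^+ nn i * t <= gadget i h + 2 ^- ww i.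

Definition rich (t : R) k := forall M, exists i, [/\ (M <= i)%N, kk i = k, (M <= ww i)%N & good t i].

Lemma rich_sequence t k : rich t k -> exists I : nat -> nat, (forall m, (I m < I m.+1)%N) /\
  forall m, [/\ (m <= I m)%N, kk (I m) = k, (m <= ww (I m))%N & good t (I m)].
Proof.
move=> /choice[c hc]; pose I := fix I m := if m is m'.+1 then c (I m' + m').+1 else c 0%N.
have le1 m : (m < (I m + m).+1)%N by rewrite ltnS leq_addl.
exists I; split=> [m|[|m]]; last 2 first.
- exact: hc.
- by have [h1 h2 h3 h4] := hc (I m + m).+1; split => //=; exact: leq_trans (le1 m) _.
by have [h1 _ _ _] := hc (I m + m).+1; apply: leq_trans h1; rewrite ltnS leq_addr.
Qed.

(* [0 < q] keeps the level below [nn i], so that no gadget can bring distant times close in the image. *)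
Lemma close_before i q t u : (0 < q)%N -> (q <= ww i)%N -> `|t - u| <= 1 / 8 ->
  edist (ghat t) (ghat u) < lam ^- (nn i - q) / 64 -> `|t - u| <= 2 ^+ q / 2 ^+ nn i.
Proof.
move=> q0 qw h1 h2; have [a [b [na mb wa wb]]] := nn_mm i.
have qn : (q <= nn i)%N by apply: leq_trans qw (ww_nn i).
have [h|] := ghat_close h1 h2.
  apply: le_trans h _; rewrite ler_pdivlMr ?pow2_gt0 // -{2}(subnK qn) exprD mulKf // gt_eqF // pow2_gt0.
move=> [i' [j1 j2 _ _ _]]; exfalso.
have [ii|ii] := leqP i i'.
  have : (nn i <= nn i')%N.
    rewrite /nn leq_mul2l; apply/orP; right.
    by move: ii; rewrite leq_eqVlt => /predU1P[->//|/(NN_mono e1)/ltnW].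
  by move: j1 q0 qn; clear; lia.
have : (mm i'.+1 <= mm i)%N by rewrite /mm leq_mul2l MM_mono ?orbT.
by move: j2 na wa qw; clear; lia.
Qed.

Lemma ferr_le u v P : `|u| <= `|v| -> ferr u P <= ferr v P.
Proof.
by move=> uv; rewrite ler_wpM2r ?invr_ge0 ?exprn_ge0 // lerD2r ler_wpM2l ?exprn_ge0 // ler_wpM2l.
Qed.

(** The end 2^n / 8 of the rescaled time interval is a multiple of the period 2^ww, so a cluster
    starting at or before [t] belongs to a period lying entirely inside; no end point of the curve
    enters the blow-up. *)
Lemma gadget_range t i h (n := nn i) : t <= 1 / 8 -> gadget i h <= 2 ^+ n * t ->
  forall u, `|u| <= 2 ^+ (ww i - 2) - 1 -> 0 <= (gadget i h + u) / 2 ^+ n <= 1 / 8.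
Proof.
move=> t8 ht u /ler_normlP[u1 u2]; have p : 0 < 2 ^+ n := pow2_gt0 n.
have w4 : (4 <= ww i)%N by rewrite /ww leq_addl.
have e2 : 2 ^+ (ww i).-1 = 2 * 2 ^+ (ww i - 2) :> R.
  by rewrite -exprS; congr (_ ^+ _); move: w4; clear; lia.
have e3 : 2 ^+ ww i = 2 * 2 ^+ (ww i).-1 :> R.
  by rewrite -exprS; congr (_ ^+ _); move: w4; clear; lia.
have p2 := pow2_gt0 (ww i - 2).
have g0 : gadget i h = 2 ^+ ww i * h%:R + 2 ^+ (ww i).-1 by rewrite /gadget natrD natrM !natrX.
have h0 : 0 <= 2 ^+ ww i * h%:R :> R by rewrite mulr_ge0 ?exprn_ge0.
apply/andP; split; first by rewrite divr_ge0 ?(ltW p) //; lra.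
rewrite ler_pdivrMr //.
have wn : (ww i + 3 <= n)%N.
  have h1 : (ww i < NN i)%N.
    by apply: leq_trans (leq_addl _ _); apply: leq_trans (BB_AA e1 i); rewrite /BB addSn ltnS leq_addl.
  apply: (@leq_trans (4 * NN i)); last by rewrite leq_mul2r d4 orbT.
  by move: h1; clear; lia.
have nE : 2 ^+ n = 2 ^+ ww i * 2 ^+ (n - 3 - ww i) * 8 :> R.
  have -> : 8 = 2 ^+ 3 :> R by rewrite !exprS expr0; lra.
  by rewrite -!exprD; congr (_ ^+ _); move: wn; clear; lia.
have pw := pow2_gt0 (ww i).
have t2 : 2 ^+ n * t <= 2 ^+ n * (1 / 8) by rewrite ler_pM2l.
have hh : (h < 2 ^ (n - 3 - ww i))%N.
  by rewrite -(ltr_nat R) natrX -(ltr_pM2l pw); lra.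
have : h.+1%:R <= 2 ^+ (n - 3 - ww i) :> R by rewrite -natrX ler_nat.
have -> : h.+1%:R = h%:R + 1 :> R by rewrite natr1.
by rewrite -(ler_pM2l pw) mulrDr mulr1; lra.
Qed.

Lemma curve_tangent t k : 0 <= t <= 1 / 8 -> rich t k -> Tan curve (ghat t) (range (Fvec k)).
Proof.
move=> tI; have /andP[t0 t8] := tI; move=> /rich_sequence[I [Ilt hI]].
have l0 := lam_gt0; have l1 := lam_gt1; have C0 := holder_const_ge0.
have d0 : (0 < d)%N by apply: leq_trans d4.
pose r m := lam ^- nn (I m).
have r0 m : 0 < r m by rewrite invr_gt0 exprn_gt0.
apply: (@Tan_intro _ _ _ _ _ r) => //.
- by exists t.
- exact: Fvec_closed.
- by exists 0; rewrite ?Fvec0.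
- move=> m; rewrite lef_pV2 ?posrE ?exprn_gt0 // ler_weXn2l ?ltW //.
  by rewrite /nn leq_pmul2l //; apply/ltnW/NN_mono.
- move=> z z0; have [N HN] := pow_small l1 z0; exists N; apply: HN.
  by have [_ _ h _] := hI N; exact: leq_trans h (ww_nn _).
(* This choice makes images at distance at most R0 lam^-n, with n = [nn i], closer than lam^-(n -
   q)/64, as [close_before] requires; the successor keeps [q] positive. *)
move=> R0 z R00 z0; have [q0 Hq] := pow_unbounded (64 * R0 + 1) l1.
pose q := q0.+1; pose K : R := (4 * d)%:R * 3.
have K0 : 0 < K by rewrite mulr_gt0 // ltr0n muln_gt0.
have V0 : 0 <= Fbound R0 by rewrite /Fbound addr_ge0 // powR_ge0.
have q2 : 0 <= 2 ^+ q :> R by rewrite exprn_ge0.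
(* The window contains both the times found by [close_before] and the parameters of the points of
   the tangent in the ball of radius [R0]. *)
pose W : R := 2 ^+ q + 1 + Fbound R0; have W0 : 0 <= W by rewrite /W; lra.
have zK : 0 < z / 2 / K by rewrite !divr_gt0.
have zC : 0 < z / 2 / (holder_const + 1) by rewrite !divr_gt0 // ltr_wpDl.
have [P HP] := ferr_small W zK; have [Nc HC] := pow_small l1 zC.
have [Nw HW] := pow2_lt (W + 1).
exists (((d * P).+1 + Nc + Nw + 2) + q)%N => m mM.
have [_ ik iw [h /andP[g1 g2]]] := hI m; rewrite /r; set i := I m in ik iw g1 g2 *.
have iw' := leq_trans mM iw; have [wP [w1 [w2 w3]]] := window_room iw'.
have p := pow2_gt0 (nn i); have ln := exprn_gt0 (nn i) l0.
set th := gadget i h / 2 ^+ nn i.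
have v2 : 2 ^- ww i <= 1 :> R by rewrite invf_le1 ?exprn_gt0 // exprn_ege1 // ler1n.
have key u : `|u| <= W -> 0 <= (gadget i h + u) / 2 ^+ nn i <= 1 / 8 /\
    edist (lam ^+ nn i *: (ghat ((gadget i h + u) / 2 ^+ nn i) - ghat t)) (Fvec k u) <= z.
  move=> uW; have hu : `|u| <= 2 ^+ (ww i - 2) - 1.
    by rewrite lerBrDr; apply: le_trans (HW _ w2); rewrite lerD2r.
  split; first by apply: gadget_range hu; [exact: t8 | exact: g1].
  have a1 := Fvec_approx h wP hu; rewrite ik -/th in a1.
  have a2 : K * ferr u P <= z / 2.
    apply: le_trans (_ : K * ferr W P <= _); first by rewrite ler_pM2l // ferr_le // (ger0_norm W0).
    by rewrite mulrC -ler_pdivlMr // HP.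
  have a3 : lam ^+ nn i * edist (ghat th) (ghat t) <= z / 2.
    have c1 : `|th - t| <= 2 ^- ww i / 2 ^+ nn i.
      rewrite ler_pdivlMr // -{1}(gtr0_norm p) -normrM mulrBl /th divfK ?gt_eqF //.
      by rewrite distrC ger0_norm; lra.
    have c2 : `|th - t| <= 1.
      apply: le_trans c1 _; rewrite ler_pdivrMr // mul1r; apply: le_trans v2 _.
      by rewrite exprn_ege1 // ler1n.
    have := ghat_holder c2; rewrite -(ler_pM2l ln) => c3; apply: le_trans c3 _.
    apply: (@le_trans _ _ (holder_const * lam ^- ww i)); last first.
      have h2 : holder_const * lam ^- ww i <= (holder_const + 1) * lam ^- ww i.
        by rewrite ler_pM2r ?invr_gt0 ?exprn_gt0 // lerDl.
      apply: le_trans h2 _; rewrite mulrC -ler_pdivlMr ?ltr_wpDl //; apply: HC.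
      by move: iw'; clear; lia.
    rewrite mulrCA ler_wpM2l //.
    have -> : lam ^- ww i = lam ^+ nn i * (2 ^- ww i / 2 ^+ nn i) `^ s^-1.
      by rewrite lam_scale ?invr_ge0 ?exprn_ge0 // pow_inv.
    rewrite ler_pM2l //; apply: ge0_ler_powR c1; rewrite ?nnegrE ?invr_ge0 //.
    by have := s1; move=> ?; lra.
  apply: le_trans (edist_triangle (lam ^+ nn i *: (ghat ((gadget i h + u) / 2 ^+ nn i) - ghat th)) _ _) _.
  rewrite (edist_scale_sub _ _ _ ln) [z]splitr.
  by apply: lerD => //; apply: le_trans a1 a2.
split.
  move=> _ [t' t'I <-]; have /andP[t'0 t'8] := t'I; move=> hy.
  have tt : `|t - t'| <= 1 / 8 by apply: dist_itv.
  have qw : (q <= ww i)%N by [].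
  have qn : (q <= nn i)%N := leq_trans qw (ww_nn i).
  have := @close_before i q t t' isT qw tt; rewrite edistC => /(_ _)h1.
  have {h1} : `|t - t'| <= 2 ^+ q / 2 ^+ nn i.
    apply: h1; apply: le_lt_trans hy _.
    rewrite -{1}(subnK qn) exprD invfM mulrCA ltr_pM2l ?invr_gt0 ?exprn_gt0 //.
    rewrite ltr_pdivrMr ?exprn_gt0 // mulrC ltr_pdivlMr //.
    by have := Hq q (leqnSn _); move=> ?; lra.
  rewrite ler_pdivlMr // -{1}(gtr0_norm p) -normrM mulrBl => /ler_normlP[b1 b2].
  pose u := 2 ^+ nn i * t' - gadget i h.
  have uW : `|u| <= W by rewrite /W ler_norml /u; apply/andP; split; lra.
  have tu : (gadget i h + u) / 2 ^+ nn i = t' by rewrite /u addrC subrK mulrC mulKf ?gt_eqF.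
  have [_ h1] := key u uW; rewrite tu in h1.
  by exists (Fvec k u); [exists u | rewrite invrK].
move=> _ [u _ <-] ur; have uW : `|u| <= W.
  by apply: le_trans (Fvec_proper ur) _; rewrite /W lerDr addr_ge0.
have [h1 h2] := key u uW; exists (ghat ((gadget i h + u) / 2 ^+ nn i)).
  by exists ((gadget i h + u) / 2 ^+ nn i).
by rewrite invrK edistC.
Qed.

(** * Times without enough tangents *)

Definition dyadic_cover (N : set R) b (L : seq nat) := forall t, N t ->
  exists2 c, c \in L & c%:R <= 2 ^+ b * t <= c%:R + 1.

Lemma dyadic_refine N b a L (bad : pred nat) : dyadic_cover N b L ->
  (forall t c x, N t -> (x < 2 ^ a)%N -> bad x ->
    ~ (c * 2 ^ a + x)%N%:R <= 2 ^+ (b + a) * t <= (c * 2 ^ a + x)%N%:R + 1) ->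
  dyadic_cover N (b + a) [seq (c * 2 ^ a + x)%N | c <- L, x <- seq.filter (predC bad) (iota 0 (2 ^ a))].
Proof.
move=> hL hbad t Nt; have [c cL /andP[c1 c2]] := hL t Nt.
have p := pow2_gt0 a; set q : R := 2 ^+ a in p.
have qn : (2 ^ a)%:R = q by rewrite natrX.
pose y := q * (2 ^+ b * t) - q * c%:R.
have y0 : 0 <= y by rewrite subr_ge0 ler_pM2l.
have y1 : y <= q.
  have h : q * (2 ^+ b * t) <= q * (c%:R + 1) by rewrite ler_pM2l.
  by move: h; rewrite mulrDr mulr1 /y; lra.
have [x [xq x1 x2]] : exists x, [/\ (x < 2 ^ a)%N, x%:R <= y & y <= x%:R + 1].
  have [yq|yq] := ltP y q.
    have [f1 f2] := floor_bounds y; have f0 : 0 <= Num.floor y by rewrite floor_ge_int.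
    have E : (absz (Num.floor y))%:R = (Num.floor y)%:~R :> R.
      by rewrite -[in RHS](gez0_abs f0).
    exists (absz (Num.floor y)); rewrite E; split=> //; last exact: ltW.
    by rewrite -(ltr_nat R) E qn; lra.
  have q1 : (0 < 2 ^ a)%N by rewrite expn_gt0.
  have E : (2 ^ a).-1%:R + 1 = q by rewrite natr1 prednK.
  by exists (2 ^ a).-1; split; [rewrite prednK | lra | lra].
have E : (c * 2 ^ a + x)%N%:R = q * c%:R + x%:R :> R by rewrite natrD natrM qn mulrC.
have In : (c * 2 ^ a + x)%N%:R <= 2 ^+ (b + a) * t <= (c * 2 ^ a + x)%N%:R + 1.
  by rewrite E exprD mulrAC [_ * q]mulrC -/q; move: x1 x2; rewrite /y => *; apply/andP; split; lra.
exists (c * 2 ^ a + x)%N => //; apply/allpairsP; exists (c, x); split=> //=.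
rewrite mem_filter mem_iota /= add0n xq andbT; apply/negP => bx.
exact: (hbad t c x Nt xq bx In).
Qed.

(** While [k] and [M] fix the number of loops and the width, [z] runs through infinitely many blocks
    of this same shape, so each removes the same proportion of times. *)
Definition type_index k M z := (2 ^ k * 3 ^ M * 5 ^ z).-1.

Lemma type_indexP k M z : [/\ kk (type_index k M z) = k, ww (type_index k M z) = (k + M + 4)%N,
  (z <= type_index k M z)%N & (type_index k M z < type_index k M z.+1)%N].
Proof.
have p2 : (0 < 2 ^ k)%N by rewrite expn_gt0. have p3 : (0 < 3 ^ M)%N by rewrite expn_gt0.
have p5 : (0 < 5 ^ z)%N by rewrite expn_gt0.
have E : (type_index k M z).+1 = (2 ^ k * 3 ^ M * 5 ^ z)%N by rewrite prednK // !muln_gt0 p2 p3.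
have E' : (type_index k M z.+1).+1 = (5 * (type_index k M z).+1)%N.
  by rewrite E prednK ?expnS ?[(5 * 5 ^ z)%N]mulnC ?[(5 * (_ * _))%N]mulnC ?mulnA // !muln_gt0 p2 p3 p5.
have M3 : (z < 5 ^ z)%N by rewrite ltn_expl.
have k2 : kk (type_index k M z) = k.
  by rewrite /kk E !lognM ?muln_gt0 ?p2 // !lognX /= muln1 !muln0 !addn0.
split=> //; last by rewrite -ltnS E'; lia.
  by rewrite /ww k2 E !lognM ?muln_gt0 ?p2 // !lognX /= !muln0 muln1 add0n addn0.
by rewrite -ltnS E (leq_trans M3) // leq_pmull // muln_gt0 p2.
Qed.

Definition poor k M : set R := [set t | 0 <= t <= 1 / 8 /\
  forall z, (M <= z)%N -> ~ good t (type_index k M z)].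

Lemma not_rich t k : 0 <= t <= 1 / 8 -> ~ rich t k -> exists M, poor k M t.
Proof.
move=> tI /existsNP[M hM]; exists M; split => // z Mz gz; apply: hM.
have [h1 h2 h3 _] := type_indexP k M z; exists (type_index k M z); split => //.
  exact: leq_trans Mz h3.
by rewrite h2; lia.
Qed.

Lemma room_before i j : (i < j)%N -> (nn i + ww i <= nn j - ww j)%N /\ (ww j <= nn j)%N.
Proof.
move=> ij; have [a [b [na mb wa wb]]] := nn_mm i; have [a' [b' [na' mb' wa' wb']]] := nn_mm j.
have h : (mm i.+1 <= mm j)%N by rewrite /mm leq_mul2l MM_mono ?orbT.
by move: h na mb wa wb na' wa'; clear; lia.
Qed.

(** Intervals are first refined to whole periods, of length 2^-(nn i - w), and then to length 2^-(nn
    i + w). Of the 2^(2w) pieces of a period, the one right after the start of the cluster consists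
    of good times and is dropped. The proportion lost is the same for every [z], so the covers
    shrink geometrically. *)
Lemma poor_cover k M (w := (k + M + 4)%N) Z : exists b L,
  [/\ dyadic_cover (poor k M) b L, (Z <= b)%N,
      (b <= nn (type_index k M (M + Z)) - w)%N &
      (size L)%:R <= 2 ^+ b * (1 - 2 ^- (2 * w)) ^+ Z :> R].
Proof.
elim: Z => [|Z [b [L [cov Zb bi sL]]]].
  exists 0%N, [:: 0%N]; split=> //; last by rewrite /= !expr0 mulr1.
  move=> t [/andP[t0 t8] _]; exists 0%N; rewrite ?inE // expr0 mul1r add0r.
  by apply/andP; split; lra.
set i := type_index k M (M + Z) in bi; have [ik iw _ ilt] := type_indexP k M (M + Z).
have [r1 _] := room_before ilt; have := ww_nn i; rewrite -/i iw -/w in r1 * => wn.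
have [_ iw' _ _] := type_indexP k M (M + Z).+1; rewrite iw' -/w in r1.
have [a ab] : exists a, (b + a = nn i - w)%N by exists (nn i - w - b)%N; rewrite subnKC.
have cov1 := @dyadic_refine _ _ a L pred0 cov (fun _ _ _ _ _ h => False_ind _ (notF h)).
set L1 := (X in dyadic_cover _ _ X) in cov1.
have bE : (b + a + 2 * w = nn i + w)%N by move: ab wn; clear; lia.
have w1 : (0 < 2 * w)%N by rewrite /w addnS muln_gt0.
pose bad : pred nat := fun x => x == (2 ^ (2 * w).-1)%N.
have hbad t c x : poor k M t -> (x < 2 ^ (2 * w))%N -> bad x ->
    ~ (c * 2 ^ (2 * w) + x)%N%:R <= 2 ^+ (b + a + 2 * w) * t <= (c * 2 ^ (2 * w) + x)%N%:R + 1.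
  move=> [_ /(_ (M + Z)%N (leq_addr _ _)) ng] _ /eqP-> h; apply: ng; exists c.
  have pw := pow2_gt0 w.
  have gE : gadget i c * 2 ^+ w = (c * 2 ^ (2 * w) + 2 ^ (2 * w).-1)%N%:R.
    rewrite /gadget iw -/w -natrX -natrM; congr (_%:R).
    rewrite mulnDl mulnAC -expnD -expnD mulnC addnn -mul2n; congr (_ + 2 ^ _)%N.
    by move: w1; rewrite /w; clear; lia.
  move: h; rewrite bE exprD mulrAC -gE -/i iw -/w => /andP[h1 h2]; apply/andP; split.
    by rewrite -(ler_pM2r pw).
  by rewrite -(ler_pM2r pw) mulrDl mulVf ?gt_eqF.
have cov2 := dyadic_refine cov1 hbad; rewrite bE in cov2.
set L2 := (X in dyadic_cover _ _ X) in cov2; exists (nn i + w)%N, L2; split=> //.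
- by move: Zb ab wn; rewrite /w; clear; lia.
- by rewrite addnS.
have sz1 : size L1 = (size L * 2 ^ a)%N by rewrite size_allpairs filter_predT size_iota.
have sz2 : size L2 = (size L1 * (2 ^ (2 * w)).-1)%N.
  rewrite size_allpairs; congr (_ * _)%N.
  have := count_predC bad (iota 0 (2 ^ (2 * w))); rewrite size_iota size_filter.
  rewrite (eq_count (_ : bad =1 pred1 (2 ^ (2 * w).-1)%N)) // count_uniq_mem ?iota_uniq // mem_iota /=.
  have lt1 : (2 ^ (2 * w).-1 < 2 ^ (2 * w))%N by rewrite ltn_exp2l // ltn_predL.
  by rewrite add0n lt1 add1n => /(congr1 predn).
rewrite sz2 sz1 !natrM natrX.
have E : (2 ^ (2 * w)).-1%:R = 2 ^+ (2 * w) * (1 - 2 ^- (2 * w)) :> R.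
  have h : (2 ^ (2 * w)).-1%:R + 1 = 2 ^+ (2 * w) :> R by rewrite natr1 prednK ?natrX // expn_gt0.
  by rewrite mulrBr mulr1 mulfV ?gt_eqF ?pow2_gt0 // -h addrK.
have p1 := pow2_gt0 a; have p2 := pow2_gt0 (2 * w).
have v1 : 0 <= 1 - 2 ^- (2 * w) :> R by rewrite subr_ge0 invf_le1 // exprn_ege1 // ler1n.
rewrite E -bE (exprD _ (b + a)) (exprD _ b) exprS.
set q : R := 2 ^+ (2 * w) in p2 v1 *; set x : R := 1 - q^-1 in v1 *.
have sL' : (size L)%:R <= 2 ^+ b * x ^+ Z := sL.
have -> : 2 ^+ b * 2 ^+ a * q * (x * x ^+ Z) = 2 ^+ b * x ^+ Z * (2 ^+ a * (q * x)) by ring.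
by rewrite -mulrA ler_wpM2r // !mulr_ge0 // ltW.
Qed.

(** By the Hölder bound a time interval of length 2^-b has an image whose diameter to the power s is
    at most a constant times 2^-b. The cost of a cover is thus the proportion of intervals left, and
    there are only countably many pairs (k, M). *)
Lemma not_rich_null A : A `<=` ghat @` [set t | 0 <= t <= 1 / 8 /\ exists k, ~ rich t k] ->
  hausdorff s A = 0%E.
Proof.
move=> sub.
have s0 : 0 < s by have := s1; move=> ?; lra.
pose km n : nat * nat := odflt (0%N, 0%N) (unpickle n).
apply: (@hausdorff_null_union _ _ _ _ (fun n => ghat @` poor (km n).1 (km n).2)) => //.
  move=> _ /sub[t [tI [k nr]] <-]; have [M hM] := not_rich tI nr.
  by exists (pickle (k, M)) => //; exists t; rewrite // /km pickleK.
move=> n dl z dl0 z0; case: (km n) => k M /=; set w := (k + M + 4)%N.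
have C0 : 0 < holder_const + 1 by rewrite ltr_wpDl // holder_const_ge0.
have l0 := lam_gt0; have l1 := lam_gt1.
have p := pow2_gt0 (2 * w).
have x1 : 1 < (1 - 2 ^- (2 * w))^-1 :> R.
  have h : 2 ^- (2 * w) < 1 :> R by rewrite invf_lt1 // exprn_egt1 ?ltr1n // /w addnS muln_eq0.
  have h' : 0 < 2 ^- (2 * w) :> R by rewrite invr_gt0.
  by rewrite invf_gt1; lra.
have [Z1 H1] := pow_small x1 (divr_gt0 z0 (powR_gt0 s C0)).
have [Z2 H2] := pow_small l1 (divr_gt0 dl0 C0).
have [b [L [cov Zb _ sL]]] := poor_cover k M (Z1 + Z2).
exists (size L), (fun q => ghat @` [set t | 0 <= t <= 1 / 8 /\
  (nth 0%N L q)%:R <= 2 ^+ b * t <= (nth 0%N L q)%:R + 1]), ((holder_const + 1) * lam ^- b).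
have pb := pow2_gt0 b.
split.
- move=> _ [t pt <-]; have [c cL hc] := cov t pt.
  exists (index c L); first by rewrite index_mem.
  by exists t => //; rewrite nth_index //; split => //; have [] := pt.
- move=> q _ _ [t [/andP[t0 t8] /andP[t1 t2]] <-] [u [/andP[u0 u8] /andP[u1 u2]] <-].
  have h : `|t - u| <= 2 ^- b.
    rewrite -[leRHS]mul1r ler_pdivlMr // -{1}(gtr0_norm pb) -normrM mulrBl.
    by rewrite ler_norml; apply/andP; split; lra.
  have h1 : `|t - u| <= 1 by rewrite ler_norml; apply/andP; split; lra.
  apply: le_trans (ghat_holder h1) _; apply: ler_pM; rewrite ?holder_const_ge0 ?powR_ge0 ?lerDl //.
  apply: pow_le1 => //; apply: le_trans (_ : 2 ^+ b * 2 ^- b <= 1); last by rewrite mulfV ?gt_eqF.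
  by rewrite ler_pM2l.
- by rewrite mulr_ge0 ?invr_ge0 ?exprn_ge0 // ltW.
- by rewrite mulrC -ler_pdivlMr // H2 // (leq_trans (leq_addl _ _) Zb).
rewrite powRM ?(ltW C0) ?invr_ge0 ?exprn_ge0 ?(ltW l0) //.
have -> : (lam ^- b) `^ s = 2 ^- b by rewrite -pow_inv powR_sV // invr_ge0 exprn_ge0.
apply: le_trans (_ : 2 ^+ b * (1 - 2 ^- (2 * w)) ^+ (Z1 + Z2) * ((holder_const + 1) `^ s * 2 ^- b) <= _).
  by rewrite ler_wpM2r // mulr_ge0 ?powR_ge0 ?invr_ge0 ?exprn_ge0.
have := H1 _ (leq_addr Z2 Z1); rewrite exprVn invrK ler_pdivlMr ?powR_gt0 // => h.
by rewrite [_ / 2 ^+ b]mulrC mulrACA mulfV ?gt_eqF // mul1r.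
Qed.

(** The two times share the line position, while their loop coordinates 0 and 1 enter the waves only
    through integer multiples, where the waves vanish. *)
Lemma Fvec_cross k q : (q < k)%N -> Fvec k q%:R = Fvec k (q%:R + 1 / 2).
Proof.
move=> qk; have [||x0 y0] := @path_loop R k q 0 qk; [lra|lra|].
have [||x1 y1] := @path_loop R k q (1 / 2) qk; [lra|lra|].
rewrite mulr0 sub0r max_l ?addr0 in x0; last lra; rewrite mulr0 addr0 min_r ?ler01 // in y0.
rewrite [in Num.max _ _](_ : 2 * (1 / 2) - 1 = 0 :> R) ?maxxx ?addr0 in x1; last lra.
rewrite (_ : 2 * (1 / 2) = 1 :> R) ?minxx in y1; last lra.
apply/rowP => j; rewrite !mxE; congr (limn _); apply/funext => P; congr (_ * _).
apply: eq_bigr => p _; rewrite /lterm x0 x1 y0 y1; congr (_ * _).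
case: ifP => // _; case: ifP => // _.
rewrite mulr0 mulr1 (_ : 0 = 0%:~R :> R) // wave_int.
by rewrite (_ : 2 ^+ _ = (2 ^+ (j %% d + d * (p - P)) * 1)%:~R :> R) ?wave_int // intr_pow2M mulr1.
Qed.

Lemma hausdorff_set0 n : hausdorff s (set0 : set 'rV[R]_n) = 0%E.
Proof.
have s0 : 0 < s by have := s1; move=> ?; lra.
apply: (@hausdorff_null_union _ _ _ _ (fun _ => set0)) => // _ dl z dl0 z0.
exists 0%N, (fun _ => set0), 0; split=> //; first exact: ltW.
by rewrite mul0r ltW.
Qed.

Lemma curve_theorem : let g := fun t : R => ghat (t / 8) in
  holder01 g s^-1 /\
  let G := g @` [set t : R | 0 <= t <= 1] in
  (0 < hausdorff s G)%E /\
  hae s G (fun x => exists T : nat -> set 'rV[R]_(4 * d),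
     (forall k, Tan G x (T k)) /\
     (forall i j, i <> j -> ~ homeomorphic (T i) (T j))) /\
  hae s G (fun x => exists T : set 'rV[R]_(4 * d), Tan G x T /\
     forall (n : nat) (Q : set 'rV[R]_n),
       self_similar Q -> hdim Q = s%:E ->
       hausdorff s [set z | Q z /\ exists T', Tan Q z T' /\ bilip_equiv T T'] = 0%E).
Proof.
(* The time is compressed to [0, 1/8] because the separation of images is available for times at
   most 1/8 apart. *)
move=> g; have si : 0 < s^-1 by rewrite invr_gt0; have := s1; move=> ?; lra.
have C0 := holder_const_ge0.
have -> : g @` [set t : R | 0 <= t <= 1] = curve.
  apply/seteqP; split=> [_ [t /= /andP[t0 t1] <-]|_ [t /= /andP[t0 t1] <-]].
    by exists (t / 8) => //=; apply/andP; split; lra.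
  by exists (8 * t) => /=; [apply/andP; split; lra | rewrite /g mulrC mulKf].
split.
  exists holder_const => t u /andP[t0 t1] /andP[u0 u1]; rewrite /g.
  have E : t / 8 - u / 8 = (t - u) / 8 by lra.
  have le8 : `|t / 8 - u / 8| <= `|t - u|.
    by rewrite E normrM ler_piMr // gtr0_norm ?invf_le1 ?invr_gt0 ?ltr0n // ler1n.
  apply: le_trans (ghat_holder _) _.
    by apply: le_trans le8 _; rewrite ler_norml; apply/andP; split; lra.
  by rewrite ler_wpM2l //; apply: ge0_ler_powR le8; rewrite ?nnegrE // ltW.
split; first exact: curve_positive.
split; apply: not_rich_null => _ [[t /= tI <-] nP]; exists t => //; split => //; apply: contrapT => /forallNP all_rich; apply: nP.
  exists (fun k => range (Fvec k)); split=> [k|i j].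
    by apply: curve_tangent => //; exact: contrapT (all_rich k).
  exact: (not_homeomorphic si C0 Fvec_holder Fvec_lower Fvec_cross).
exists (range (Fvec 1)); split=> [|n Q ssQ _].
  by apply: curve_tangent => //; exact: contrapT (all_rich 1).
(* The exceptional set is empty: no tangent of a self-similar set is bi-Lipschitz to the curve with
   one loop. *)
rewrite (_ : mkset _ = set0) ?hausdorff_set0 // -subset0 => z [_ [T' [tanQ bi]]].
exact: (not_bilip si C0 Fvec_holder Fvec_lower Fvec_cross ssQ tanQ bi).
Qed.

End Curve.

Theorem theorem1p4 (R : realType) (s : R) : 1 < s ->
  exists (N : nat) (g : R -> 'rV[R]_N),
    holder01 g s^-1 /\
    let G := g @` [set t : R | 0 <= t <= 1] in
    (0 < hausdorff s G)%E /\
    hae s G (fun x => exists T : nat -> set 'rV[R]_N,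
       (forall k, Tan G x (T k)) /\
       (forall i j, i <> j -> ~ homeomorphic (T i) (T j))) /\
    hae s G (fun x => exists T : set 'rV[R]_N, Tan G x T /\
       forall (n : nat) (Q : set 'rV[R]_n),
         self_similar Q -> hdim Q = s%:E ->
         hausdorff s [set z | Q z /\ exists T', Tan Q z T' /\ bilip_equiv T T'] = 0%E).
Proof.
move=> s1; have l1 := lam_gt1 s1; have m1 := mu_gt1 s1.
have [d1 h1] := pow_unbounded 512 l1; have [d2 h2] := pow_unbounded 512 m1.
pose d := (4 + d1 + d2)%N.
have d4 : (4 <= d)%N by rewrite /d -addnA leq_addr.
have b5 : 512 <= (2 `^ s^-1) ^+ d by apply: h1; rewrite /d -addnA addnCA leq_addr.
have g5 : 512 <= (2 / 2 `^ s^-1) ^+ d by apply: h2; rewrite /d leq_addl.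
have g1 : 1 < (2 / 2 `^ s^-1) ^+ d by apply: lt_le_trans g5; rewrite ltr1n.
have [e he] := pow_unbounded (2 ^+ d.+2 * (2 / 2 `^ s^-1) ^+ d * (2 `^ s^-1) ^+ d) g1.
(* The bound [he] holds for all larger exponents, so [e.+1] provides a positive one. *)
exists (4 * d)%N, (fun t => ghat s d e.+1 (t / 8)).
apply: (curve_theorem s1 d4 (ltn0Sn e) b5 g5); exact: he.
Qed.
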